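(* Consider the system $x_{t+1}=f(x_t,u_t,w_t)$, $y_t=g(x_t,u_t)$, $t=0,\dots,T-1$, with $f:\mathbb{R}^n\times\mathcal{U}\times\mathbb{R}^d\to\mathbb{R}^n$, $g:\mathbb{R}^n\times\mathcal{U}\to\mathbb{R}^r$, states $x_t\in\mathbb{R}^n$, control inputs $u_t\in\mathcal{U}\subset\mathbb{R}^m$, disturbances $w_t\in\mathbb{R}^d$ and observations $y_t\in\mathbb{R}^r$. Let $\tau>0$ be the input memory length, $\mathbf{U}_t^{(\tau)}=(u_t,\dots,u_{t-\tau})\in(\mathcal{U})^{\tau+1}$, and $\Phi=[\phi_1~\cdots~\phi_M]^T$ with basis functions $\phi_i:(\mathbb{R}^m)^{\tau+1}\to\mathbb{R}$. Let $\mathcal{F}_t=\sigma\{x_0,x_1,\dots,x_t\}$. Suppose that the following hold. (Lipschitz continuity) There exists $L>0$ such that $\|g(x,u)-g(\tilde x,\tilde u)\|_2\le L(\|x-\tilde x\|_2+\|u-\tilde u\|_2)$ for all $x,\tilde x\in\mathbb{R}^n$, $u,\tilde u\in\mathcal{U}$. For $k\ge1$, let $f^{(k)}$ be the $k$-fold composition of the dynamics, mapping $(x_{t-k},u_{t-k},\dots,u_{t-1},w_{t-k},\dots,w_{t-1})$ to $x_t$; there are $C>0$ and $0<\rho<1$ such that, for every $k\ge1$ and with any later inputs $u_{t-k+1},\dots,u_{t-1}\in\mathcal{U}$ and later disturbances $w_{t-k+1},\dots,w_{t-1}\in\mathbb{R}^d$ held fixed, replacing $(x_{t-k},u_{t-k},w_{t-k})$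 by any $(\tilde x_{t-k},\tilde u_{t-k},\tilde w_{t-k})\in\mathbb{R}^n\times\mathcal{U}\times\mathbb{R}^d$ changes the value of $f^{(k)}$ by at most $C\rho^k(\|x_{t-k}-\tilde x_{t-k}\|_2+\|u_{t-k}-\tilde u_{t-k}\|_2+\|w_{t-k}-\tilde w_{t-k}\|_2)$ in $\ell_2$-norm. Moreover $f(0,0,0)=0$. (Basis functions) $|\phi_i(\mathbf{U})-\phi_i(\tilde{\mathbf{U}})|\le L_\phi\|\mathbf{U}-\tilde{\mathbf{U}}\|_2$ for all $i=1,\dots,M$ and all $\mathbf{U},\tilde{\mathbf{U}}\in(\mathcal{U})^{\tau+1}$; there exists a universal constant $\lambda>0$ such that $\mathbb{E}[\Phi(\mathbf{U}_t^{(\tau)})\Phi(\mathbf{U}_t^{(\tau)})^T]\succeq\lambda^2I_M$ for all $t\ge\tau$; and $\Phi(0)=0$. (Sub-Gaussian control inputs) $u_0,\dots,u_{T-1}$ are independent of each other and there is a finite $\sigma_u>0$ such that $\|u_t\|_{\psi_2}\le\sigma_u$ for all $t=0,\dots,T-1$. (Sub-Gaussian disturbances) There exists $\sigma_w>0$ such that $\|x_0\|_{\psi_2}\le\sigma_w$ and, conditioned on $\mathcal{F}_t$, $\|w_t\|_{\psi_2}\le\sigma_w$ for all $t=0,\dots,T-1$ and $\mathcal{F}_t$. (Probabilistic adversarial attack) $w_t$ is an adversarial attack at each time $t$ with probability $p<\frac{1}{2\tau}$ conditioned on $\mathcal{F}_t$; i.e., there exists a sequence $(\xi_t)_{t\ge0}$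 of independent $\mathrm{Bernoulli}(p)$ variables such that $\{\xi_t=0\}\subseteq\{w_t=0\}$ for all $t\ge0$. Consider $\nu:=\frac{\sqrt{M\tau}\,L_\phi\sigma_u}{\lambda}$ and an approximation tolerance $\bar\epsilon\ge0$. Let $G^*\in\mathbb{R}^{r\times M}$ be any matrix that satisfies $$g(f(\cdots f(0,u_{t-\tau},0),\cdots,u_{t-1},0),u_t)=G^*\cdot\Phi(\mathbf{U}_t^{(\tau)})+\epsilon_t(\mathbf{U}_t^{(\tau)})$$ with $\|\epsilon_t(\mathbf{U}_t^{(\tau)})\|_2\le\bar\epsilon$ for all $t$ (with $t\ge\tau$). Also, let $\hat G_T$ denote a solution to the $\ell_2$-norm estimator $$\hat G_T=\arg\min_{G}\ \sum_{t=\tau}^{T-1}\bigl\|y_t-G\cdot\Phi(\mathbf{U}_t^{(\tau)})\bigr\|_2 .$$ Given $\delta\in(0,1]$, when $$T=\Omega\left(\frac{\tau\nu^8}{(2(1-p)^\tau-1)^2}\left[rM\log\left(\frac{\tau\nu}{2(1-p)^\tau-1}\right)+\log\left(\frac1\delta\right)\right]\right),$$ we have $$\|G^*-\hat G_T\|_F=O\left(\left(\frac{\rho^\tau L}{\lambda}\cdot\frac{\sigma_u+\sigma_w}{1-\rho}+\frac{\bar\epsilon}{\lambda}\right)\cdot\frac{\nu^3}{2(1-p)^\tau-1}\right)$$ with probability at least $1-\delta$.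
   Context: Sub-Gaussian norms: for a scalar random variable $w$, $\|w\|_{\psi_2}=\inf\{c>0:\mathbb{E}[\exp(w^2/c^2)]\le2\}$, and $w$ is sub-Gaussian if this is finite (no zero-mean requirement). A random vector $w\in\mathbb{R}^d$ is sub-Gaussian if $w^Tx$ is sub-Gaussian for every $x\in\mathbb{R}^d$, with norm $\|w\|_{\psi_2}=\sup_{\|x\|_2\le1}\|w^Tx\|_{\psi_2}$; with this definition the paper takes the sub-Gaussian norm of the scalar $\|w\|_2$ to be equal to that of the vector $w$ (citing $w^T\frac{w}{\|w\|_2}=\|w\|_2$). $O(\cdot)$ and $\Omega(\cdot)$ are the usual big-$O$ and big-$\Omega$ notations; the constant $C$ of the Lipschitz assumption is absorbed into them. A hypothesis $T=\Omega(Q)$ means $T\ge cQ$ for a sufficiently large constant $c$. $\|\cdot\|_F$ is the Frobenius norm, $\|\mathbf{U}\|_2$ is the Euclidean norm of the stacked vector, $\sigma\{\cdot\}$ is the generated sigma-algebra, $\succeq$ denotes the positive semidefinite order and $I_M$ is the $M\times M$ identity matrix.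
   Formalization: The formal theorem also assumes that the attack indicators ξ_t are independent of all control inputs and that each u_t is independent of F_t, and it replaces the logarithm in the condition on T by max(1, log); the claim fails without these. *)

(* Defs.v *)
From HB Require Import structures.
From mathcomp Require Export all_boot all_order all_algebra finmap.
From mathcomp Require Export all_classical all_reals all_analysis.
From mathcomp Require Export measurable_realfun measurable_structure.
Export Order.TTheory GRing.Theory Num.Theory.
Export numFieldNormedType.Exports.

Set Implicit Arguments.
Unset Strict Implicit.
Unset Printing Implicit Defensive.

Global Open Scope classical_set_scope.
Global Open Scope ring_scope.

(* Entrywise l2 norm: the Euclidean norm of a column vector and the Frobenius
   norm of a matrix.  (The library norm on matrices is the sup norm.) *)
Definition l2norm (R : realType) (a b : nat) (A : 'M[R]_(a, b)) : R :=
  Num.sqrt (\sum_(i < a) \sum_(j < b) A i j ^+ 2).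

Definition psd (R : realType) (k : nat) (A : 'M[R]_k) : Prop :=
  A^T = A /\ forall v : 'cV[R]_k, 0 <= (v^T *m A *m v) 0 0.

Section Dynamics.
Context (R : realType) (n m d : nat).
Implicit Types (f : 'cV[R]_n -> 'cV[R]_m -> 'cV[R]_d -> 'cV[R]_n)
  (U : set 'cV[R]_m).

(* f^(k): k steps of the dynamics from state x; us 0, ws 0 are the earliest
   (first applied) input and disturbance, us k.-1, ws k.-1 the latest. *)
Fixpoint flow f (k : nat) (x : 'cV[R]_n) (us : nat -> 'cV[R]_m)
    (ws : nat -> 'cV[R]_d) : 'cV[R]_n :=
  if k is k'.+1 then f (flow f k' x us ws) (us k') (ws k') else x.

Definition contracting_dynamics f U (C rho : R) : Prop :=
  forall (k : nat) (x x' : 'cV[R]_n) (us us' : nat -> 'cV[R]_m)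
      (ws ws' : nat -> 'cV[R]_d),
    (0 < k)%N ->
    (forall i, (i < k)%N -> U (us i) /\ U (us' i)) ->
    (forall i, (0 < i < k)%N -> us' i = us i /\ ws' i = ws i) ->
    l2norm (flow f k x us ws - flow f k x' us' ws') <=
      C * rho ^+ k * (l2norm (x - x') + l2norm (us 0%N - us' 0%N)
                      + l2norm (ws 0%N - ws' 0%N)).

Definition lipschitz_observation (r : nat)
    (g : 'cV[R]_n -> 'cV[R]_m -> 'cV[R]_r) U (L : R) : Prop :=
  forall x x' u u', U u -> U u' ->
    l2norm (g x u - g x' u') <= L * (l2norm (x - x') + l2norm (u - u')).

End Dynamics.

Section InputWindow.
Context (R : realType) (m tau : nat).

(* A tuple (u_t, ..., u_{t - tau}) is the m x (tau + 1) matrix with these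
   columns, in this order; l2norm is then the norm of the stacked vector. *)
Definition window (us : nat -> 'cV[R]_m) (t : nat) : 'M[R]_(m, tau.+1) :=
  \matrix_(i < m, j < tau.+1) us (t - j)%N i 0.

Definition in_windows (U : set 'cV[R]_m) (W : 'M[R]_(m, tau.+1)) : Prop :=
  forall j, U (col j W).

Definition Phi (M : nat) (phi : 'I_M -> 'M[R]_(m, tau.+1) -> R)
    (W : 'M[R]_(m, tau.+1)) : 'cV[R]_M := \col_i phi i W.

End InputWindow.

Section Probability.
Context d (Omega : measurableType d) (R : realType) (P : probability Omega R).

Definition random_vector (k : nat) (X : Omega -> 'cV[R]_k) : Prop :=
  forall i, measurable_fun [set: Omega] (fun omega => X omega i 0).

(* The sigma-algebra generated by the X i, i in J. *)
Definition sigma_gen d' (S : measurableType d') (I : Type) (J : set I)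
    (X : I -> Omega -> S) : set (set Omega) :=
  <<s [set A | exists2 i, J i &
        exists2 B : set S, measurable B & A = X i @^-1` B] >>.

Definition sigma_vec (k : nat) (J : set nat) (X : nat -> Omega -> 'cV[R]_k)
    : set (set Omega) :=
  sigma_gen (J `*` [set: 'I_k]) (fun ti omega => X ti.1 omega ti.2 0).

Definition filtration (k : nat) (x : nat -> Omega -> 'cV[R]_k) (t : nat) :=
  sigma_vec [set s | (s <= t)%N] x.

Definition independent2 (F G : set (set Omega)) : Prop :=
  forall A B, F A -> G B -> P (A `&` B) = (P A * P B)%E.

Definition mutual_independence (I : choiceType) (F : I -> set (set Omega))
    : Prop :=
  forall (J : {fset I}) (A : I -> set Omega),
    (forall i, i \in J -> F i (A i)) ->
    P (\bigcap_(i in [set` J]) A i) = (\prod_(i <- J) P (A i))%E.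

(* Y is a version of the conditional expectation E[X | F], for a nonnegative
   (possibly non-integrable) X and a sub-sigma-algebra F. *)
Definition cond_expectation (F : set (set Omega)) (X Y : Omega -> \bar R)
    : Prop :=
  [/\ forall omega, (0 <= Y omega)%E,
      forall B : set (\bar R), measurable B -> F (Y @^-1` B) &
      forall A, F A ->
        (\int[P]_(omega in A) Y omega = \int[P]_(omega in A) X omega)%E].

Definition psi2_norm (X : Omega -> R) : \bar R :=
  ereal_inf [set c%:E | c in [set c : R | 0 < c /\
    ('E_P[fun omega => expR (X omega ^+ 2 / c ^+ 2)%R] <= 2%:E)%E]].

Definition psi2_norm_vec (k : nat) (X : Omega -> 'cV[R]_k) : \bar R :=
  ereal_sup [set psi2_norm (fun omega => ((X omega)^T *m v) 0 0) |
    v in [set v : 'cV[R]_k | l2norm v <= 1]].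

(* psi2_norm with E[.] replaced by E[. | F], the bound by 2 holding almost
   surely: the essential supremum of the conditional psi2 norm. *)
Definition cond_psi2_norm (F : set (set Omega)) (X : Omega -> R) : \bar R :=
  ereal_inf [set c%:E | c in [set c : R | 0 < c /\
    exists2 Y : Omega -> \bar R,
      cond_expectation F
        (fun omega => (expR (X omega ^+ 2 / c ^+ 2))%:E) Y &
      {ae P, forall omega, (Y omega <= 2%:E)%E}]].

Definition cond_psi2_norm_vec (F : set (set Omega)) (k : nat)
    (X : Omega -> 'cV[R]_k) : \bar R :=
  ereal_sup [set cond_psi2_norm F (fun omega => ((X omega)^T *m v) 0 0) |
    v in [set v : 'cV[R]_k | l2norm v <= 1]].

(* The convention that the scalar |X|_2 has the same sub-Gaussian norm as the
   vector X is rendered by bounding both norms by s: in general the norm of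
   the scalar can exceed that of the vector by a factor of order sqrt k. *)
Definition subgaussian_le (k : nat) (X : Omega -> 'cV[R]_k) (s : R) : Prop :=
  (psi2_norm_vec X <= s%:E)%E /\
  (psi2_norm (fun omega => l2norm (X omega)) <= s%:E)%E.

Definition cond_subgaussian_le (F : set (set Omega)) (k : nat)
    (X : Omega -> 'cV[R]_k) (s : R) : Prop :=
  (cond_psi2_norm_vec F X <= s%:E)%E /\
  (cond_psi2_norm F (fun omega => l2norm (X omega)) <= s%:E)%E.

Definition second_moment (k : nat) (X : Omega -> 'cV[R]_k) : 'M[R]_k :=
  \matrix_(i, j) fine 'E_P[fun omega => X omega i 0 * X omega j 0].

(* The attack times may not depend on the inputs u_0, ..., u_(T-1): the
   indicators xi are independent of the family of all inputs.  Without this an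
   attacker striking only when the inputs are large defeats the estimator. *)
Definition probabilistic_attack (n m k T : nat) (x : nat -> Omega -> 'cV[R]_n)
    (u : nat -> Omega -> 'cV[R]_m) (w : nat -> Omega -> 'cV[R]_k) (p : R)
    : Prop :=
  exists xi : nat -> {RV P >-> bool},
    [/\ forall t A, distribution P (xi t) A = bernoulli_prob p A,
        mutual_independence
          (fun t : nat => sigma_gen [set t] (fun s => xi s : Omega -> bool)),
        independent2
          (sigma_gen [set: nat] (fun s => xi s : Omega -> bool))
          (sigma_vec [set t | (t < T)%N] u),
        forall t, (t < T)%N ->
          cond_expectation (filtration x t)
            (fun omega => (xi t omega)%:R%:E) (cst p%:E) &
        forall t omega, (t < T)%N -> xi t omega = false -> w t omega = 0].

(* E contains an event of probability at least q; for measurable E this is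
   q <= P E. *)
Definition with_probability_ge (q : R) (E : set Omega) : Prop :=
  exists A : set Omega, [/\ measurable A, A `<=` E & (q%:E <= P A)%E].

End Probability.

Section Rates.
Context (R : realType).

Definition attack_gap (p : R) (tau : nat) : R := 2 * (1 - p) ^+ tau - 1.

Definition nu_ratio (M tau : nat) (Lphi su lambda : R) : R :=
  Num.sqrt (M%:R * tau%:R) * Lphi * su / lambda.

(* The logarithm is floored at 1.  With nu the ratio above, nu ^+ 2 is at least
   M tau / ((tau + 1) ln 2), so the floor only affects constants unless
   M = tau = 1, where the logarithm can be negative. *)
Definition horizon (r M tau : nat) (nu kappa delta : R) : R :=
  tau%:R * nu ^+ 8 / kappa ^+ 2 *
  (r%:R * M%:R * Num.max 1 (ln (tau%:R * nu / kappa)) + ln (1 / delta)).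

Definition error_rate (tau : nat) (rho L lambda su sw epsbar nu kappa : R)
    : R :=
  (rho ^+ tau * L / lambda * ((su + sw) / (1 - rho)) + epsbar / lambda) *
  (nu ^+ 3 / kappa).

End Rates.

Definition l2_minimizer (R : realType) (m r M tau T : nat)
    (phi : 'I_M -> 'M[R]_(m, tau.+1) -> R) (ys : nat -> 'cV[R]_r)
    (us : nat -> 'cV[R]_m) (Ghat : 'M[R]_(r, M)) : Prop :=
  let loss (G : 'M[R]_(r, M)) :=
    \sum_(tau <= t < T) l2norm (ys t - G *m Phi phi (window tau us t)) in
  forall G, loss Ghat <= loss G.

(* Main.v *)
Require Import Defs.
From mathcomp Require Import ring lra zify.

(* Optimality of the estimator gives, for D = Gstar - Ghat,
     sum_t s_t |D Z_t| <= 2 sum_(t clean) |y_t - Gstar Z_t|,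
   where Z_t is the feature vector, s_t = 1 when no attack occurs in
   [t - tau, t - 1] ("t is clean") and s_t = -1 otherwise.  At clean times the
   residual is at most L C rho^tau |x_(t - tau)| + epsbar.

   Lower bound on the left side.  Attack times are independent of the inputs, so
   E[s_t |D Z_t|] = kap E|D Z_t| with kap = 2 (1 - p)^tau - 1, and E|D Z_t| is
   bounded below by its second and fourth moments.  Terms whose indices agree
   modulo tau + 1 are independent, which yields an exponential moment bound and
   a lower tail for fixed D; a net of the unit sphere makes it uniform.

   Upper bound on sum_t |x_t|.  A Lyapunov function V, equivalent to the norm,
   satisfies V(x_(t+1)) <= rho V(x_t) + rho C (|u_t| + |w_t|).  Hence
   Q_t = (1 - rho) sum_(s < t) V(x_s) + V(x_t) has increments at most
   rho C (|u_t| + |w_t|), and exp(theta Q_t) grows at most geometrically in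
   expectation. *)

Set Implicit Arguments.
Unset Strict Implicit.
Unset Printing Implicit Defensive.

(** * Sub-sigma-algebras and independence *)

Section SubSigmaAlgebra.
Import HBNNSimple.
Context d (Omega : measurableType d) (R : realType) (P : probability Omega R).
Local Open Scope ereal_scope.

(** The optimality inequality is deterministic and keeps two sources of randomness apart: the lower
    bound sees only inputs and attack indicators, while the states enter only through their total.
    The adversary may therefore choose [w t] from the past and the current input. A term of sign -1
    comes from the triangle inequality alone, whatever the size of the attack; what must survive is
    [kap > 0], which [p < 1 / (2 * tau)] gives by Bernoulli's inequality. The powers of [nu] come
    from one scale. For [y = |D Z| / (4 * lambda * nu)] with [|D| >= 1/2], the second moment is at
    least [1 / (64 * nu ^+ 2)] while [expR (y ^+ 2)] has mean at most 2, so the mean of [y] is at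
    least of order [nu ^- 3]. The exponential parameter and the mesh of the net are then of order
    [kap / nu ^+ 3], the gain per term is of order [kap ^+ 2 / nu ^+ 6], and the error comes out
    with [nu ^+ 2 / kap]. The bound [nu >= 1/4], forced by the same two moments, absorbs the
    remaining powers. *)

Lemma g_sigma_algebra_sub (G : set (set Omega)) :
  G `<=` measurable -> <<s G >> `<=` @measurable _ Omega.
Proof.
by move=> GM; apply: smallest_sub => //; exact: sigma_algebra_measurable.
Qed.

Lemma g_sigma_measurable_fun (G : set (set Omega)) d' (S : measurableType d')
  (h : Omega -> S) : G `<=` measurable ->
  measurable_fun setT (h : g_sigma_algebraType G -> S) -> measurable_fun setT h.
Proof.
move=> GM mh _ B mB; have mhB := mh measurableT B mB.
exact: (g_sigma_algebra_sub GM) mhB.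
Qed.

(* This replaces conditional expectations: an integral bound on the events of a
   sub-sigma-algebra extends to nonnegative weights measurable for it. *)
Lemma integral_mul_le (G : set (set Omega)) (X h : Omega -> R) (K : R) :
  G `<=` measurable ->
  measurable_fun setT X -> (forall w, 0 <= X w)%R -> (0 <= K)%R ->
  (forall A, <<s G >> A -> \int[P]_(w in A) (X w)%:E <= K%:E * P A) ->
  measurable_fun setT (h : g_sigma_algebraType G -> R) ->
  (forall w, 0 <= h w)%R ->
  \int[P]_w (h w * X w)%:E <= K%:E * \int[P]_w (h w)%:E.
Proof.
move=> GM mX X0 K0 HK mh h0.
have sG := g_sigma_algebra_sub GM.
pose GT := g_sigma_algebraType G.
have mh' : measurable_fun [set: GT] (EFin \o (h : GT -> R)).
  exact/measurable_EFinP.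
pose s n : {nnsfun GT >-> R} := nnsfun_approx measurableT mh' n.
have ms n : measurable_fun setT (s n : Omega -> R).
  by apply: g_sigma_measurable_fun GM _; exact: measurable_funPT.
have s0 n w : (0 <= s n w)%R by exact: fun_ge0.
have cs w : EFin \o s^~ w @ \oo --> (h w)%:E.
  by apply: (cvg_nnsfun_approx measurableT mh') => // x _; rewrite lee_fin.
have nds : nondecreasing_seq (s : (GT -> R)^nat) by exact: nd_nnsfun_approx.
have ndsw w m n : (m <= n)%N -> (s m w <= s n w)%R.
  by move=> mn; have /lefP := nds m n mn; exact.
(* For a simple weight both sides are finite sums over its values, and every level set lies in
   [<<s G >>], where [HK] applies. Monotone convergence then passes to [h]. *)
have step n : \int[P]_w ((s n w)%:E * (X w)%:E) <= K%:E * \int[P]_w (s n w)%:E.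
  have mpre y : measurable (s n @^-1` [set y] : set Omega).
    by rewrite -[X in measurable X]setTI; apply: ms.
  have mind y : measurable_fun setT (\1_(s n @^-1` [set y]) : Omega -> R).
    by apply: measurable_indic; exact: mpre.
  have -> : \int[P]_w ((s n w)%:E * (X w)%:E) =
      \sum_(y \in range (s n)) (y%:E * \int[P]_(w in s n @^-1` [set y]) (X w)%:E).
    transitivity (\int[P]_w (\sum_(y \in range (s n))
        (y * \1_(s n @^-1` [set y]) w)%:E * (X w)%:E)).
      apply: eq_integral => w _; rewrite fimfunE -fsumEFin//.
      rewrite ge0_mule_fsuml// => y.
      rewrite EFinM; exact: nnfun_muleindic_ge0.
    rewrite ge0_integral_fsum//.
    - apply: eq_fsbigr => y /set_mem [w _ <-].
      rewrite (eq_integral (fun w' => (s n w)%:E *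
          ((X w')%:E * (\1_(s n @^-1` [set s n w]) w')%:E))).
        rewrite ge0_integralZl_EFin//.
        + congr (_ * _); rewrite [RHS]integral_mkcond.
          apply: eq_integral => x _; rewrite patchE indicE.
          by case: ifPn => _; rewrite ?mule1 ?mule0.
        + by move=> x _; rewrite mule_ge0 ?lee_fin//.
        + by apply: emeasurable_funM; exact/measurable_EFinP.
      by move=> w' _ /=; rewrite -!EFinM -mulrA [X in (_ * X)%R]mulrC.
    - move=> y; apply: emeasurable_funM; apply/measurable_EFinP => //.
      exact: measurable_funM.
    - by move=> y w _; rewrite mule_ge0 ?lee_fin//= -lee_fin EFinM;
        exact: nnfun_muleindic_ge0.
  have -> : \int[P]_w (s n w)%:E =
      \sum_(y \in range (s n)) (y%:E * P (s n @^-1` [set y])).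
    transitivity (\int[P]_w (\sum_(y \in range (s n))
        (y * \1_(s n @^-1` [set y]) w)%:E)).
      by apply: eq_integral => w _; rewrite fimfunE -fsumEFin.
    rewrite ge0_integral_fsum//.
    - apply: eq_fsbigr => y /set_mem [w _ <-].
      under eq_integral do rewrite EFinM.
      rewrite ge0_integralZl_EFin//.
        by rewrite integral_indic// setIT.
      exact/measurable_EFinP.
    - by move=> y; apply/measurable_EFinP; exact: measurable_funM.
    - by move=> y w _; rewrite EFinM; exact: nnfun_muleindic_ge0.
  rewrite ge0_mule_fsumr; last first.
    move=> y; have [y0|y0] := ltP y 0%R; last by rewrite mule_ge0// lee_fin.
    have -> : s n @^-1` [set y] = set0 :> set Omega.
      by apply/seteqP; split => // w /= swy; have := s0 n w; rewrite swy leNgt y0.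
    by rewrite measure0 mule0.
  apply: lee_fsum => // y [w _ <-].
  rewrite muleCA; apply: lee_wpmul2l; first by rewrite lee_fin.
  apply: HK.
  have msn : measurable_fun [set: GT] (s n : GT -> R) by exact: measurable_funPT.
  by have := msn measurableT [set s n w]; rewrite setTI; apply.
have m1 : measurable_fun setT h by exact: g_sigma_measurable_fun GM mh.
have cvgL : \int[P]_w ((s n w)%:E * (X w)%:E) @[n --> \oo] -->
    \int[P]_w (h w * X w)%:E.
  rewrite (eq_integral (fun w : Omega => limn (fun n => (s n w)%:E * (X w)%:E))).
    apply: cvg_monotone_convergence => //.
    - by move=> n; apply: emeasurable_funM; exact/measurable_EFinP.
    - by move=> n w _; rewrite mule_ge0// lee_fin.
    - by move=> w _ m n mn; rewrite lee_wpmul2r// lee_fin// ndsw.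
  move=> w _; apply/esym/cvg_lim => //; rewrite EFinM.
  by apply: cvgeZr => //; exact: cs.
have cvgR : K%:E * \int[P]_w (s n w)%:E @[n --> \oo] -->
    K%:E * \int[P]_w (h w)%:E.
  apply: cvgeZl => //.
  rewrite (eq_integral (fun w : Omega => limn (fun n => (s n w)%:E))).
    apply: cvg_monotone_convergence => //.
    - by move=> n; exact/measurable_EFinP.
    - by move=> n w _; rewrite lee_fin.
    - by move=> w _ m n mn; rewrite lee_fin// ndsw.
  by move=> w _; apply/esym/cvg_lim => //; exact: cs.
by apply: (lee_cvg_to cvgL cvgR); near=> n.
Unshelve. all: by end_near. Qed.
End SubSigmaAlgebra.

Section Independence.
Context d (Omega : measurableType d) (R : realType) (P : probability Omega R).
Local Open Scope ereal_scope.

(** [integral_mul_le] is used twice with exchanged roles. With weight [X] and variable [\1_A] it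
    bounds the integral of [X] over an event [A] of [<<s G1 >>] by [P A] times the full integral,
    which is the hypothesis needed for the weight [h]. *)
Lemma independent_integral_mul_le (G1 G2 : set (set Omega)) (h X : Omega -> R)
    (K : R) :
  G1 `<=` measurable -> G2 `<=` measurable ->
  independent2 P <<s G1 >> <<s G2 >> ->
  measurable_fun setT (h : g_sigma_algebraType G1 -> R) ->
  measurable_fun setT (X : g_sigma_algebraType G2 -> R) ->
  (forall w, 0 <= h w)%R -> (forall w, 0 <= X w)%R -> (0 <= K)%R ->
  \int[P]_w (X w)%:E <= K%:E ->
  \int[P]_w (h w * X w)%:E <= K%:E * \int[P]_w (h w)%:E.
Proof.
move=> G1M G2M ind mh mX h0 X0 K0 XK.
apply: (integral_mul_le G1M) => //; first exact: g_sigma_measurable_fun G2M mX.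
move=> A GA; have mA := g_sigma_algebra_sub G1M GA.
have fA : P A \is a fin_num by rewrite fin_num_measure.
have : \int[P]_w (X w * \1_A w)%:E <= (fine (P A))%:E * \int[P]_w (X w)%:E.
  apply: (integral_mul_le G2M) => //.
  - by rewrite fine_ge0.
  - move=> B GB; rewrite fineK//; have mB := g_sigma_algebra_sub G2M GB.
    rewrite integral_indic//= ind//.
rewrite fineK// => XA; rewrite muleC; apply: le_trans (lee_wpmul2l _ XK) => //.
apply: le_trans XA; rewrite integral_mkcond le_eqVlt; apply/orP; left.
apply/eqP/eq_integral => w _; rewrite patchE indicE.
by case: ifPn => _; rewrite ?mulr1 ?mulr0.
Qed.

(** For fixed [B], the restriction of [P] to [B] and the multiple of [P] by [P B] agree on a
    pi-system, hence on the sigma-algebra it generates. Doing this on one side and then on the other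
    enlarges both classes. *)
Lemma independent2_pi_system (G1 G2 : set (set Omega)) :
  G1 `<=` measurable -> G2 `<=` measurable ->
  setI_closed G1 -> setI_closed G2 -> G1 setT -> G2 setT ->
  independent2 P G1 G2 -> independent2 P <<s G1 >> <<s G2 >>.
Proof.
move=> G1M G2M I1 I2 T1 T2 ind.
have half (G H : set (set Omega)) : G `<=` measurable -> H `<=` measurable ->
    setI_closed G -> G setT ->
    independent2 P G H -> independent2 P <<s G >> H.
  move=> GM HM IG TG iGH A B sA HB.
  have mB := HM _ HB.
  have fB : P B \is a fin_num by rewrite fin_num_measure.
  have k0 : (0 <= fine (P B))%R by rewrite fine_ge0.
  have : mrestr P mB A = mscale (NngNum k0) P A.
    apply: (@g_sigma_algebra_measure_unique _ _ _ G GM (fun=> setT)) => //.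
    - by rewrite bigcup_const.
    - by move=> C GC; rewrite /= /mrestr /mscale/= fineK// muleC iGH.
    - by move=> k; rewrite /= /mrestr setTI ltey_eq fB.
  by rewrite /mrestr /mscale/= fineK// muleC.
have sym (G H : set (set Omega)) : independent2 P G H -> independent2 P H G.
  by move=> i A B HA GB; rewrite setIC muleC i.
have sG2M := g_sigma_algebra_sub G2M.
exact: half _ _ G1M sG2M I1 T1
  (sym _ _ (half _ _ G2M G1M I2 T2 (sym _ _ ind))).
Qed.

(** Finite intersections of events with indices in [D] form a pi-system [Pi D] whose sigma-algebra
    contains the grouped one. For disjoint index sets two such intersections merge into one over the
    union, to which mutual independence applies. *)
Lemma mutual_independence_grouping (I : choiceType) (G : I -> set (set Omega))
    (A B : set I) :
  (forall i, G i `<=` measurable) ->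
  mutual_independence P (fun i => <<s G i >>) ->
  A `&` B = set0 ->
  independent2 P <<s \bigcup_(i in A) <<s G i >> >>
                 <<s \bigcup_(i in B) <<s G i >> >>.
Proof.
move=> GM ind AB.
have sGM i : <<s G i >> `<=` measurable by exact: g_sigma_algebra_sub.
pose Pi (D : set I) := [set E | exists (J : {fset I}) (F : I -> set Omega),
  [/\ [set` J] `<=` D, forall i, <<s G i >> (F i) &
      E = \bigcap_(i in [set` J]) F i] ].
have sT i : <<s G i >> setT.
  by have := @measurableT _ (g_sigma_algebraType (G i)).
have PiT D : Pi D setT.
  exists fset0, (fun=> setT); split => //.
  by rewrite eqEsubset; split => // w _ i _.
have PiM D : Pi D `<=` measurable.
  move=> _ [J [F [_ GF ->]]]; apply: fin_bigcap_measurable => // i _.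
  by apply: (sGM i).
have PiI D : setI_closed (Pi D).
  move=> _ _ [J1 [F1 [JD1 GF1 ->]]] [J2 [F2 [JD2 GF2 ->]]].
  exists (J1 `|` J2)%fset, (fun i => (if i \in J1 then F1 i else setT) `&`
     (if i \in J2 then F2 i else setT)); split.
  - by move=> i /=; rewrite inE => /orP[/JD1|/JD2].
  - move=> i; apply: (@measurableI _ (g_sigma_algebraType (G i)));
      by case: ifP => _ //; (exact: GF1 || exact: GF2).
  - apply/seteqP; split=> w.
      move=> [w1 w2] i /= _; split; case: ifP => // ij; [exact: w1|exact: w2].
    move=> wI; split=> i /= iJ; have := wI i; rewrite /= inE iJ ?orbT;
      by move=> /(_ isT)[].
have sub D : <<s \bigcup_(i in D) <<s G i >> >> `<=` <<s Pi D >>.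
  apply: sub_sigma_algebra2 => E [i Di GE].
  exists [fset i]%fset, (fun j => if j == i then E else setT); split.
  - by move=> j /=; rewrite inE => /eqP ->.
  - by move=> j; case: eqP => [->|_].
  - apply/seteqP; split=> w.
      by move=> Ew j /=; rewrite inE => /eqP ->; rewrite eqxx.
    by move=> /(_ i); rewrite /= inE eqxx; apply.
have iPi : independent2 P (Pi A) (Pi B).
  move=> _ _ [J1 [F1 [JD1 GF1 ->]]] [J2 [F2 [JD2 GF2 ->]]].
  have dis : [disjoint J1 & J2]%fset.
    apply/fdisjointP => i iJ1; apply/negP => iJ2.
    have : (A `&` B) i by split; [exact: JD1|exact: JD2].
    by rewrite AB.
  pose F i := if i \in J1 then F1 i else F2 i.
  have -> : \bigcap_(i in [set` J1]) F1 i `&` \bigcap_(i in [set` J2]) F2 i =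
      \bigcap_(i in [set` (J1 `|` J2)%fset]) F i.
    apply/seteqP; split=> w.
      move=> [w1 w2] i /=; rewrite inE /F; case: ifP => /= [iJ1 _|_ iJ2].
        exact: w1.
      exact: w2.
    move=> wF; split=> i /= iJ; have := wF i; rewrite /= inE iJ /F ?orbT.
      by rewrite iJ; exact.
    case: ifPn => [iJ1|_]; last exact.
    by have /fdisjointP/(_ _ iJ1) := dis; rewrite iJ.
  rewrite (ind J1)//.
  rewrite (ind J2)//.
  rewrite (ind (J1 `|` J2)%fset F); last by move=> i _; rewrite /F; case: ifP.
  rewrite (perm_big (J1 ++ J2))/=; last first.
    apply: uniq_perm; first exact: fset_uniq.
      rewrite cat_uniq !fset_uniq andbT/=; apply/hasPn => i iJ2.
      by apply/negP => iJ1; have /fdisjointP/(_ _ iJ1) := dis; rewrite iJ2.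
    by move=> i; rewrite mem_cat inE.
  rewrite big_cat/=; congr (_ * _); apply: eq_big_seq => i iJ; rewrite /F.
    by rewrite iJ.
  by case: ifPn => // iJ1; have /fdisjointP/(_ _ iJ1) := dis; rewrite iJ.
move=> E1 E2 /sub s1 /sub s2.
by have := independent2_pi_system (PiM A) (PiM B) (PiI A) (PiI B) (PiT A) (PiT B) iPi; apply.
Qed.

End Independence.

Section IndependenceSum.
Context d (Omega : measurableType d) (R : realType) (P : probability Omega R).
Local Open Scope ereal_scope.

(** Puts inputs and attack indicators into a single independent family, so that one block of indices
    may contain both. *)
Lemma mutual_independence_sum (I J : choiceType) (F : I -> set (set Omega))
    (H : J -> set (set Omega)) (SF SH : set (set Omega)) :
  (forall i, F i `<=` <<s SF >>) -> (forall j, H j `<=` <<s SH >>) ->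
  independent2 P <<s SF >> <<s SH >> ->
  mutual_independence P F -> mutual_independence P H ->
  mutual_independence P (fun k : I + J =>
    match k with inl i => F i | inr j => H j end).
Proof.
move=> FS HS ind mF mH L A LA.
pose L1 := [fset x in pmap (fun k => if k is inl i then Some i else None) L]%fset.
pose L2 := [fset x in pmap (fun k => if k is inr i then Some i else None) L]%fset.
have in1 i : (i \in L1) = (inl i \in L).
  rewrite !inE mem_pmap; apply/mapP/idP => [[[k|k] kL]//= [->]//|iL].
  by exists (inl i).
have in2 i : (i \in L2) = (inr i \in L).
  rewrite !inE mem_pmap; apply/mapP/idP => [[[k|k] kL]//= [->]//|iL].
  by exists (inr i).
have -> : \bigcap_(i in [set` L]) A i =
    \bigcap_(i in [set` L1]) A (inl i) `&` \bigcap_(i in [set` L2]) A (inr i).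
  rewrite eqEsubset; split => w.
    by move=> wA; split => i /=; rewrite ?in1 ?in2 => iL; exact: wA.
  move=> [w1 w2] [i|i] iL; first by apply: w1; rewrite /= in1.
  by apply: w2; rewrite /= in2.
have A1 i : i \in L1 -> F i (A (inl i)) by rewrite in1 => /LA.
have A2 i : i \in L2 -> H i (A (inr i)) by rewrite in2 => /LA.
rewrite ind; last 2 first.
- apply: (@fin_bigcap_measurable _ (g_sigma_algebraType SF)) => // i /A1.
  exact: FS.
- apply: (@fin_bigcap_measurable _ (g_sigma_algebraType SH)) => // i /A2.
  exact: HS.
rewrite mF// mH// [RHS](perm_big (map inl L1 ++ map inr L2))/=.
  by rewrite big_cat/= !big_map.
apply: uniq_perm; first exact: fset_uniq.
  rewrite cat_uniq !map_inj_uniq ?fset_uniq/= ?andbT; last 2 first.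
    by move=> ? ? [].
    by move=> ? ? [].
  by apply/hasPn => _ /mapP[j _ ->]; apply/mapP => -[].
move=> [k|k]; rewrite mem_cat.
  rewrite mem_map; last by move=> ? ? [].
  by rewrite in1; case: mapP => [[]//|]; rewrite orbF.
rewrite orbC mem_map; last by move=> ? ? [].
by rewrite in2; case: mapP => [[]//|]; rewrite orbF.
Qed.
End IndependenceSum.

(** * The l2 norm *)

Section L2norm.
Context (R : realType).
Implicit Types a b c : nat.

Lemma l2norm_ge0 a b (A : 'M[R]_(a, b)) : 0 <= l2norm A.
Proof. exact: sqrtr_ge0. Qed.

Lemma l2norm_sqr a b (A : 'M[R]_(a, b)) :
  l2norm A ^+ 2 = \sum_i \sum_j A i j ^+ 2.
Proof.
by rewrite sqr_sqrtr// sumr_ge0// => i _; rewrite sumr_ge0// => j _; exact: sqr_ge0.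
Qed.

Lemma l2norm_sqr_pair a b (A : 'M[R]_(a, b)) :
  l2norm A ^+ 2 = \sum_(ij : 'I_a * 'I_b) A ij.1 ij.2 ^+ 2.
Proof. by rewrite l2norm_sqr pair_big. Qed.

Lemma cauchy_schwarz (I : finType) (x y : I -> R) :
  (\sum_i x i * y i) ^+ 2 <= (\sum_i x i ^+ 2) * (\sum_i y i ^+ 2).
Proof.
(* Lagrange's identity: this double sum is twice the difference of the two sides. *)
have : 0 <= \sum_i \sum_j (x i * y j - x j * y i) ^+ 2.
  by apply: sumr_ge0 => i _; apply: sumr_ge0 => j _; exact: sqr_ge0.
have -> : \sum_i \sum_j (x i * y j - x j * y i) ^+ 2 =
    \sum_i \sum_j (x i ^+ 2 * y j ^+ 2) + \sum_i \sum_j (x j ^+ 2 * y i ^+ 2)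
     - \sum_i \sum_j (x i * y i) * (x j * y j) *+ 2.
  rewrite -big_split -sumrB; apply: eq_bigr => i _/=.
  rewrite -big_split -sumrB; apply: eq_bigr => j _/=; ring.
have -> : \sum_i \sum_j (x j ^+ 2 * y i ^+ 2) = \sum_i \sum_j (x i ^+ 2 * y j ^+ 2).
  exact: exchange_big.
have -> : \sum_i \sum_j (x i * y i) * (x j * y j) *+ 2 =
    (\sum_i x i * y i) ^+ 2 *+ 2.
  rewrite expr2 mulr_suml -sumrMnl; apply: eq_bigr => i _.
  by rewrite mulr_sumr -sumrMnl.
rewrite mulr_suml.
under [X in _ -> _ <= X]eq_bigr do rewrite mulr_sumr.
by rewrite -mulr2n -mulrnBl pmulrn_lge0// subr_ge0.
Qed.

Lemma l2norm0 a b : l2norm (0 : 'M[R]_(a, b)) = 0.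
Proof.
rewrite /l2norm big1 ?sqrtr0// => i _; rewrite big1// => j _.
by rewrite mxE expr0n.
Qed.

Lemma l2normZ a b (k : R) (A : 'M[R]_(a, b)) : l2norm (k *: A) = `|k| * l2norm A.
Proof.
rewrite /l2norm -(sqrtr_sqr k) -sqrtrM ?sqr_ge0//; congr Num.sqrt.
rewrite mulr_sumr; apply: eq_bigr => i _; rewrite mulr_sumr; apply: eq_bigr => j _.
by rewrite mxE exprMn.
Qed.

Lemma l2normN a b (A : 'M[R]_(a, b)) : l2norm (- A) = l2norm A.
Proof. by rewrite -scaleN1r l2normZ normrN1 mul1r. Qed.

Lemma l2normD a b (A B : 'M[R]_(a, b)) : l2norm (A + B) <= l2norm A + l2norm B.
Proof.
rewrite -ler_sqr ?nnegrE ?addr_ge0 ?l2norm_ge0//.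
rewrite sqrrD !l2norm_sqr_pair.
have -> : \sum_(ij : 'I_a * 'I_b) (A + B) ij.1 ij.2 ^+ 2 =
   \sum_(ij : 'I_a * 'I_b) A ij.1 ij.2 ^+ 2 +
   (\sum_(ij : 'I_a * 'I_b) A ij.1 ij.2 * B ij.1 ij.2) *+ 2 +
   \sum_(ij : 'I_a * 'I_b) B ij.1 ij.2 ^+ 2.
  rewrite -sumrMnl -!big_split/=; apply: eq_bigr => ij _.
  by rewrite mxE sqrrD.
rewrite lerD2r lerD2l lerMn2r/= (le_trans (ler_norm _))//.
rewrite -ler_sqr ?nnegrE ?mulr_ge0 ?l2norm_ge0//.
by rewrite real_normK ?num_real// exprMn !l2norm_sqr_pair cauchy_schwarz.
Qed.

Lemma l2norm_dist a b (A B : 'M[R]_(a, b)) : l2norm (A - B) = l2norm (B - A).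
Proof. by rewrite -l2normN opprB. Qed.

Lemma l2normB_ge a b (A B : 'M[R]_(a, b)) : l2norm A - l2norm B <= l2norm (A - B).
Proof. by rewrite lerBlDr (le_trans _ (l2normD _ _))// subrK. Qed.

Lemma l2norm_mulmx a b c (A : 'M[R]_(a, b)) (B : 'M[R]_(b, c)) :
  l2norm (A *m B) <= l2norm A * l2norm B.
Proof.
rewrite -ler_sqr ?nnegrE ?mulr_ge0 ?l2norm_ge0// exprMn !l2norm_sqr.
rewrite mulr_suml; apply: ler_sum => i _.
rewrite [X in _ <= _ * X]exchange_big mulr_sumr; apply: ler_sum => j _.
rewrite mxE; exact: cauchy_schwarz.
Qed.

Lemma l2norm_le_sum a b (A : 'M[R]_(a, b)) : l2norm A <= \sum_i \sum_j `|A i j|.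
Proof.
have s0 : 0 <= \sum_i \sum_j `|A i j|.
  by apply: sumr_ge0 => i _; exact: sumr_ge0.
rewrite -ler_sqr ?nnegrE ?l2norm_ge0// l2norm_sqr expr2 mulr_suml.
apply: ler_sum => i _; rewrite mulr_suml; apply: ler_sum => j _.
rewrite -real_normK ?num_real// expr2 ler_wpM2l//.
rewrite (bigD1 i)//= (bigD1 j)//= -addrA lerDl addr_ge0//.
  exact: sumr_ge0.
by apply: sumr_ge0 => k _; exact: sumr_ge0.
Qed.

Lemma l2norm_entry_sum_le a b (A : 'M[R]_(a, b)) :
  \sum_i \sum_j `|A i j| <= Num.sqrt (a * b)%:R * l2norm A.
Proof.
have s0 : 0 <= \sum_i \sum_j `|A i j|.
  by apply: sumr_ge0 => i _; exact: sumr_ge0.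
rewrite -ler_sqr ?nnegrE ?mulr_ge0 ?sqrtr_ge0 ?l2norm_ge0// exprMn sqr_sqrtr//.
rewrite l2norm_sqr_pair pair_big/=.
have := @cauchy_schwarz ('I_a * 'I_b)%type (fun=> 1) (fun ij => `|A ij.1 ij.2|).
rewrite /=; under [X in X ^+ 2 <= _]eq_bigr do rewrite mul1r.
rewrite expr1n sumr_const cardE -cardT card_prod !card_ord => /le_trans; apply.
by rewrite ler_wpM2l//; apply: ler_sum => ij _; rewrite real_normK ?num_real.
Qed.

Lemma l2norm_eq0 a b (A : 'M[R]_(a, b)) : l2norm A = 0 -> A = 0.
Proof.
move=> A0; apply/matrixP => i j; rewrite mxE.
have : \sum_i \sum_j A i j ^+ 2 = 0 by rewrite -l2norm_sqr A0 expr0n.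
move=> /eqP; rewrite psumr_eq0; last first.
  by move=> k _; apply: sumr_ge0 => l _; exact: sqr_ge0.
move=> /allP/(_ i); rewrite mem_index_enum => /(_ isT)/=.
rewrite psumr_eq0; last by move=> l _; exact: sqr_ge0.
move=> /allP/(_ j); rewrite mem_index_enum => /(_ isT)/=.
by rewrite sqrf_eq0 => /eqP.
Qed.

End L2norm.

(** * Measurability of Lipschitz functions of random matrices *)

Section MeasurableLipschitz.
Context d (S : measurableType d) (R : realType) (a b : nat).
Implicit Types X : S -> 'M[R]_(a, b).

Lemma measurable_l2norm X :
  (forall i j, measurable_fun setT (fun s => X s i j)) ->
  measurable_fun setT (fun s => l2norm (X s)).
Proof.
move=> mX; rewrite /l2norm.
apply: (@measurableT_comp _ _ _ _ _ _ (@Num.sqrt R)).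
  by apply: continuous_measurable_fun; exact: sqrt_continuous.
apply: measurable_sum => i; apply: measurable_sum => j.
exact: measurable_funX.
Qed.

Lemma rat_matrix_dense (A : 'M[R]_(a, b)) (e : R) : 0 < e ->
  exists q : 'M[rat]_(a, b), l2norm (A - map_mx ratr q) < e.
Proof.
(* The extra 1 makes the total error [a * b * h] strictly smaller than [e] and covers empty
   matrices. *)
move=> e0; pose h := e / ((a * b)%:R + 1).
have h0 : 0 < h by rewrite divr_gt0// ltr_wpDl.
have ex i j : exists r : rat, `|A i j - ratr r| < h.
  have : A i j - h < A i j + h by lra.
  move=> /rat_in_itvoo[r]; rewrite in_itv/= => /andP[r1 r2]; exists r.
  by rewrite ltr_norml; lra.
exists (\matrix_(i, j) sval (cid (ex i j))).
apply: le_lt_trans (l2norm_le_sum _) _.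
apply: (@le_lt_trans _ _ (\sum_(i < a) \sum_(j < b) h)).
  apply: ler_sum => i _; apply: ler_sum => j _; rewrite !mxE.
  by case: cid => r /= /ltW.
rewrite !sumr_const !card_ord -mulrnA -(mulr_natl h) /h mulrA ltr_pdivrMr.
  by rewrite mulrC ltr_pM2l// [(b * a)%N]mulnC ltrDl.
by rewrite ltr_wpDl.
Qed.

(* Sublevel sets are unions of balls with rational centres and radii; [D] itself
   need not be measurable. *)
Lemma measurable_lipschitz_comp (D : set 'M[R]_(a, b)) (F : 'M[R]_(a, b) -> R)
    (L : R) X : 0 <= L ->
  (forall A B, D A -> D B -> `|F A - F B| <= L * l2norm (A - B)) ->
  (forall s, D (X s)) ->
  (forall i j, measurable_fun setT (fun s => X s i j)) ->
  measurable_fun setT (fun s => F (X s)).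
Proof.
move=> L0 FL DX mX mT; apply: (measurability _ (RGenInftyO.measurableE R)) => //.
move=> /= _ [_ [x ->] <-]; rewrite setTI.
pose good (qr : 'M[rat]_(a, b) * rat) := exists2 B, D B &
  F B + L * l2norm (map_mx ratr qr.1 - B) + L * ratr qr.2 < x.
rewrite [X in measurable X](_ : _ = \bigcup_(qr : 'M[rat]_(a, b) * rat)
    (if `[< good qr >] then
       [set s | l2norm (X s - map_mx ratr qr.1) < ratr qr.2] else set0)).
  apply: countable_bigcupT_measurable => [|qr]; first exact: countableP.
  case: ifP => // _.
  have mq : measurable_fun setT (fun s => l2norm (X s - map_mx ratr qr.1)).
    apply: measurable_l2norm => i j; under eq_fun do rewrite !mxE.
    exact: measurable_funB.
  rewrite [X in measurable X](_ : _ =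
    (fun s => l2norm (X s - map_mx ratr qr.1)) @^-1` `]-oo, ratr qr.2[).
    by rewrite -[X in measurable X]setTI; apply: mq.
  by apply/seteqP; split => s /=; rewrite in_itv.
apply/seteqP; split => s /=; rewrite ?in_itv/=.
  (* The bound loses at most [L * e] for the distance to the rational centre and [L * e] for the
     radius; [2 * L * e] stays below the available gap. *)
  move=> Fx; pose e := (x - F (X s)) / (2 * L + 1).
  have e0 : 0 < e by rewrite divr_gt0 ?subr_gt0//; lra.
  have [q qe] := rat_matrix_dense (X s) e0.
  have /rat_in_itvoo[r] := qe; rewrite in_itv/= => /andP[r1 r2].
  exists (q, r) => //=; case: asboolP => //= nG; exfalso; apply: nG.
  exists (X s) => //=.
  have eL : e * (2 * L + 1) = x - F (X s) by rewrite mulfVK//; lra.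
  rewrite l2norm_dist.
  have : L * l2norm (X s - map_mx ratr q) <= L * e by rewrite ler_wpM2l// ltW.
  have : L * ratr r <= L * e by rewrite ler_wpM2l// ltW.
  lra.
move=> [[q r] _ /=]; case: asboolP => //= -[B DB]/= lt Xr.
apply: le_lt_trans lt.
have := FL _ _ (DX s) DB; rewrite ler_norml => /andP[_].
have : l2norm (X s - B) <= l2norm (X s - map_mx ratr q) + l2norm (map_mx ratr q - B).
  by rewrite (le_trans _ (l2normD _ _))// addrA subrK.
move=> h1 h2.
have h3 : L * l2norm (X s - B) <=
    L * (l2norm (X s - map_mx ratr q) + l2norm (map_mx ratr q - B)).
  by rewrite ler_wpM2l.
have h4 : L * l2norm (X s - map_mx ratr q) <= L * ratr r by rewrite ler_wpM2l// ltW.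
lra.
Qed.
End MeasurableLipschitz.

(** * A Lyapunov function for the dynamics *)

Section Lyapunov.
Context (R : realType) (n m d : nat).
Variables (f : 'cV[R]_n -> 'cV[R]_m -> 'cV[R]_d -> 'cV[R]_n)
  (U : set 'cV[R]_m) (C rho : R).
Hypotheses (C1 : 1 <= C) (rho0 : 0 < rho) (rho1 : rho < 1)
  (contr : contracting_dynamics f U C rho) (U0 : U 0) (f0 : f 0 0 0 = 0).

(** A converse Lyapunov construction: the divergence of two trajectories under common inputs and
    disturbances, reweighted by [rho ^- k]. Contraction bounds the set by [C * l2norm x], and
    [k = 0] contributes the norm itself. *)
Let incr_set (x : 'cV[R]_n) : set R :=
  [set z | exists k us ws, (forall i, U (us i)) /\
     z = rho ^- k * l2norm (flow f k x us ws - flow f k 0 us ws)].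

(* Unlike the norm (when [C > 1]), this contracts by [rho] at every step. *)
Definition lyapunov (x : 'cV[R]_n) : R := sup (incr_set x).

Let flow_lip k x x' us ws : (forall i, U (us i)) ->
  rho ^- k * l2norm (flow f k x us ws - flow f k x' us ws) <= C * l2norm (x - x').
Proof.
move=> Uu; case: k => [|k].
  by rewrite expr0 invr1 mul1r/= ler_peMl// l2norm_ge0.
rewrite ler_pdivrMl ?exprn_gt0// mulrA [_ * C]mulrC.
have := @contr k.+1 x x' us us ws ws; rewrite !subrr !l2norm0 !addr0.
by apply.
Qed.

Let incr_ub x : ubound (incr_set x) (C * l2norm x).
Proof.
by move=> _ [k [us [ws [Uu ->]]]]; rewrite -{2}[x]subr0 flow_lip.
Qed.

Let incr_sup x : has_sup (incr_set x).
Proof.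
split; last by exists (C * l2norm x); exact: incr_ub.
by eexists; exists 0%N, (fun=> 0), (fun=> 0); split.
Qed.

Lemma lyapunov_le x : lyapunov x <= C * l2norm x.
Proof. by apply: ge_sup; [exact: (incr_sup x).1|exact: incr_ub]. Qed.

Lemma lyapunov_ge x : l2norm x <= lyapunov x.
Proof.
apply: (ub_le_sup (incr_sup x).2).
exists 0%N, (fun=> 0), (fun=> 0); split => //=.
by rewrite expr0 invr1 mul1r subr0.
Qed.

Lemma lyapunov_ge0 x : 0 <= lyapunov x.
Proof. exact: le_trans (l2norm_ge0 x) (lyapunov_ge x). Qed.

Let lyapunov_lip1 x x' : lyapunov x <= lyapunov x' + C * l2norm (x - x').
Proof.
apply: ge_sup; first exact: (incr_sup x).1.
move=> _ [k [us [ws [Uu ->]]]].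
have h1 : rho ^- k * l2norm (flow f k x' us ws - flow f k 0 us ws) <= lyapunov x'.
  by apply: (ub_le_sup (incr_sup x').2); exists k, us, ws.
apply: le_trans (lerD h1 (flow_lip k x x' ws Uu)).
have rk : 0 <= rho ^- k by rewrite invr_ge0 exprn_ge0// ltW.
rewrite -mulrDr ler_wpM2l//.
by rewrite [X in _ <= X]addrC (le_trans _ (l2normD _ _))// addrA subrK.
Qed.

Lemma lyapunov_lip x x' : `|lyapunov x - lyapunov x'| <= C * l2norm (x - x').
Proof.
rewrite ler_norml.
have := lyapunov_lip1 x x'; have := lyapunov_lip1 x' x.
rewrite (l2norm_dist x' x); lra.
Qed.

Let shift T (u : T) (us : nat -> T) i := if i is i'.+1 then us i' else u.

Let flow_shift k x u us w ws :
  flow f k (f x u w) us ws = flow f k.+1 x (shift u us) (shift w ws).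
Proof. by elim: k => //= k ->. Qed.

(** A flow started at [f x u w] is a flow one step longer started at [x], which turns the weight
    [rho ^- k] into [rho * rho ^- k.+1]. The intermediate flow [D] starts at 0 but keeps [u], [w] as
    first step: passing from [x] to 0 costs [lyapunov x], and then replacing [u], [w] by 0 is one
    use of the contraction in its first input. Writing 0 as [f 0 0 0] makes the reference flow
    equally long. *)
Lemma lyapunov_step x u w : U u ->
  lyapunov (f x u w) <= rho * lyapunov x + rho * C * (l2norm u + l2norm w).
Proof.
move=> Uu; apply: ge_sup; first exact: (incr_sup _).1.
move=> _ [k [us [ws [Uus ->]]]].
have Us : forall i, U (shift u us i) by case.
have Us0 : forall i, U (shift 0 us i) by case.
rewrite -f0 !flow_shift.
set A := flow _ _ _ _ _; set B := flow _ _ _ _ _.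
pose D := flow f k.+1 0 (shift u us) (shift w ws).
have h1 : rho ^- k.+1 * l2norm (A - D) <= lyapunov x.
  by apply: (ub_le_sup (incr_sup x).2); exists k.+1, (shift u us), (shift w ws).
have h2 : l2norm (D - B) <= C * rho ^+ k.+1 * (l2norm u + l2norm w).
  have := @contr k.+1 0 0 (shift u us) (shift 0 us) (shift w ws) (shift 0 ws).
  rewrite subrr !subr0 l2norm0 add0r; apply => //.
  by case.
have rk : 0 < rho ^+ k.+1 by rewrite exprn_gt0.
have -> : rho ^- k = rho * rho ^- k.+1.
  by rewrite exprS invfM mulrA mulfV ?mul1r// gt_eqF.
rewrite -!mulrA -mulrDr ler_pM2l//.
have h3 : rho ^- k.+1 * l2norm (D - B) <= C * (l2norm u + l2norm w).
  by rewrite ler_pdivrMl// mulrA [_ * C]mulrC.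
apply: le_trans (lerD h1 h3); rewrite -mulrDr ler_pM2l ?invr_gt0//.
by rewrite (le_trans _ (l2normD _ _))// addrA subrK.
Qed.

End Lyapunov.

(** * Sub-Gaussian variables *)

Section SubGaussian.
Context d (Omega : measurableType d) (R : realType) (P : probability Omega R).
Local Open Scope ereal_scope.

Lemma prob_ge_le_integral (X : Omega -> R) (c a : R) :
  measurable_fun setT X -> (forall w, 0 <= X w)%R -> (0 < a)%R ->
  \int[P]_w (X w)%:E <= c%:E -> P [set w | (a <= X w)%R] <= (c / a)%:E.
Proof.
move=> mX X0 a0 XC.
have mE : measurable [set w | (a <= X w)%R].
  rewrite [X in measurable X](_ : _ = X @^-1` `[a, +oo[).
    by rewrite -[X in measurable X]setTI; apply: mX.
  by apply/seteqP; split => w /=; rewrite in_itv/= andbT.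
rewrite EFinM lee_pdivlMr//; apply: le_trans XC.
rewrite muleC -integral_cst//.
apply: (@le_trans _ _ (\int[P]_(w in [set w | (a <= X w)%R]) (X w)%:E)).
  apply: ge0_le_integral => //.
  - by move=> w _; rewrite lee_fin ltW.
  - by apply/measurable_EFinP/measurable_funTS.
apply: ge0_subset_integral => //; first exact/measurable_EFinP.
by move=> w _; rewrite lee_fin.
Qed.

Lemma measurable_exp_sq (X : Omega -> R) (c : R) :
  measurable_fun setT X ->
  measurable_fun setT (fun w => expR (X w ^+ 2 / c ^+ 2)).
Proof.
move=> mX; apply: (@measurableT_comp _ _ _ _ _ _ (@expR R)) => //.
apply: measurable_funM => //; exact: measurable_funX.
Qed.

Lemma exp_sq_mono (x c s : R) : (0 < c)%R -> (c <= s)%R ->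
  (expR (x ^+ 2 / s ^+ 2) <= expR (x ^+ 2 / c ^+ 2))%R.
Proof.
move=> c0 cs; have s0 := lt_le_trans c0 cs.
rewrite ler_expR ler_wpM2l ?sqr_ge0// lef_pV2 ?posrE ?exprn_gt0//.
by rewrite ler_sqr// nnegrE; exact: ltW.
Qed.

(** An infimum at most [s] yields admissible constants only below numbers larger than [s]. Taking
    [2 * s] avoids attainment, at the price of a constant factor. *)
Lemma psi2_norm_exp (X : Omega -> R) (s : R) : (0 < s)%R ->
  measurable_fun setT X -> psi2_norm P X <= s%:E ->
  \int[P]_w (expR (X w ^+ 2 / (2 * s) ^+ 2))%:E <= 2%:E.
Proof.
move=> s0 mX Xs.
have : psi2_norm P X < (2 * s)%:E.
  by apply: le_lt_trans Xs _; rewrite lte_fin; lra.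
move=> /ereal_inf_lt[_ [c [c0 cE] <-]]; rewrite lte_fin => cs.
apply: le_trans cE; rewrite unlock; apply: ge0_le_integral => //.
- by apply/measurable_EFinP; exact: measurable_exp_sq.
- by apply/measurable_EFinP; exact: measurable_exp_sq.
- by move=> w _; rewrite lee_fin exp_sq_mono// ltW.
Qed.

(** Integration over an event of [<<s G >>] removes the version [Y] of the conditional expectation
    together with its null set. *)
Lemma cond_psi2_norm_exp (G : set (set Omega)) (X : Omega -> R) (s : R)
    (A : set Omega) : (0 < s)%R -> G `<=` measurable ->
  measurable_fun setT X -> cond_psi2_norm P <<s G >> X <= s%:E ->
  <<s G >> A ->
  \int[P]_(w in A) (expR (X w ^+ 2 / (2 * s) ^+ 2))%:E <= 2%:E * P A.
Proof.
move=> s0 GM mX Xs GA; have mA := g_sigma_algebra_sub GM GA.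
have : cond_psi2_norm P <<s G >> X < (2 * s)%:E.
  by apply: le_lt_trans Xs _; rewrite lte_fin; lra.
move=> /ereal_inf_lt[_ [c [c0 [Y [Y0 YG YE] Y2]] <-]]; rewrite lte_fin => cs.
have mY : measurable_fun setT Y.
  by move=> _ B mB; rewrite setTI; exact: (g_sigma_algebra_sub GM) (YG _ mB).
apply: (@le_trans _ _ (\int[P]_(w in A) (expR (X w ^+ 2 / c ^+ 2))%:E)).
  apply: ge0_le_integral => //.
  - by apply/measurable_EFinP/measurable_funTS; exact: measurable_exp_sq.
  - by apply/measurable_EFinP/measurable_funTS; exact: measurable_exp_sq.
  - by move=> w _; rewrite lee_fin exp_sq_mono// ltW.
rewrite -YE// -integral_cst//; apply: ae_ge0_le_integral => //.
- exact: measurable_funTS.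
- by move=> w _; rewrite lee_fin.
- move: Y2 => [N [mN N0 sN]]; exists N; split => // w /= nw; apply: sN => Yw.
  by apply: nw => _.
Qed.

Lemma integral_mul_exp_le (G : set (set Omega)) (h X : Omega -> R) (s : R) :
  (0 < s)%R -> G `<=` measurable -> measurable_fun setT X ->
  cond_psi2_norm P <<s G >> X <= s%:E ->
  measurable_fun setT (h : g_sigma_algebraType G -> R) ->
  (forall w, 0 <= h w)%R ->
  \int[P]_w (h w * expR (X w ^+ 2 / (2 * s) ^+ 2))%:E <=
  2%:E * \int[P]_w (h w)%:E.
Proof.
move=> s0 GM mX Xs mh h0; apply: (integral_mul_le GM) => //.
- exact: measurable_exp_sq.
- by move=> A GA; exact: cond_psi2_norm_exp Xs GA.
Qed.

End SubGaussian.

Section GeneratedByVectors.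
Context d (Omega : measurableType d) (R : realType) (P : probability Omega R).

(** The generators inside [sigma_vec]: [<<s gen_vec J X >>] is [sigma_vec J X] by unfolding, and
    naming them gives access to [g_sigma_algebraType]. *)
Definition gen_vec k (J : set nat) (X : nat -> Omega -> 'cV[R]_k) :
    set (set Omega) :=
  [set A | exists2 ti, (J `*` [set: 'I_k]) ti & exists2 B : set R, measurable B &
     A = (fun omega => X ti.1 omega ti.2 0) @^-1` B].

Lemma gen_vec_measurable k J (X : nat -> Omega -> 'cV[R]_k) :
  (forall t, J t -> random_vector (X t)) -> gen_vec J X `<=` measurable.
Proof.
move=> mX _ [[t i] [/= Jt _] [B mB ->]].
by rewrite -[X in measurable X]setTI; exact: (mX t Jt i).
Qed.

Lemma gen_vec_coord k (J : set nat) (X : nat -> Omega -> 'cV[R]_k) t i : J t ->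
  measurable_fun setT
    ((fun omega => X t omega i 0) : g_sigma_algebraType (gen_vec J X) -> R).
Proof.
move=> Jt _ B mB; rewrite setTI; apply: sub_sigma_algebra.
by exists (t, i) => //; exists B.
Qed.

Lemma gen_vec_l2norm k (J : set nat) (X : nat -> Omega -> 'cV[R]_k) t : J t ->
  measurable_fun setT
    ((fun omega => l2norm (X t omega)) : g_sigma_algebraType (gen_vec J X) -> R).
Proof.
move=> Jt; apply: measurable_l2norm => i j; rewrite ord1.
exact: gen_vec_coord.
Qed.

Lemma random_vector_l2norm k (X : Omega -> 'cV[R]_k) : random_vector X ->
  measurable_fun setT (fun omega => l2norm (X omega)).
Proof. by move=> mX; apply: measurable_l2norm => i j; rewrite ord1. Qed.

Lemma independent2_sym (F G : set (set Omega)) :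
  independent2 P F G -> independent2 P G F.
Proof. by move=> i A B GA FB; rewrite setIC muleC i. Qed.

End GeneratedByVectors.

Section IntegralBounds.
Context d (Omega : measurableType d) (R : realType) (P : probability Omega R).
Local Open Scope ereal_scope.

Lemma le_integral_comb2 (H F G : Omega -> R) (k l : R) :
  measurable_fun setT H -> measurable_fun setT F -> measurable_fun setT G ->
  (forall w, 0 <= H w)%R -> (forall w, 0 <= F w)%R -> (forall w, 0 <= G w)%R ->
  (0 <= k)%R -> (0 <= l)%R -> (forall w, H w <= k * F w + l * G w)%R ->
  \int[P]_w (H w)%:E <= k%:E * \int[P]_w (F w)%:E + l%:E * \int[P]_w (G w)%:E.
Proof.
move=> mH mF mG H0 F0 G0 k0 l0 HFG.
rewrite -!ge0_integralZl_EFin//; try by [exact/measurable_EFinP|move=> w _; rewrite lee_fin].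
rewrite -ge0_integralD//; try by
  [move=> w _; rewrite mule_ge0// lee_fin
  |apply: emeasurable_funM => //; exact/measurable_EFinP].
apply: ge0_le_integral => //.
- by move=> w _; rewrite lee_fin.
- exact/measurable_EFinP.
- by apply: emeasurable_funD; apply: emeasurable_funM => //; exact/measurable_EFinP.
- by move=> w _; rewrite -!EFinM -EFinD lee_fin.
Qed.

Lemma measurable_set_ge (X : Omega -> R) (a : R) :
  measurable_fun setT X -> measurable [set w | (a <= X w)%R].
Proof.
move=> mX; rewrite [Y in measurable Y](_ : _ = X @^-1` `[a, +oo[).
  by rewrite -[Y in measurable Y]setTI; apply: mX.
by apply/seteqP; split => w /=; rewrite in_itv/= andbT.
Qed.

Lemma le_integral_scale (H F : Omega -> R) (k : R) :
  measurable_fun setT H -> measurable_fun setT F ->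
  (forall w, 0 <= H w)%R -> (forall w, 0 <= F w)%R ->
  (0 <= k)%R -> (forall w, H w <= k * F w)%R ->
  \int[P]_w (H w)%:E <= k%:E * \int[P]_w (F w)%:E.
Proof.
move=> mH mF H0 F0 k0 HF.
rewrite -ge0_integralZl_EFin//; try by [exact/measurable_EFinP|move=> w _; rewrite lee_fin].
apply: ge0_le_integral => //.
- by move=> w _; rewrite lee_fin.
- exact/measurable_EFinP.
- by apply: emeasurable_funM => //; exact/measurable_EFinP.
- by move=> w _; rewrite -EFinM lee_fin.
Qed.

End IntegralBounds.

(** * Growth of the state *)

(** With [z = a / (2 * s)] this is [2 * z <= 1 + z ^+ 2]. *)
Lemma exp_lin_le_sq (R : realType) (a s : R) : 0 < s ->
  expR (a / s) <= expR 1 * expR (a ^+ 2 / (2 * s) ^+ 2).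
Proof.
move=> s0; rewrite -expRD ler_expR -expr_div_n.
set z := a / (2 * s).
have -> : a / s = 2 * z by rewrite /z; field; rewrite gt_eqF.
have := sqr_ge0 (z - 1); rewrite sqrrB1 -mulr_natl; lra.
Qed.

(** The exponential splits into a product [y * z], and [y * z <= (y ^+ 2 + z ^+ 2) / 2] separates
    the factors. Input and disturbance of one step may depend on each other, so their product cannot
    be integrated factor by factor. *)
Lemma exp_drift_le (R : realType) (rho a b s t : R) :
  0 <= rho -> rho <= 1 -> 0 <= a -> 0 <= b -> 0 < s -> 0 < t ->
  expR (rho * (a + b) / (2 * (s + t))) <=
  expR 1 / 2 * expR (a ^+ 2 / (2 * s) ^+ 2) + expR 1 / 2 * expR (b ^+ 2 / (2 * t) ^+ 2).
Proof.
move=> rho0 rho1 a0 b0 s0 t0.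
have st0 : 0 < s + t by rewrite addr_gt0.
have h : rho * (a + b) / (2 * (s + t)) <= (a / s) / 2 + (b / t) / 2.
  have -> : rho * (a + b) / (2 * (s + t)) =
      (rho * a) / (s + t) / 2 + (rho * b) / (s + t) / 2.
    by field; rewrite gt_eqF.
  apply: lerD; rewrite ler_pM2r//.
    apply: ler_pM; rewrite ?mulr_ge0 ?invr_ge0 ?(ltW st0)//.
      by rewrite ler_piMl.
    by rewrite lef_pV2 ?posrE// lerDl ltW.
  apply: ler_pM; rewrite ?mulr_ge0 ?invr_ge0 ?(ltW st0)//.
    by rewrite ler_piMl.
  by rewrite lef_pV2 ?posrE// lerDr ltW.
have := exp_lin_le_sq a s0; have := exp_lin_le_sq b t0.
have -> : expR (a / s) = expR (a / s / 2) ^+ 2.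
  by rewrite -expRM_natl; congr expR; field; rewrite gt_eqF.
have -> : expR (b / t) = expR (b / t / 2) ^+ 2.
  by rewrite -expRM_natl; congr expR; field; rewrite gt_eqF.
move=> hb ha.
have : expR (rho * (a + b) / (2 * (s + t))) <= expR (a / s / 2) * expR (b / t / 2).
  by rewrite -expRD ler_expR.
move: ha hb; move: (expR (a / s / 2)) (expR (b / t / 2)) => y z ha hb hyz.
have := sqr_ge0 (y - z).
rewrite sqrrB.
lra.
Qed.

Lemma lee_drift_comb (R : realType) (e c : R) (I IA IB J : \bar R) : 0 <= e ->
  (0 <= I)%E -> (IA <= 2%:E * I)%E -> (IB <= 2%:E * I)%E ->
  (J <= (e / 2)%:E * IA + (e / 2)%:E * IB)%E -> (I <= c%:E)%E ->
  (J <= (2 * e * c)%:E)%E.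
Proof.
move=> e0 I0 hA hB hJ hI; apply: le_trans hJ _.
have e2 : (0 <= (e / 2)%:E)%E by rewrite lee_fin divr_ge0.
apply: le_trans (leeD (lee_wpmul2l e2 hA) (lee_wpmul2l e2 hB)) _.
have h2 : (0 <= (2 * e)%:E)%E by rewrite lee_fin mulr_ge0.
rewrite EFinM; apply: le_trans (lee_wpmul2l h2 hI).
rewrite !muleA -!EFinM -ge0_muleDl; last 2 first.
- by rewrite lee_fin !mulr_ge0// invr_ge0.
- by rewrite lee_fin !mulr_ge0// invr_ge0.
rewrite -EFinD (_ : e / 2 * 2 + e / 2 * 2 = 2 * e)//; lra.
Qed.

Section StateGrowth.
Context disp (Omega : measurableType disp) (R : realType) (P : probability Omega R)
  (n m d N : nat) (f : 'cV[R]_n -> 'cV[R]_m -> 'cV[R]_d -> 'cV[R]_n)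
  (U : set 'cV[R]_m) (C rho su sw : R)
  (x : nat -> Omega -> 'cV[R]_n) (u : nat -> Omega -> 'cV[R]_m)
  (w : nat -> Omega -> 'cV[R]_d).
Hypotheses (C1 : 1 <= C) (rho0 : 0 < rho) (rho1 : rho < 1)
  (contr : contracting_dynamics f U C rho) (U0 : U 0) (f0 : f 0 0 0 = 0).
Hypotheses (mx : forall t, (t <= N)%N -> random_vector (x t))
  (mu : forall t, (t < N)%N -> random_vector (u t))
  (mw : forall t, (t < N)%N -> random_vector (w t))
  (Uu : forall t omega, (t < N)%N -> U (u t omega))
  (dyn : forall t omega, (t < N)%N ->
    x t.+1 omega = f (x t omega) (u t omega) (w t omega)).
Hypotheses (indep : forall t, (t < N)%N ->
    independent2 P (sigma_vec [set t] u) (filtration x t))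
  (su0 : 0 < su) (sgu : forall t, (t < N)%N -> subgaussian_le P (u t) su)
  (sw0 : 0 < sw) (sgx : subgaussian_le P (x 0%N) sw)
  (sgw : forall t, (t < N)%N -> cond_subgaussian_le P (filtration x t) (w t) sw).

Let V s omega := lyapunov f U rho (x s omega).
(** Scales the increment [rho * C * (|u| + |w|)] to exactly the exponent treated by
    [exp_drift_le]. *)
Let theta := (2 * C * (su + sw))^-1.
Let Q t omega := theta * ((1 - rho) * (\sum_(s < t) V s omega) + V t omega).

Let C0 : 0 < C. Proof. exact: lt_le_trans C1. Qed.
Let theta0 : 0 < theta.
Proof. by rewrite invr_gt0 !mulr_gt0// addr_gt0. Qed.

Let measurable_V (J : set nat) s : J s ->
  measurable_fun setT (V s : g_sigma_algebraType (gen_vec J x) -> R).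
Proof.
move=> Js; apply: (@measurable_lipschitz_comp _ _ _ _ _ setT _ C) => //.
- exact: ltW.
- by move=> A B _ _; exact: lyapunov_lip.
- by move=> i j; rewrite ord1; exact: gen_vec_coord.
Qed.

Let measurable_Q t : measurable_fun setT
  ((fun omega => expR (Q t omega)) :
   g_sigma_algebraType (gen_vec [set s | (s <= t)%N] x) -> R).
Proof.
apply: (@measurableT_comp _ _ _ _ _ _ (@expR R)) => //.
apply: (@measurable_funM _ _ _ setT (cst theta)) => //.
apply: measurable_funD; last by apply: measurable_V => /=.
apply: (@measurable_funM _ _ _ setT (cst (1 - rho))) => //.
apply: measurable_sum => s; apply: measurable_V => /=.
exact: ltnW.
Qed.

Let gx t : (t <= N)%N -> gen_vec [set s | (s <= t)%N] x `<=` measurable.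
Proof.
by move=> tN; apply: gen_vec_measurable => s /= st; apply: mx; exact: leq_trans tN.
Qed.

(* Only the state is controlled: [w t] need not be measurable for
   [filtration x t.+1], so sums of the [l2norm (w t)] cannot be conditioned
   step by step. *)
Lemma lyapunov_exp_moment t : (t <= N)%N ->
  (\int[P]_omega (expR (Q t omega))%:E <= ((2 * expR 1) ^+ t.+1)%:E)%E.
Proof.
elim: t => [_|t IH tN].
  have m0 := random_vector_l2norm (mx (leq0n N)).
  have := @le_integral_scale _ _ _ P (fun omega => expR (Q 0 omega))
    (fun omega => expR (l2norm (x 0 omega) ^+ 2 / (2 * sw) ^+ 2)) (expR 1).
  have h := psi2_norm_exp sw0 m0 sgx.2.
  move=> /(_ (g_sigma_measurable_fun (gx (leq0n N)) (@measurable_Q 0%N))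
    (measurable_exp_sq _ m0)) H.
  apply: (@le_trans _ _ _ _ _ (H _ _ _ _)).
  - by move=> omega; exact: expR_ge0.
  - by move=> omega; exact: expR_ge0.
  - exact: expR_ge0.
  - move=> omega; rewrite /Q big_ord0 mulr0 add0r.
    apply: le_trans (exp_lin_le_sq _ sw0); rewrite ler_expR.
    have VC := lyapunov_le C1 rho0 contr U0 (x 0 omega).
    rewrite -/(V 0 omega) in VC.
    rewrite mulrC ler_pdivrMr; last by rewrite !mulr_gt0// addr_gt0.
    rewrite (le_trans VC)// -mulrA mulrC -mulrA ler_wpM2l ?l2norm_ge0//.
    have -> : sw^-1 * (2 * (C * (su + sw))) = C * (2 * (1 + su / sw)).
      by field; rewrite gt_eqF.
    rewrite ler_peMr ?(ltW C0)//.
    have : 0 < su / sw by rewrite divr_gt0. lra.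
  - rewrite expr1 EFinM [leRHS]muleC; apply: lee_wpmul2l h.
    by rewrite lee_fin expR_ge0.
have tN' := ltnW tN.
have mut := random_vector_l2norm (mu tN).
have mwt := random_vector_l2norm (mw tN).
have mQ : measurable_fun setT (fun omega => expR (Q t omega)).
  exact: (g_sigma_measurable_fun (gx tN') (@measurable_Q t)).
have mQ1 : measurable_fun setT (fun omega => expR (Q t.+1 omega)).
  exact: (g_sigma_measurable_fun (gx tN) (@measurable_Q t.+1)).
pose A omega := expR (l2norm (u t omega) ^+ 2 / (2 * su) ^+ 2).
pose B omega := expR (l2norm (w t omega) ^+ 2 / (2 * sw) ^+ 2).
have mA : measurable_fun setT A by exact: measurable_exp_sq.
have mB : measurable_fun setT B by exact: measurable_exp_sq.
(* Input and disturbance are each weighed against the past alone: the input through independence,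
   the disturbance through its conditional norm. Each costs a factor 2, and their combination gives
   the [2 * expR 1] per step. *)
have hA : (\int[P]_omega (expR (Q t omega) * A omega)%:E <=
    2%:E * \int[P]_omega (expR (Q t omega))%:E)%E.
  have gu : gen_vec [set t] u `<=` measurable.
    by apply: gen_vec_measurable => s /= ->; exact: mu.
  have mA' : measurable_fun setT (A : g_sigma_algebraType (gen_vec [set t] u) -> R).
    by apply: measurable_exp_sq; exact: gen_vec_l2norm.
  apply: (independent_integral_mul_le (gx tN') gu _ (@measurable_Q t) mA').
  - by apply: independent2_sym; exact: indep.
  - by move=> omega; exact: expR_ge0.
  - by move=> omega; exact: expR_ge0.
  - by [].
  - exact: psi2_norm_exp su0 mut (sgu tN).2.
have hB : (\int[P]_omega (expR (Q t omega) * B omega)%:E <=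
    2%:E * \int[P]_omega (expR (Q t omega))%:E)%E.
  apply: (integral_mul_exp_le sw0 (gx tN') mwt (sgw tN).2 (@measurable_Q t)).
  by move=> omega; exact: expR_ge0.
have hAB : (\int[P]_omega (expR (Q t.+1 omega))%:E <=
   (expR 1 / 2)%:E * \int[P]_omega (expR (Q t omega) * A omega)%:E +
   (expR 1 / 2)%:E * \int[P]_omega (expR (Q t omega) * B omega)%:E)%E.
  have e2 : 0 <= expR 1 / 2 :> R by rewrite divr_ge0// expR_ge0.
  have mQA : measurable_fun setT (fun omega => expR (Q t omega) * A omega).
    exact: (measurable_funM mQ).
  have mQB : measurable_fun setT (fun omega => expR (Q t omega) * B omega).
    exact: (measurable_funM mQ).
  apply: (le_integral_comb2 P mQ1 mQA mQB _ _ _ e2 e2).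
  - by move=> omega; exact: expR_ge0.
  - by move=> omega; rewrite mulr_ge0// expR_ge0.
  - by move=> omega; rewrite mulr_ge0// expR_ge0.
  move=> omega.
  rewrite (mulrCA _ (expR (Q t omega))) (mulrCA _ (expR (Q t omega))) -mulrDr.
  have := exp_drift_le (ltW rho0) (ltW rho1) (l2norm_ge0 (u t omega))
     (l2norm_ge0 (w t omega)) su0 sw0.
  move=> h; apply: le_trans (ler_wpM2l (expR_ge0 _) h).
  rewrite -expRD ler_expR /Q big_ord_recr/=.
  have := lyapunov_step C1 rho0 contr U0 f0 (x t omega) (w t omega) (Uu omega tN).
  rewrite -dyn// -/(V t omega) -/(V t.+1 omega) => VS.
  have -> : rho * (l2norm (u t omega) + l2norm (w t omega)) / (2 * (su + sw)) =
     theta * (rho * C * (l2norm (u t omega) + l2norm (w t omega))).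
    rewrite /theta; field; rewrite gt_eqF ?addr_gt0//= gt_eqF//.
  rewrite -mulrDr ler_pM2l//; lra.
rewrite exprS; apply: lee_drift_comb (expR_ge0 1) _ hA hB hAB (IH tN').
by apply: integral_ge0 => omega _; rewrite lee_fin expR_ge0.
Qed.

(** The constant 6 makes [theta * (1 - rho)] times the threshold equal to [3 * N.+1]. Markov's
    inequality leaves [(2 * expR 1) ^+ N.+1 * expR (- (3 * N.+1))], which is small enough since
    [2 <= expR 1]. *)
Lemma state_sum_tail :
  measurable [set omega | 6 * C * (su + sw) / (1 - rho) * N.+1%:R <=
        \sum_(s < N) l2norm (x s omega)] /\
  (P [set omega | (6 * C * (su + sw) / (1 - rho) * N.+1%:R <=
        \sum_(s < N) l2norm (x s omega))%R] <= (expR (- N.+1%:R))%:E)%E.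
Proof.
have mQ := g_sigma_measurable_fun (gx (leqnn N)) (@measurable_Q N).
have := @prob_ge_le_integral _ _ _ P (fun omega => expR (Q N omega)) _ (expR (3 * N.+1%:R)) mQ
  (fun omega => expR_ge0 _) (expR_gt0 _) (lyapunov_exp_moment (leqnn N)).
have r1 : 0 < 1 - rho by rewrite subr_gt0.
have mS : measurable_fun setT (fun omega => \sum_(s < N) l2norm (x s omega)).
  apply: measurable_sum => s; apply: random_vector_l2norm.
  by apply: mx; exact: ltnW.
move=> h; split; first exact: measurable_set_ge.
apply: le_trans (le_trans h _).
  apply: le_measure; rewrite ?inE.
  - exact: measurable_set_ge.
  - exact: measurable_set_ge.
  - move=> omega /= hx; rewrite ler_expR /Q.
    rewrite /theta [leRHS]mulrC ler_pdivlMr; last by rewrite !mulr_gt0// addr_gt0.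
    have V0 := lyapunov_ge0 C1 rho0 contr U0 (x N omega).
    rewrite -/(V N omega) in V0.
    have SV : \sum_(s < N) l2norm (x s omega) <= \sum_(s < N) V s omega.
      by apply: ler_sum => s _; exact: (lyapunov_ge C1 rho0 contr).
    have := le_trans hx SV; rewrite mulrAC ler_pdivrMr// => h2; lra.
rewrite lee_fin ler_pdivrMr ?expR_gt0// -expRD.
have -> : - N.+1%:R + 3 * N.+1%:R = N.+1%:R * 2 :> R by ring.
rewrite expRM_natl lerXn2r ?nnegrE ?mulr_ge0 ?expR_ge0//.
have -> : expR 2 = expR 1 * expR 1 :> R by rewrite -expRD.
by rewrite ler_pM2r ?expR_gt0// (le_trans _ (expR_ge1Dx 1)).
Qed.
End StateGrowth.

(** * Independent blocks *)

Section IndependentBlocks.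
Context d (Omega : measurableType d) (R : realType) (P : probability Omega R).
Local Open Scope ereal_scope.

Lemma sub_g_sigma_measurable_fun (G H : set (set Omega)) (h : Omega -> R) :
  G `<=` <<s H >> ->
  measurable_fun setT (h : g_sigma_algebraType G -> R) ->
  measurable_fun setT (h : g_sigma_algebraType H -> R).
Proof.
move=> GH mh _ B mB; have mhB := mh measurableT B mB.
have sub : <<s G >> `<=` <<s H >>.
  by apply: smallest_sub => //; exact: smallest_sigma_algebra.
exact: sub mhB.
Qed.

(** Induction on the number of factors: the product so far is measurable for the union of the
    earlier blocks, which misses the new one, so grouping makes the two independent. The predicate
    [q] will select a residue class. *)
Lemma integral_prod_blocks (I : choiceType) (G : I -> set (set Omega))
    (B : nat -> set I) (q : pred nat) (h : nat -> Omega -> R) (K : nat -> R)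
    (n : nat) :
  (forall i, G i `<=` measurable) ->
  mutual_independence P (fun i => <<s G i >>) ->
  (forall k l, (l < k < n)%N -> q k -> q l -> B l `&` B k = set0) ->
  (forall k, (k < n)%N -> q k -> measurable_fun setT
    (h k : g_sigma_algebraType (\bigcup_(i in B k) <<s G i >>) -> R)) ->
  (forall k w, 0 <= h k w)%R -> (forall k, 0 <= K k)%R ->
  (forall k, (k < n)%N -> q k -> \int[P]_w (h k w)%:E <= (K k)%:E) ->
  \int[P]_w (\prod_(k < n | q k) h k w)%:E <= (\prod_(k < n | q k) K k)%:E.
Proof.
move=> GM ind dis mh h0 K0 hK.
have step j : (j <= n)%N ->
    \int[P]_w (\prod_(k < j | q k) h k w)%:E <= (\prod_(k < j | q k) K k)%:E.
  elim: j => [_|j IH jn].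
    under eq_integral do rewrite big_ord0.
    by rewrite big_ord0 integral_cst// mul1e probability_le1.
  have IHj := IH (ltnW jn).
  under eq_integral do rewrite big_mkcond big_ord_recr/= -big_mkcond/=.
  rewrite [X in _ <= X%:E]big_mkcond big_ord_recr/= -big_mkcond/=.
  case: ifP => qj; last by rewrite mulr1; under eq_integral do rewrite mulr1.
  pose A := \bigcup_(l in [set l | (l < j)%N /\ q l]) B l.
  have AB : A `&` B j = set0.
    apply/seteqP; split => // i [[l [lj ql] Bl] Bj].
    have := dis j l; rewrite lj jn => /(_ isT qj ql) <-.
    by split.
  have GA : \bigcup_(i in A) <<s G i >> `<=` measurable.
    by move=> E [i _ GE]; exact: (g_sigma_algebra_sub (GM i)) GE.
  have GB : \bigcup_(i in B j) <<s G i >> `<=` measurable.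
    by move=> E [i _ GE]; exact: (g_sigma_algebra_sub (GM i)) GE.
  have iAB := mutual_independence_grouping GM ind AB.
  have mprod : measurable_fun setT ((fun w => (\prod_(k < j | q k) h k w)%R) :
      g_sigma_algebraType (\bigcup_(i in A) <<s G i >>) -> R).
    rewrite (_ : (fun w => (\prod_(k < j | q k) h k w)%R) =
        fun w => (\prod_(k < j) (if q k then h k w else 1))%R); last first.
      by apply/funext => w; rewrite big_mkcond.
    apply: measurable_prod => k _; case qk : (q k) => //.
    apply: (@sub_g_sigma_measurable_fun (\bigcup_(i in B k) <<s G i >>)).
      apply: (@subset_trans _ (\bigcup_(i in A) <<s G i >>)).
        by move=> E [i Bi Ei]; exists i => //; exists (k : nat) => //; split.
      exact: sub_sigma_algebra.
    by apply: mh => //; rewrite (ltn_trans _ jn).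
  have p0 w : (0 <= \prod_(k < j | q k) h k w)%R by exact: prodr_ge0.
  have := independent_integral_mul_le GA GB iAB mprod (mh j jn qj) p0 (h0 j) (K0 j)
    (hK j jn qj).
  move=> /le_trans; apply; rewrite mulrC EFinM.
  by apply: lee_wpmul2l => //; rewrite lee_fin.
exact: step.
Qed.

End IndependentBlocks.

(** * Tail of the total input energy *)

Section InputEnergy.
Context disp (Omega : measurableType disp) (R : realType) (P : probability Omega R)
  (m T : nat) (u : nat -> Omega -> 'cV[R]_m) (su : R).
Hypotheses (mu : forall t, (t < T)%N -> random_vector (u t))
  (ind : mutual_independence P (fun t : 'I_T => sigma_vec [set t : nat] u))
  (su0 : 0 < su) (sgu : forall t, (t < T)%N -> subgaussian_le P (u t) su).

(** Controls the sum of the feature norms, hence the cost of replacing a direction by a nearby net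
    point. The threshold [2 * T] works because independence bounds the exponential moment by
    [2 ^+ T] and [2 <= expR 1]. *)
Lemma input_energy_tail :
  measurable [set omega | 2 * T%:R <=
        \sum_(s < T) l2norm (u s omega) ^+ 2 / (2 * su) ^+ 2] /\
  (P [set omega | (2 * T%:R <=
        \sum_(s < T) l2norm (u s omega) ^+ 2 / (2 * su) ^+ 2)%R] <=
   (expR (- T%:R))%:E)%E.
Proof.
pose S omega := \sum_(s < T) l2norm (u s omega) ^+ 2 / (2 * su) ^+ 2.
pose h s omega := expR (l2norm (u s omega) ^+ 2 / (2 * su) ^+ 2).
have GM (i : 'I_T) : gen_vec [set i : nat] u `<=` measurable.
  by apply: gen_vec_measurable => s /= ->; exact: mu.
have hprod : (\int[P]_omega (\prod_(s < T | predT s) h s omega)%:E <=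
    (\prod_(s < T | predT s) 2)%:E)%E.
  apply: (@integral_prod_blocks _ _ _ P 'I_T (fun t => gen_vec [set t : nat] u)
    (fun k => [set i | val i = k]) predT h (fun=> 2)) => //.
  - move=> k l /andP[lk _] _ _; apply/seteqP; split => // i [/= il ik].
    by move: lk; rewrite -il ik ltnn.
  - move=> k kT _.
    apply: (@sub_g_sigma_measurable_fun _ _ _ (gen_vec [set k] u)).
      apply: (@subset_trans _ (\bigcup_(i in [set i : 'I_T | val i = k])
         <<s gen_vec [set i : nat] u >>)); last exact: sub_sigma_algebra.
      move=> E Ek; exists (Ordinal kT) => //=; exact: sub_sigma_algebra.
    by apply: measurable_exp_sq; exact: gen_vec_l2norm.
  - by move=> k omega; exact: expR_ge0.
  - move=> k kT _; apply: psi2_norm_exp => //; last exact: (sgu kT).2.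
    exact: random_vector_l2norm (mu kT).
have mS : measurable_fun setT S.
  apply: measurable_sum => s; apply: measurable_funM => //.
  by apply: measurable_funX; exact: random_vector_l2norm (mu (ltn_ord s)).
have mE : measurable_fun setT (fun omega => expR (S omega)).
  exact: (@measurableT_comp _ _ _ _ _ _ (@expR R)).
have hE : (\int[P]_omega (expR (S omega))%:E <= (2 ^+ T)%:E)%E.
  under eq_integral do rewrite /S expR_sum.
  apply: le_trans hprod _; rewrite prodr_const card_ord//.
have H := prob_ge_le_integral mE (fun omega => expR_ge0 _) (expR_gt0 (2 * T%:R)) hE.
split; first exact: measurable_set_ge.
move: H; under [X in (P X <= _)%E -> _]eq_set do rewrite ler_expR.
move=>  /le_trans; apply; rewrite lee_fin ler_pdivrMr ?expR_gt0// -expRD.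
have -> : - T%:R + 2 * T%:R = T%:R * 1 :> R by ring.
rewrite expRM_natl lerXn2r ?nnegrE ?expR_ge0//.
by rewrite (le_trans _ (expR_ge1Dx 1)).
Qed.

End InputEnergy.

(** * Exponential moment of one signed term *)

Section RealBounds.
Context (R : realType).
Implicit Types x y z q : R.

(** From [1 - z <= expR (- z)] follows [expR z <= 1 + z * expR z]; inserting this bound into itself
    gives the quadratic remainder. *)
Lemma expR_le_quad z : 0 <= z -> expR z <= 1 + z + z ^+ 2 * expR z.
Proof.
move=> z0; have e0 := expR_gt0 z.
have h : expR z <= 1 + z * expR z.
  have := expR_ge1Dx (- z); rewrite expRN -(ler_pM2r e0) mulVf ?gt_eqF//; lra.
have := ler_wpM2l z0 h; rewrite expr2; lra.
Qed.

Lemma expRN_le_quad z : 0 <= z -> expR (- z) <= 1 - z + z ^+ 2.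
Proof.
move=> z0; have z1 : 0 < 1 + z by lra.
have h : expR (- z) <= (1 + z)^-1.
  by rewrite expRN lef_pV2 ?posrE ?expR_gt0// expR_ge1Dx.
apply: le_trans h _; rewrite -(ler_pM2r z1) mulVf ?gt_eqF//.
have := mulr_ge0 (sqr_ge0 z) z0; lra.
Qed.

Lemma expR_half_le2 : expR (2^-1) <= 2 :> R.
Proof.
have e0 := expR_gt0 (2^-1 : R).
have := expR_ge1Dx (- 2^-1 : R).
rewrite expRN -(ler_pM2r e0) mulVf ?gt_eqF//; lra.
Qed.

Lemma sqr_expR_le y : y ^+ 2 * expR y <= 4 * expR (y ^+ 2).
Proof.
have h1 : y ^+ 2 <= 2 * expR (y ^+ 2 / 2).
  have := expR_ge1Dx (y ^+ 2 / 2); lra.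
have h2 : expR y <= 2 * expR (y ^+ 2 / 2).
  apply: (@le_trans _ _ (expR (2^-1) * expR (y ^+ 2 / 2))).
    rewrite -expRD ler_expR; have := sqr_ge0 (y - 1); rewrite sqrrB1; lra.
  by rewrite ler_wpM2r ?expR_ge0// expR_half_le2.
apply: le_trans (ler_pM (sqr_ge0 _) (expR_ge0 _) h1 h2) _.
have -> : expR (y ^+ 2) = expR (y ^+ 2 / 2) * expR (y ^+ 2 / 2).
  by rewrite -expRD; congr expR; lra.
lra.
Qed.

Lemma pow4_le_expR y : y ^+ 4 <= 2 * expR (y ^+ 2).
Proof.
have := @expR_ge1Dxn R (y ^+ 2) 1 (sqr_ge0 _).
rewrite -exprM (_ : (2`!)%N = 2%N)//=; lra.
Qed.

(** A pointwise form of bounding a first moment below by the second and fourth. Below [al] the first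
    term alone is at most [y]; above [al] the left side is not positive. The level [al] is fixed
    later. *)
Lemma le_sq_sub_pow4 y al : 0 <= y -> 0 < al -> y ^+ 2 / al - y ^+ 4 / al ^+ 3 <= y.
Proof.
move=> y0 al0.
have [yal|aly] := leP y al.
  have h : y ^+ 2 / al <= y by rewrite ler_pdivrMr// expr2 ler_wpM2l.
  have : 0 <= y ^+ 4 / al ^+ 3 by rewrite divr_ge0// exprn_ge0// ltW.
  lra.
suff : y ^+ 2 / al <= y ^+ 4 / al ^+ 3 by lra.
have -> : y ^+ 4 / al ^+ 3 = y ^+ 2 / al * (y / al) ^+ 2.
  by field; rewrite gt_eqF.
have d0 : 0 <= y ^+ 2 / al by rewrite divr_ge0 ?sqr_ge0// ltW.
rewrite ler_peMr//.
by rewrite exprn_ege1// ler_pdivlMr// mul1r ltW.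
Qed.

(* The linear term [- th * (2 * q - 1) * y] is traded for moments through
   [y >= y ^+ 2 / al - y ^+ 4 / al ^+ 3]. *)
Lemma signed_exp_le y q th al : 0 <= y -> 0 <= q -> q <= 1 -> 0 <= 2 * q - 1 ->
  0 <= th -> th <= 1 -> 0 < al ->
  q * expR (- (th * y)) + (1 - q) * expR (th * y) +
    th * (2 * q - 1) / al * y ^+ 2 <=
  1 + (2 * th * (2 * q - 1) / al ^+ 3 + 4 * th ^+ 2) * expR (y ^+ 2).
Proof.
move=> y0 q0 q1 k0 th0 th1 al0.
have ty0 : 0 <= th * y by rewrite mulr_ge0.
have hm := ler_wpM2l q0 (expRN_le_quad ty0).
have q1' : 0 <= 1 - q by lra.
have hp := ler_wpM2l q1' (expR_le_quad ty0).
have ey : expR (th * y) <= expR y by rewrite ler_expR ler_piMl.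
have e1 : 1 <= expR y by rewrite -expR0 ler_expR.
have s0 : 0 <= (th * y) ^+ 2 by exact: sqr_ge0.
have hq1 : q * (th * y) ^+ 2 <= q * ((th * y) ^+ 2 * expR y).
  by rewrite ler_wpM2l// ler_peMr.
have hq2 : (1 - q) * ((th * y) ^+ 2 * expR (th * y)) <=
    (1 - q) * ((th * y) ^+ 2 * expR y).
  by rewrite ler_wpM2l// ler_wpM2l.
have hs : (th * y) ^+ 2 * expR y <= 4 * th ^+ 2 * expR (y ^+ 2).
  have := ler_wpM2l (sqr_ge0 th) (sqr_expR_le y); rewrite exprMn; lra.
have tk0 : 0 <= th * (2 * q - 1) by rewrite mulr_ge0.
have hy := ler_wpM2l tk0 (le_sq_sub_pow4 y0 al0).
have h4 : th * (2 * q - 1) * (y ^+ 4 / al ^+ 3) <=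
    2 * th * (2 * q - 1) / al ^+ 3 * expR (y ^+ 2).
  have c0 : 0 <= th * (2 * q - 1) / al ^+ 3 by rewrite divr_ge0// exprn_ge0// ltW.
  have := ler_wpM2l c0 (pow4_le_expR y); lra.
lra.
Qed.

End RealBounds.

Section SignedExp.
Context d (Omega : measurableType d) (R : realType) (P : probability Omega R).

Lemma measurable_lin2 (k l : R) (f g : Omega -> R) :
  measurable_fun setT f -> measurable_fun setT g ->
  measurable_fun setT (fun w => k * f w + l * g w).
Proof.
move=> mf mg; apply: measurable_funD.
  exact: (@measurable_funM _ _ _ setT (cst k)).
exact: (@measurable_funM _ _ _ setT (cst l)).
Qed.

Lemma lin2_ge0 (k l : R) (f g : Omega -> R) :
  (forall w, 0 <= f w) -> (forall w, 0 <= g w) -> 0 <= k -> 0 <= l ->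
  forall w, 0 <= k * f w + l * g w.
Proof. by move=> f0 g0 k0 l0 w; rewrite addr_ge0// mulr_ge0. Qed.

Lemma integral_lin2 (f g : Omega -> R) (a b k l : R) :
  measurable_fun setT f -> measurable_fun setT g ->
  (forall w, 0 <= f w) -> (forall w, 0 <= g w) ->
  (\int[P]_w (f w)%:E = a%:E)%E -> (\int[P]_w (g w)%:E = b%:E)%E ->
  0 <= k -> 0 <= l ->
  (\int[P]_w (k * f w + l * g w)%:E = (k * a + l * b)%:E)%E.
Proof.
move=> mf mg f0 g0 fa gb k0 l0.
have -> : (\int[P]_w (k * f w + l * g w)%:E =
    \int[P]_w (k%:E * (f w)%:E + l%:E * (g w)%:E))%E.
  by apply: eq_integral => w _; rewrite EFinD !EFinM.
have mf' := (measurable_EFinP setT f).2 mf.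
have mg' := (measurable_EFinP setT g).2 mg.
rewrite ge0_integralD//.
- rewrite ge0_integralZl_EFin//; last by move=> w _; rewrite lee_fin.
  rewrite ge0_integralZl_EFin//; last by move=> w _; rewrite lee_fin.
  by rewrite fa gb -!EFinM -EFinD.
- by move=> w _; rewrite mule_ge0// lee_fin.
- exact: emeasurable_funM.
- by move=> w _; rewrite mule_ge0// lee_fin.
- exact: emeasurable_funM.
Qed.

(** Since [A] is independent of [y], the sign averages to [q * expR (- (th * y)) + (1 - q) * expR
    (th * y)] under the integral. [signed_exp_le] bounds this pointwise by terms whose means are
    known. *)
Lemma signed_exp_moment (G1 G2 : set (set Omega)) (A : set Omega)
    (y : Omega -> R) (q th al b : R) :
  G1 `<=` measurable -> G2 `<=` measurable ->
  independent2 P <<s G1 >> <<s G2 >> ->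
  <<s G1 >> A -> P A = q%:E -> 0 <= 2 * q - 1 ->
  measurable_fun setT (y : g_sigma_algebraType G2 -> R) -> (forall w, 0 <= y w) ->
  (\int[P]_w (expR (y w ^+ 2))%:E <= 2%:E)%E ->
  (b%:E <= \int[P]_w (y w ^+ 2)%:E)%E ->
  0 <= th -> th <= 1 -> 0 < al ->
  (\int[P]_w (expR (- (th * (y w * (2 * \1_A w - 1)))))%:E <=
   (1 + 4 * th * (2 * q - 1) / al ^+ 3 + 8 * th ^+ 2
      - th * (2 * q - 1) / al * b)%:E)%E.
Proof.
move=> G1M G2M ind GA PA k0 my' y0 hE hb th0 th1 al0.
have my := g_sigma_measurable_fun G2M my'.
have mA := g_sigma_algebra_sub G1M GA.
have q0 : 0 <= q by rewrite -lee_fin -PA.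
have q1 : q <= 1 by rewrite -lee_fin -PA probability_le1.
pose em w := expR (- (th * y w)); pose ep w := expR (th * y w).
have m_em (G : set (set Omega)) : measurable_fun setT (y : g_sigma_algebraType G -> R) ->
    measurable_fun setT (em : g_sigma_algebraType G -> R).
  move=> h; apply: (@measurableT_comp _ _ _ _ _ _ (@expR R)) => //.
  apply: measurable_funN; exact: (@measurable_funM _ _ _ setT (cst th)).
have m_ep (G : set (set Omega)) : measurable_fun setT (y : g_sigma_algebraType G -> R) ->
    measurable_fun setT (ep : g_sigma_algebraType G -> R).
  move=> h; apply: (@measurableT_comp _ _ _ _ _ _ (@expR R)) => //.
  exact: (@measurable_funM _ _ _ setT (cst th)).
have mem : measurable_fun setT em by exact: g_sigma_measurable_fun G2M (m_em _ my').
have mep : measurable_fun setT ep by exact: g_sigma_measurable_fun G2M (m_ep _ my').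
pose E2 w := expR (y w ^+ 2).
have mE2 : measurable_fun setT E2.
  apply: (@measurableT_comp _ _ _ _ _ _ (@expR R)) => //; exact: measurable_funX.
have em0 w : 0 <= em w by exact: expR_ge0.
have ep0 w : 0 <= ep w by exact: expR_ge0.
have E20 w : 0 <= E2 w by exact: expR_ge0.
(* Domination by [expR (y ^+ 2)] makes all integrals real numbers, so that the final subtraction is
   legitimate. Until then the inequality is kept with nonnegative terms on both sides. *)
have finI (g : Omega -> R) (c : R) : measurable_fun setT g -> (forall w, 0 <= g w) ->
    0 <= c -> (forall w, g w <= c * E2 w) ->
    exists2 r, 0 <= r & (\int[P]_w (g w)%:E = r%:E)%E.
  move=> mg g0 c0 gc.
  have := le_integral_scale P mg mE2 g0 E20 c0 gc.
  move=> /le_trans/(_ (lee_wpmul2l _ hE)); rewrite lee_fin => /(_ c0) fin.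
  have i0 : (0 <= \int[P]_w (g w)%:E)%E.
    by apply: integral_ge0 => w _; rewrite lee_fin.
  exists (fine (\int[P]_w (g w)%:E)); first exact: fine_ge0.
  rewrite fineK// ge0_fin_numE//; exact: le_lt_trans fin (ltry _).
have E21 w : 1 <= E2 w by rewrite -expR0 ler_expR sqr_ge0.
have [Im Im0 HIm] : exists2 r, 0 <= r & (\int[P]_w (em w)%:E = r%:E)%E.
  apply: (finI em 1) => // w; rewrite mul1r; apply: le_trans (E21 w).
  by rewrite -[leRHS]expR0 ler_expR oppr_le0 mulr_ge0.
have [Ip Ip0 HIp] : exists2 r, 0 <= r & (\int[P]_w (ep w)%:E = r%:E)%E.
  apply: (finI ep 2) => // w; rewrite /ep /E2.
  apply: (@le_trans _ _ (expR (2^-1) * expR (y w ^+ 2))).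
    rewrite -expRD ler_expR.
    have : th * y w <= y w by rewrite ler_piMl.
    have := sqr_ge0 (y w - 1); have := sqr_ge0 (y w); rewrite sqrrB1; lra.
  by rewrite ler_wpM2r ?expR_ge0// expR_half_le2.
have [Iy Iy0 HIy] : exists2 r, 0 <= r & (\int[P]_w (y w ^+ 2)%:E = r%:E)%E.
  apply: (finI _ 1) => //.
  - exact: measurable_funX.
  - by move=> w; exact: sqr_ge0.
  - move=> w; rewrite mul1r; have := expR_ge1Dx (y w ^+ 2); rewrite -/(E2 w); lra.
have [IE IE0 HIE] : exists2 r, 0 <= r & (\int[P]_w (E2 w)%:E = r%:E)%E.
  by apply: (finI _ 1) => // w; rewrite mul1r.
rewrite HIE lee_fin in hE; rewrite HIy lee_fin in hb.
have mi1 : measurable_fun setT (\1_A : g_sigma_algebraType G1 -> R).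
  exact: (@measurable_indic _ (g_sigma_algebraType G1)).
have mi2 : measurable_fun setT (\1_(~` A) : g_sigma_algebraType G1 -> R).
  apply: (@measurable_indic _ (g_sigma_algebraType G1)).
  exact: (@measurableC _ (g_sigma_algebraType G1)).
have hm : (\int[P]_w (\1_A w * em w)%:E <= (Im * q)%:E)%E.
  apply: le_trans (independent_integral_mul_le G1M G2M ind mi1 (m_em _ my') _ em0 Im0 _) _.
  - by move=> w; rewrite indicE.
  - by rewrite HIm.
  - by rewrite integral_indic// setIT [X in (_ * X <= _)%E]PA -EFinM.
have hp : (\int[P]_w (\1_(~` A) w * ep w)%:E <= (Ip * (1 - q))%:E)%E.
  apply: le_trans (independent_integral_mul_le G1M G2M ind mi2 (m_ep _ my') _ ep0 Ip0 _) _.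
  - by move=> w; rewrite indicE.
  - by rewrite HIp.
  - rewrite integral_indic//; last exact: measurableC.
    rewrite setIT [X in (_ * X <= _)%E](probability_setC P mA).
    by rewrite [X in (1 - X)%E]PA -EFinB -EFinM.
have mi1' := g_sigma_measurable_fun G1M mi1.
have mi2' := g_sigma_measurable_fun G1M mi2.
pose hsg w := expR (- (th * (y w * (2 * \1_A w - 1)))).
have hsgE w : hsg w = \1_A w * em w + \1_(~` A) w * ep w.
  rewrite /hsg !indicE in_setC; case: (w \in A) => /=.
    by rewrite mul1r mul0r addr0 /em; congr expR; ring.
  by rewrite mul1r mul0r add0r /ep; congr expR; ring.
have hI : (\int[P]_w (hsg w)%:E <= (Im * q + Ip * (1 - q))%:E)%E.
  rewrite EFinD; apply: le_trans (leeD hm hp).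
  rewrite -ge0_integralD//=.
  - rewrite le_eqVlt; apply/orP; left; apply/eqP; apply: eq_integral => w _.
    by rewrite hsgE EFinD.
  - by move=> w _; rewrite lee_fin mulr_ge0// indicE.
  - by apply/measurable_EFinP; exact: measurable_funM.
  - by move=> w _; rewrite lee_fin mulr_ge0// indicE.
  - by apply/measurable_EFinP; exact: measurable_funM.
apply: le_trans hI _; rewrite lee_fin.
set kap := 2 * q - 1.
set k1 := th * kap / al; set k2 := 2 * th * kap / al ^+ 3 + 4 * th ^+ 2.
have k10 : 0 <= k1 by rewrite divr_ge0 ?mulr_ge0// ltW.
have k20 : 0 <= k2.
  by rewrite addr_ge0 ?divr_ge0 ?mulr_ge0 ?sqr_ge0 ?exprn_ge0// ltW.
have q1' : 0 <= 1 - q by rewrite subr_ge0.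
have my2 : measurable_fun setT (fun w => y w ^+ 2) by exact: measurable_funX.
have y20 w : 0 <= y w ^+ 2 by exact: sqr_ge0.
have int1 : (\int[P]_w (1 : R)%:E = 1%:E)%E.
  by rewrite integral_cst// mul1e; exact: probability_setT.
have key : q * Im + (1 - q) * Ip + k1 * Iy <= 1 + k2 * IE.
  rewrite -lee_fin.
  have HL1 := integral_lin2 mem mep em0 ep0 HIm HIp q0 q1'.
  have HL2 := integral_lin2 (measurable_lin2 q (1 - q) mem mep) my2
    (lin2_ge0 em0 ep0 q0 q1') y20 HL1 HIy ler01 k10.
  have HR := integral_lin2 (@measurable_cst _ _ _ _ setT (1 : R)) mE2 (fun=> ler01) E20
    int1 HIE ler01 k20.
  rewrite !mul1r in HL2 HR; rewrite -HL2 -HR; apply: ge0_le_integral => //.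
  - by move=> w _; rewrite lee_fin addr_ge0// ?mul1r ?lin2_ge0// mulr_ge0.
  - apply/measurable_EFinP; apply: measurable_lin2 => //; exact: measurable_lin2.
  - apply/measurable_EFinP.
    apply: (@measurable_funD _ _ _ setT (cst (1 : R))) => //.
    exact: (@measurable_funM _ _ _ setT (cst k2)).
  - move=> w _; rewrite lee_fin !mul1r.
    exact: (signed_exp_le (y0 w) q0 q1 k0 th0 th1 al0).
have h1 : k1 * b <= k1 * Iy by rewrite ler_wpM2l.
have h2 : k2 * IE <= k2 * 2 by rewrite ler_wpM2l.
have -> : 1 + 4 * th * kap / al ^+ 3 + 8 * th ^+ 2 - k1 * b = 1 + k2 * 2 - k1 * b.
  by rewrite /k2; field; rewrite gt_eqF.
lra.
Qed.

End SignedExp.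

(** The exponential lies above its tangent at the mean [a], and the linear parts cancel in the
    sum. *)
Lemma jensen_expR (R : realType) (k : nat) (v : 'I_k.+1 -> R) :
  expR (k.+1%:R^-1 * \sum_j v j) <= k.+1%:R^-1 * \sum_j expR (v j).
Proof.
set a := k.+1%:R^-1 * \sum_j v j.
have k0 : 0 < k.+1%:R :> R by [].
rewrite ler_pdivlMl//.
have -> : k.+1%:R * expR a = \sum_j (expR a * (1 + (v j - a))).
  rewrite -mulr_sumr big_split/= sumrB !sumr_const !card_ord.
  have -> : \sum_j v j = a *+ k.+1 by rewrite -mulr_natl /a mulVKf.
  by rewrite subrr addr0 mulrC.
apply: ler_sum => j _.
rewrite -[in leRHS](subrK a (v j)) expRD mulrC ler_pM2r ?expR_gt0//.
exact: expR_ge1Dx.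
Qed.

(** * Quadratic forms of the second moment matrix *)

Section SecondMoment.
Context d (Omega : measurableType d) (R : realType) (P : probability Omega R).

(** Entries of [second_moment] pass through [fine], so they carry information only once the products
    of coordinates are known to be integrable; the finite mean of [l2norm (X w) ^+ 2] provides
    this. *)
Lemma second_moment_quad k (X : Omega -> 'cV[R]_k) (v : 'cV[R]_k) :
  random_vector X -> (\int[P]_w (l2norm (X w) ^+ 2)%:E < +oo)%E ->
  (\int[P]_w (((v^T *m X w) 0 0) ^+ 2)%:E =
   ((v^T *m second_moment P X *m v) 0 0)%:E)%E.
Proof.
move=> mX fX.
have mN := random_vector_l2norm mX.
have iN : P.-integrable setT (EFin \o (fun w => l2norm (X w) ^+ 2)).
  apply/integrableP; split; first by apply/measurable_EFinP; exact: measurable_funX.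
  under eq_integral do rewrite /= ger0_norm ?sqr_ge0//.
  exact: fX.
have iXX i j : P.-integrable setT (EFin \o (fun w => X w i 0 * X w j 0)).
  apply: le_integrable iN => //.
    by apply/measurable_EFinP; apply: measurable_funM; exact: mX.
  move=> w _ /=; rewrite lee_fin [leRHS]ger0_norm ?sqr_ge0//.
  have sq l : X w l 0 ^+ 2 <= l2norm (X w) ^+ 2.
    rewrite l2norm_sqr (bigD1 l)//= big_ord1 lerDl.
    by apply: sumr_ge0 => l' _; apply: sumr_ge0 => j' _; exact: sqr_ge0.
  have ab l : `|X w l 0| <= l2norm (X w).
    rewrite -ler_sqr ?nnegrE ?l2norm_ge0//.
    by rewrite real_normK ?num_real.
  by rewrite normrM expr2; apply: ler_pM.
have -> : (\int[P]_w (((v^T *m X w) 0 0) ^+ 2)%:E =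
    \int[P]_w (\sum_i \sum_j (v i 0 * v j 0)%:E * (X w i 0 * X w j 0)%:E))%E.
  apply: eq_integral => w _; rewrite mxE expr2 mulr_suml -sumEFin.
  apply: eq_bigr => i _; rewrite mulr_sumr -sumEFin; apply: eq_bigr => j _.
  by rewrite -EFinM !mxE; congr EFin; ring.
have iZ i j : P.-integrable setT
    (fun w => (v i 0 * v j 0)%:E * (X w i 0 * X w j 0)%:E)%E.
  by apply: integrableZl => //; exact: iXX.
have iS i : P.-integrable setT
    (fun w => \sum_j (v i 0 * v j 0)%:E * (X w i 0 * X w j 0)%:E)%E.
  by apply: integrable_sum => // j _; exact: iZ.
rewrite integral_sum//.
transitivity (\sum_i \sum_j (v i 0 * v j 0 * second_moment P X i j)%:E)%E.
  apply: eq_bigr => i _; rewrite integral_sum//; apply: eq_bigr => j _.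
  rewrite integralZl//; last exact: iXX.
  rewrite [RHS]EFinM; congr (_ * _)%E; rewrite mxE unlock fineK//.
  apply: integrable_fin_num => //; exact: iXX.
rewrite mxE exchange_big/= -sumEFin; apply: eq_bigr => j _.
rewrite mxE mulr_suml -sumEFin; apply: eq_bigr => i _.
by congr EFin; rewrite !mxE; ring.
Qed.

End SecondMoment.

(** * Features *)

Lemma window_index (t tau : nat) (j : 'I_tau.+1) :
  (t - tau <= t - j <= t)%N.
Proof. by have := ltn_ord j; lia. Qed.

Section Features.
Context disp (Omega : measurableType disp) (R : realType) (P : probability Omega R)
  (m M tau T : nat) (U : set 'cV[R]_m) (phi : 'I_M -> 'M[R]_(m, tau.+1) -> R)
  (u : nat -> Omega -> 'cV[R]_m) (Lphi lambda su : R).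
Hypotheses (tau0 : (0 < tau)%N) (tauT : (tau < T)%N)
  (mu : forall t, (t < T)%N -> random_vector (u t))
  (Uu : forall t omega, (t < T)%N -> U (u t omega)) (U0 : U 0)
  (Lphi0 : 0 < Lphi)
  (phiL : forall i W W', in_windows U W -> in_windows U W' ->
    `|phi i W - phi i W'| <= Lphi * l2norm (W - W'))
  (lambda0 : 0 < lambda)
  (excite : forall t, (tau <= t < T)%N ->
    psd (second_moment P
           (fun omega => Phi phi (window tau (fun s => u s omega) t))
         - (lambda ^+ 2)%:M))
  (phi0 : Phi phi 0 = 0)
  (su0 : 0 < su) (sgu : forall t, (t < T)%N -> subgaussian_le P (u t) su).

Definition feature t omega := Phi phi (window tau (fun s => u s omega) t).

Let inW t omega : (tau <= t < T)%N -> in_windows U (window tau (fun s => u s omega) t).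
Proof.
move=> /andP[_ tT] j.
have -> : col j (window tau (fun s => u s omega) t) = u (t - j)%N omega.
  by apply/matrixP => i k; rewrite !mxE ord1.
by apply: Uu; apply: leq_ltn_trans tT; exact: leq_subr.
Qed.

Let feature_entry_measurable t i : (tau <= t < T)%N ->
  measurable_fun setT ((fun omega => feature t omega i 0) :
    g_sigma_algebraType (gen_vec [set s | (t - tau <= s <= t)%N] u) -> R).
Proof.
move=> tt; rewrite /feature.
rewrite (_ : (fun omega => _) =
    fun omega => phi i (window tau (fun s => u s omega) t)); last first.
  by apply/funext => omega; rewrite mxE.
apply: (@measurable_lipschitz_comp _ (g_sigma_algebraType
  (gen_vec [set s | (t - tau <= s <= t)%N] u)) _ _ _ (in_windows U) (phi i) Lphi).
- exact: ltW.
- exact: phiL.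
- by move=> omega; exact: inW.
- move=> k j; rewrite (_ : (fun omega => _) = fun omega => u (t - j)%N omega k 0).
    2: by apply/funext => omega; rewrite mxE.
  apply: gen_vec_coord => /=.
  exact: window_index.
Qed.

Lemma feature_random_vector t : (tau <= t < T)%N -> random_vector (feature t).
Proof.
move=> tt i; apply: (g_sigma_measurable_fun _ (feature_entry_measurable i tt)).
apply: gen_vec_measurable => s /= /andP[_ st]; apply: mu.
by apply: leq_ltn_trans st _; case/andP: tt.
Qed.

Lemma l2norm_mul_feature_measurable r t (D : 'M[R]_(r, M)) : (tau <= t < T)%N ->
  measurable_fun setT ((fun omega => l2norm (D *m feature t omega)) :
    g_sigma_algebraType (gen_vec [set s | (t - tau <= s <= t)%N] u) -> R).
Proof.
move=> tt; apply: (@measurable_l2norm _ (g_sigma_algebraType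
  (gen_vec [set s | (t - tau <= s <= t)%N] u))) => i j.
rewrite (_ : (fun omega => _) =
    fun omega => \sum_k D i k * feature t omega k 0); last first.
  by apply/funext => omega; rewrite mxE ord1.
apply: measurable_sum => k.
apply: (@measurable_funM _ _ _ setT (cst (D i k))) => //.
exact: feature_entry_measurable.
Qed.

Let v s omega := l2norm (u s omega) ^+ 2 / (2 * su) ^+ 2.

Lemma feature_energy t omega : (tau <= t < T)%N ->
  l2norm (feature t omega) ^+ 2 <=
  M%:R * Lphi ^+ 2 * \sum_(j < tau.+1) l2norm (u (t - j)%N omega) ^+ 2.
Proof.
move=> tt; set W := window tau (fun s => u s omega) t.
have -> : \sum_(j < tau.+1) l2norm (u (t - j)%N omega) ^+ 2 = l2norm W ^+ 2.
  rewrite l2norm_sqr exchange_big/=; apply: eq_bigr => j _.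
  by rewrite l2norm_sqr; apply: eq_bigr => i _; rewrite big_ord1 mxE.
have W0 : in_windows U (0 : 'M[R]_(m, tau.+1)).
  by move=> j; rewrite (_ : col j 0 = 0)//; apply/matrixP => i k; rewrite !mxE.
rewrite l2norm_sqr.
apply: (@le_trans _ _ (\sum_(i < M) Lphi ^+ 2 * l2norm W ^+ 2)); last first.
  by rewrite sumr_const card_ord -mulrA mulr_natl.
apply: ler_sum => i _; rewrite big_ord1 mxE -exprMn.
have phi0i : phi i 0 = 0 by have /matrixP/(_ i 0) := phi0; rewrite !mxE.
have := phiL i (inW omega tt) W0; rewrite phi0i !subr0 => h.
rewrite -[leLHS]real_normK ?num_real// ler_sqr// nnegrE.
by rewrite mulr_ge0 ?l2norm_ge0// ltW.
Qed.

Let nu := nu_ratio M tau Lphi su lambda.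
(** The normalization for which [(|D Z| / K) ^+ 2] is at most the average of the [v s] over the
    window: [K ^+ 2] equals [4 * M * tau * Lphi ^+ 2 * (2 * su) ^+ 2], and [tau.+1 <= 4 * tau]. *)
Let K := 4 * lambda * nu.

Lemma nu_sq : (lambda * nu) ^+ 2 = M%:R * tau%:R * Lphi ^+ 2 * su ^+ 2.
Proof.
rewrite /nu /nu_ratio.
have -> : lambda * (Num.sqrt (M%:R * tau%:R) * Lphi * su / lambda) =
    Num.sqrt (M%:R * tau%:R) * (Lphi * su).
  by field; rewrite gt_eqF.
rewrite exprMn sqr_sqrtr ?mulr_ge0//; ring.
Qed.

Lemma nu_ge0 : 0 <= nu.
Proof. by rewrite /nu /nu_ratio !mulr_ge0 ?sqrtr_ge0 ?invr_ge0// ltW. Qed.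

Lemma normalized_energy r t omega (D : 'M[R]_(r, M)) : (tau <= t < T)%N ->
  (0 < M)%N -> l2norm D <= 1 ->
  (l2norm (D *m feature t omega) / K) ^+ 2 <=
  tau.+1%:R^-1 * \sum_(j < tau.+1) v (t - j)%N omega.
Proof.
move=> tt M0 D1.
have K2 : K ^+ 2 = 16 * (M%:R * tau%:R * Lphi ^+ 2 * su ^+ 2).
  by rewrite -nu_sq /K; ring.
have MR : 0 < M%:R :> R by rewrite ltr0n.
have tR : 0 < tau%:R :> R by rewrite ltr0n.
have K20 : 0 < K ^+ 2 by rewrite K2 !mulr_gt0// ?exprn_gt0.
have t1 : tau.+1%:R <= 4 * tau%:R :> R.
  rewrite -natr1; have : 1 <= tau%:R :> R by rewrite ler1n.
  lra.
rewrite expr_div_n ler_pdivrMr//.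
have h1 : l2norm (D *m feature t omega) ^+ 2 <= l2norm (feature t omega) ^+ 2.
  rewrite ler_sqr ?nnegrE ?l2norm_ge0//; apply: le_trans (l2norm_mulmx _ _) _.
  by rewrite ler_piMl// l2norm_ge0.
apply: le_trans h1 (le_trans (feature_energy omega tt) _).
have -> : \sum_(j < tau.+1) v (t - j)%N omega =
   (\sum_(j < tau.+1) l2norm (u (t - j)%N omega) ^+ 2) / (2 * su) ^+ 2.
  by rewrite mulr_suml.
set S := \sum_(j < _) _.
have S0 : 0 <= S by apply: sumr_ge0 => j _; exact: sqr_ge0.
have -> : tau.+1%:R^-1 * (S / (2 * su) ^+ 2) * K ^+ 2 =
   M%:R * Lphi ^+ 2 * S * ((4 * tau%:R) / tau.+1%:R).
  by rewrite K2; field; rewrite !gt_eqF// ltr_wpDr.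
apply: ler_peMr.
  by apply: mulr_ge0 => //; apply: mulr_ge0 => //; exact: sqr_ge0.
by rewrite ler_pdivlMr// mul1r.
Qed.

Let tj t (j : 'I_tau.+1) : (tau <= t < T)%N -> (t - j < T)%N.
Proof. by move=> /andP[_]; apply: leq_ltn_trans; exact: leq_subr. Qed.

Let F t omega := \sum_(j < tau.+1) expR (v (t - j)%N omega).

Let mexp s : (s < T)%N -> measurable_fun setT (fun omega => expR (v s omega)).
Proof.
by move=> sT; apply: measurable_exp_sq; exact: random_vector_l2norm (mu sT).
Qed.

Let mF t : (tau <= t < T)%N -> measurable_fun setT (F t).
Proof. by move=> tt; apply: measurable_sum => j; apply: mexp; exact: tj. Qed.

Let F0 t omega : 0 <= F t omega.
Proof. by apply: sumr_ge0 => j _; exact: expR_ge0. Qed.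

Let intF t : (tau <= t < T)%N ->
  (\int[P]_omega (F t omega)%:E <= (tau.+1%:R * 2)%:E)%E.
Proof.
move=> tt; rewrite /F; under eq_integral do rewrite -sumEFin.
rewrite ge0_integral_sum//.
- rewrite mulr_natl -[X in _ *+ X]card_ord -sumr_const -sumEFin.
  apply: lee_sum => j _; have jT := tj j tt.
  apply: psi2_norm_exp => //; last exact: (sgu jT).2.
  exact: random_vector_l2norm (mu jT).
- by move=> j; apply/measurable_EFinP; apply: mexp; exact: tj.
Qed.

(** Jensen's inequality moves the average over the window out of the exponential, so the bound 2 for
    a single input survives for every window length. *)
Lemma normalized_exp_moment r t (D : 'M[R]_(r, M)) : (tau <= t < T)%N ->
  (0 < M)%N -> l2norm D <= 1 ->
  (\int[P]_omega (expR ((l2norm (D *m feature t omega) / K) ^+ 2))%:E <= 2%:E)%E.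
Proof.
move=> tt M0 D1.
have gM : gen_vec [set s | (t - tau <= s <= t)%N] u `<=` measurable.
  apply: gen_vec_measurable => s /= /andP[_ st]; apply: mu.
  by apply: leq_ltn_trans st _; case/andP: tt.
have mH : measurable_fun setT
    (fun omega => expR ((l2norm (D *m feature t omega) / K) ^+ 2)).
  apply: (@measurableT_comp _ _ _ _ _ _ (@expR R)) => //.
  apply: measurable_funX; apply: measurable_funM => //.
  exact: (g_sigma_measurable_fun gM (l2norm_mul_feature_measurable D tt)).
have k0 : 0 <= tau.+1%:R^-1 :> R by rewrite invr_ge0.
have HF omega : expR ((l2norm (D *m feature t omega) / K) ^+ 2) <=
    tau.+1%:R^-1 * F t omega.
  apply: le_trans (jensen_expR _); rewrite ler_expR.
  exact: normalized_energy.
apply: le_trans (le_integral_scale P mH (mF tt) (fun=> expR_ge0 _) (F0 t) k0 HF) _.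
apply: le_trans (lee_wpmul2l _ (intF tt)) _; first by rewrite lee_fin.
by rewrite -EFinM mulKf.
Qed.

(** Excitation is applied to each row of [D]; the squared row norms add up to the squared Frobenius
    norm, and [K ^+ 2] is [16 * lambda ^+ 2 * nu ^+ 2]. *)
Lemma excitation r t (D : 'M[R]_(r, M)) : (tau <= t < T)%N -> (0 < M)%N ->
  ((l2norm D ^+ 2 / (16 * nu ^+ 2))%:E <=
   \int[P]_omega ((l2norm (D *m feature t omega) / K) ^+ 2)%:E)%E.
Proof.
move=> tt M0.
have MR : 0 < M%:R :> R by rewrite ltr0n.
have tR : 0 < tau%:R :> R by rewrite ltr0n.
have mZ := feature_random_vector tt.
have ln0 : 0 < (lambda * nu) ^+ 2.
  by rewrite nu_sq !mulr_gt0// ?exprn_gt0.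
have K2 : K ^+ 2 = 16 * (lambda * nu) ^+ 2 by rewrite /K; ring.
have K20 : 0 < K ^+ 2 by rewrite K2 mulr_gt0.
have K0 : K != 0 by rewrite -sqrf_eq0 gt_eqF.
have finZ : (\int[P]_omega (l2norm (feature t omega) ^+ 2)%:E < +oo)%E.
  have mZ2 : measurable_fun setT (fun omega => l2norm (feature t omega) ^+ 2).
    by apply: measurable_funX; exact: random_vector_l2norm.
  have c0 : 0 <= M%:R * Lphi ^+ 2 * (2 * su) ^+ 2.
    by apply: mulr_ge0; [apply: mulr_ge0 => //|]; exact: sqr_ge0.
  have le1 omega : l2norm (feature t omega) ^+ 2 <=
      M%:R * Lphi ^+ 2 * (2 * su) ^+ 2 * F t omega.
    apply: le_trans (feature_energy omega tt) _.
    have c1 : 0 <= M%:R * Lphi ^+ 2 by apply: mulr_ge0 => //; exact: sqr_ge0.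
    rewrite -[leRHS]mulrA ler_wpM2l//.
    rewrite mulr_sumr; apply: ler_sum => j _.
    have := expR_ge1Dx (v (t - j)%N omega); rewrite {1}/v => h.
    rewrite mulrC -ler_pdivrMr ?exprn_gt0 ?mulr_gt0//; lra.
  have h1 := le_integral_scale P mZ2 (mF tt) (fun=> sqr_ge0 _) (F0 t) c0 le1.
  apply: le_lt_trans h1 _.
  apply: le_lt_trans (lee_wpmul2l _ (intF tt)) _; first by rewrite lee_fin.
  by rewrite -EFinM ltry.
have quad (i : 'I_r) := second_moment_quad (row i D)^T mZ finZ.
have row_ge (i : 'I_r) : ((lambda ^+ 2 * l2norm (row i D) ^+ 2)%:E <=
    \int[P]_omega ((((row i D)^T^T *m feature t omega) 0 0) ^+ 2)%:E)%E.
  rewrite quad lee_fin.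
  have [_ /(_ (row i D)^T)] := excite tt.
  rewrite mulmxBr mulmxBl mxE -/(feature t).
  have -> : (- ((row i D)^T^T *m (lambda ^+ 2)%:M *m (row i D)^T)) 0 0 =
      - (lambda ^+ 2 * l2norm (row i D) ^+ 2).
    rewrite mxE mul_mx_scalar -scalemxAl mxE; congr (- (_ * _)).
    rewrite l2norm_sqr big_ord1 mxE; apply: eq_bigr => k _.
    by rewrite !mxE expr2.
  by rewrite subr_ge0.
have mrow (i : 'I_r) : measurable_fun setT
    (fun omega => (((row i D)^T^T *m feature t omega) 0 0) ^+ 2).
  apply: measurable_funX.
  rewrite (_ : (fun omega => _) =
    fun omega => \sum_k D i k * feature t omega k 0); last first.
    by apply/funext => omega; rewrite mxE; apply: eq_bigr => k _; rewrite !mxE.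
  apply: measurable_sum => k.
  by apply: (@measurable_funM _ _ _ setT (cst (D i k))) => //; exact: mZ.
have -> : (\int[P]_omega ((l2norm (D *m feature t omega) / K) ^+ 2)%:E =
    (K ^- 2)%:E * \sum_(i < r) \int[P]_omega
      ((((row i D)^T^T *m feature t omega) 0 0) ^+ 2)%:E)%E.
  rewrite -ge0_integral_sum//; last 2 first.
  - by move=> i; apply/measurable_EFinP; exact: mrow.
  - by move=> i omega _; rewrite lee_fin sqr_ge0.
  rewrite -ge0_integralZl_EFin//; last 3 first.
  - by move=> omega _; apply: sume_ge0 => i _; rewrite lee_fin sqr_ge0.
  - by apply: emeasurable_sum => i; apply/measurable_EFinP; exact: mrow.
  - by rewrite invr_ge0 ltW.
  apply: eq_integral => omega _; rewrite sumEFin -EFinM; congr EFin.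
  rewrite expr_div_n mulrC l2norm_sqr; congr (_ * _); apply: eq_bigr => i _.
  rewrite big_ord1 !mxE; congr (_ ^+ 2); apply: eq_bigr => k _.
  by rewrite !mxE.
have c0 : (0 <= (K ^- 2)%:E)%E by rewrite lee_fin invr_ge0 ltW.
apply: (@le_trans _ _ ((K ^- 2)%:E *
    \sum_(i < r) (lambda ^+ 2 * l2norm (row i D) ^+ 2)%:E)%E); last first.
  by apply: lee_wpmul2l => //; apply: lee_sum => i _; exact: row_ge.
rewrite sumEFin -EFinM lee_fin -mulr_sumr.
have -> : \sum_(i < r) l2norm (row i D) ^+ 2 = l2norm D ^+ 2.
  rewrite l2norm_sqr; apply: eq_bigr => i _; rewrite l2norm_sqr big_ord1.
  by apply: eq_bigr => j _; rewrite mxE.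
rewrite le_eqVlt; apply/orP; left; apply/eqP.
have nu0 : nu != 0.
  by move: ln0; rewrite exprMn; case: eqP => // ->; rewrite expr0n mulr0 ltxx.
by rewrite /K; field; rewrite nu0 gt_eqF.
Qed.

(** For a matrix unit [D], the mean of [1 + y ^+ 2] is at most that of [expR (y ^+ 2)], hence at
    most 2, while excitation puts it at or above [1 + 1 / (16 * nu ^+ 2)]. Positive dimensions are
    what makes a [D] of norm 1 available. *)
Lemma nu_ge_quarter r : (0 < r)%N -> (0 < M)%N -> 4^-1 <= nu.
Proof.
move=> r0 M0; have tt : (tau <= tau < T)%N by rewrite leqnn.
pose D : 'M[R]_(r, M) := delta_mx (Ordinal r0) (Ordinal M0).
have D1 : l2norm D ^+ 2 = 1.
  rewrite l2norm_sqr (bigD1 (Ordinal r0))//= (bigD1 (Ordinal M0))//= !mxE !eqxx.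
  rewrite !big1 ?addr0 ?expr1n//.
    move=> i /negbTE ir; rewrite big1// => j _.
    by rewrite mxE ir expr0n.
  by move=> j /negbTE jr; rewrite mxE jr andbF expr0n.
have D1' : l2norm D <= 1 by rewrite -ler_sqr ?nnegrE ?l2norm_ge0// D1 expr1n.
have := excitation D tt M0; rewrite D1 => h1.
have h2 := normalized_exp_moment tt M0 D1'.
have gM : gen_vec [set s | (tau - tau <= s <= tau)%N] u `<=` measurable.
  apply: gen_vec_measurable => s /= /andP[_ st]; apply: mu.
  exact: leq_ltn_trans st tauT.
pose y omega := l2norm (D *m feature tau omega) / K.
have my : measurable_fun setT y.
  apply: measurable_funM => //.
  exact: (g_sigma_measurable_fun gM (l2norm_mul_feature_measurable D tt)).
have h3 : (1 + \int[P]_omega (y omega ^+ 2)%:E <= 2%:E)%E.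
  apply: le_trans h2.
  have -> : (1 = \int[P]_omega (cst 1%E omega))%E.
    by rewrite integral_cst// mul1e; exact/esym/probability_setT.
  have my2 : measurable_fun setT (fun omega => (y omega ^+ 2)%:E).
    by apply/measurable_EFinP; exact: measurable_funX.
  rewrite -ge0_integralD//; last by move=> omega _; rewrite lee_fin sqr_ge0.
  apply: ge0_le_integral => //.
  - by move=> omega _; rewrite adde_ge0// lee_fin sqr_ge0.
  - exact: emeasurable_funD.
  - apply/measurable_EFinP; apply: (@measurableT_comp _ _ _ _ _ _ (@expR R)) => //.
    exact: measurable_funX.
  - by move=> omega _; rewrite lee_fin expR_ge1Dx.
have := le_trans (leeD2l 1 h1) h3.
rewrite -EFinD lee_fin.
have nu0 := nu_ge0.
move=> h.
have n2 : 0 < nu ^+ 2.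
  have : 0 < (lambda * nu) ^+ 2.
    by rewrite nu_sq !mulr_gt0 ?exprn_gt0// ltr0n.
  by rewrite exprMn pmulr_rgt0// exprn_gt0.
have : 1 / (16 * nu ^+ 2) <= 1 by lra.
rewrite ler_pdivrMr; last by rewrite mulr_gt0.
move=> h16.
rewrite -ler_sqr ?nnegrE//; lra.
Qed.

End Features.

(** * Lower tail of the signed sum *)

(** The choices [al = 32 * nu] and [th = kap / (2 ^+ 16 * nu ^+ 3)] balance the terms: with [X] the
    exponent on the right, the gain is at least [2 * X], and the fourth-moment and quadratic losses
    are [X / 2] each, leaving [1 - X]. *)
Lemma block_constants_le (R : realType) (nu kap b : R) :
  0 < nu -> (64 * nu ^+ 2)^-1 <= b -> 0 <= kap ->
  1 + 4 * (kap / (2 ^+ 16 * nu ^+ 3)) * kap / (32 * nu) ^+ 3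
    + 8 * (kap / (2 ^+ 16 * nu ^+ 3)) ^+ 2
    - (kap / (2 ^+ 16 * nu ^+ 3)) * kap / (32 * nu) * b <=
  expR (- (kap ^+ 2 / (2 ^+ 28 * nu ^+ 6))).
Proof.
move=> nu0 hb kap0; apply: le_trans (expR_ge1Dx _).
have c0 : 0 <= (kap / (2 ^+ 16 * nu ^+ 3)) * kap / (32 * nu).
  by rewrite !mulr_ge0// ?invr_ge0// ?mulr_ge0// ?exprn_ge0// ltW.
have := ler_wpM2l c0 hb.
set X := kap ^+ 2 / _.
have -> : (kap / (2 ^+ 16 * nu ^+ 3)) * kap / (32 * nu) * (64 * nu ^+ 2)^-1 = 2 * X.
  by rewrite /X; field; rewrite gt_eqF.
have -> : 4 * (kap / (2 ^+ 16 * nu ^+ 3)) * kap / (32 * nu) ^+ 3 = X / 2.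
  by rewrite /X; field; rewrite gt_eqF.
have -> : 8 * (kap / (2 ^+ 16 * nu ^+ 3)) ^+ 2 = X / 2.
  by rewrite /X; field; rewrite gt_eqF.
lra.
Qed.

Lemma mod_class_gap (l k c : nat) :
  (l < k)%N -> (l %% c = k %% c)%N -> (l + c <= k)%N.
Proof.
move=> lk /esym/eqP; rewrite eqn_mod_dvd; last exact: ltnW.
by move=> /dvdn_leq; rewrite subn_gt0 lk => /(_ isT); lia.
Qed.

Section AttackBlocks.
Context disp (Omega : measurableType disp) (R : realType) (P : probability Omega R)
  (m M tau T : nat) (U : set 'cV[R]_m) (phi : 'I_M -> 'M[R]_(m, tau.+1) -> R)
  (u : nat -> Omega -> 'cV[R]_m) (Lphi lambda su p : R)
  (xi : nat -> {RV P >-> bool}).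
Hypotheses (tau0 : (0 < tau)%N) (tauT : (tau < T)%N)
  (mu : forall t, (t < T)%N -> random_vector (u t))
  (Uu : forall t omega, (t < T)%N -> U (u t omega)) (U0 : U 0)
  (Lphi0 : 0 < Lphi)
  (phiL : forall i W W', in_windows U W -> in_windows U W' ->
    `|phi i W - phi i W'| <= Lphi * l2norm (W - W'))
  (lambda0 : 0 < lambda)
  (excite : forall t, (tau <= t < T)%N ->
    psd (second_moment P
           (fun omega => Phi phi (window tau (fun s => u s omega) t))
         - (lambda ^+ 2)%:M))
  (phi0 : Phi phi 0 = 0)
  (indu : mutual_independence P (fun t : 'I_T => sigma_vec [set t : nat] u))
  (su0 : 0 < su) (sgu : forall t, (t < T)%N -> subgaussian_le P (u t) su)
  (p0 : 0 <= p) (p1 : p <= 1)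
  (dxi : forall t A, distribution P (xi t) A = bernoulli_prob p A)
  (indxi : mutual_independence P
    (fun t : nat => sigma_gen [set t] (fun s => xi s : Omega -> bool)))
  (indxiu : independent2 P
    (sigma_gen [set: nat] (fun s => xi s : Omega -> bool))
    (sigma_vec [set t | (t < T)%N] u)).

Let nu := nu_ratio M tau Lphi su lambda.
Let K := 4 * lambda * nu.
Let kap := attack_gap p tau.
Hypothesis kap0 : 0 < kap.

Let gen_xi (J : set nat) : set (set Omega) :=
  [set A | exists2 i, J i & exists2 B : set bool, measurable B & A = xi i @^-1` B].

Let gen_xi_measurable J : gen_xi J `<=` measurable.
Proof.
move=> _ [i _ [B mB ->]]; rewrite -[X in measurable X]setTI.
exact: (measurable_funPT (xi i)).
Qed.

(** The time [t] itself is left out because [w t] acts only on the next state, not on [y t]. The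
    intersection over a finite set is the form in which mutual independence is stated. *)
Definition clean t : set Omega :=
  \bigcap_(s in [set` [fset s in iota (t - tau) tau]%fset]) (xi s @^-1` [set false]).

Definition attack_sign t omega : R := 2 * \1_(clean t) omega - 1.

Let clean_measurable (J : set nat) t :
  (forall s, (t - tau <= s < t)%N -> J s) -> (tau <= t)%N -> <<s gen_xi J >> (clean t).
Proof.
move=> tJ tt; apply: (@fin_bigcap_measurable _ (g_sigma_algebraType (gen_xi J))) => //.
move=> s /=; rewrite !inE mem_iota subnK// => st.
apply: sub_sigma_algebra; exists s; first exact: tJ.
by exists [set false].
Qed.

Let prob_clean t : (tau <= t)%N -> P (clean t) = ((1 - p) ^+ tau)%:E.
Proof.
move=> tt.
have ps s : P (xi s @^-1` [set false]) = (1 - p)%:E.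
  have := dxi s [set false]; rewrite /distribution/= /pushforward => ->.
  rewrite bernoulli_probE ?p0// !diracE memNset//= mem_set//=.
  by rewrite mule0 add0e mule1.
have pc (l : seq nat) : (\prod_(s <- l) P (xi s @^-1` [set false]) =
    ((1 - p) ^+ size l)%:E)%E.
  elim: l => [|s l IH]; first by rewrite big_nil.
  by rewrite big_cons IH ps -EFinM exprS.
rewrite /clean indxi; last first.
  move=> s _; apply: sub_sigma_algebra; exists s => //.
  by exists [set false].
rewrite pc; congr ((_ ^+ _)%:E).
rewrite (@perm_size _ _ (iota (t - tau) tau)) ?size_iota//.
apply: uniq_perm; rewrite ?fset_uniq ?iota_uniq//.
by move=> s; rewrite !inE.
Qed.

Lemma attack_gap_le1 : kap <= 1.
Proof.
have : (1 - p) ^+ tau <= 1 by rewrite exprn_ile1// ?subr_ge0// gerBl.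
rewrite /kap /attack_gap; lra.
Qed.

Let G (k : 'I_T + nat) : set (set Omega) :=
  match k with inl s => gen_vec [set s : nat] u | inr s => gen_xi [set s] end.

Let G_measurable k : G k `<=` measurable.
Proof.
case: k => [s|s] /=; last exact: gen_xi_measurable.
by apply: gen_vec_measurable => _ ->; exact: mu.
Qed.

Let G_independent : mutual_independence P (fun k => <<s G k >>).
Proof.
have -> : (fun k => <<s G k >>) = (fun k : 'I_T + nat =>
    match k with inl i => sigma_vec [set i : nat] u
    | inr j => sigma_gen [set j] (fun s => xi s : Omega -> bool) end).
  by apply/funext; case.
apply: (@mutual_independence_sum _ _ _ P _ _ _ _
  (gen_vec [set t | (t < T)%N] u) (gen_xi setT)) => //.
- move=> i; apply: sub_sigma_algebra2 => E [ti [/= -> _] BE].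
  by exists (i : nat, ti.2) => //=; split.
- move=> j; apply: sub_sigma_algebra2 => E [s _ BE].
  by exists s.
- exact: independent2_sym.
Qed.

Section SignedSum.
Variables (r : nat) (D : 'M[R]_(r, M)).
Hypotheses (M0 : (0 < M)%N) (r0 : (0 < r)%N) (D1 : l2norm D <= 1) (D2 : 2^-1 <= l2norm D).

Let y t omega := l2norm (D *m feature phi u t omega) / K.
Let th := kap / (2 ^+ 16 * nu ^+ 3).
Let gam := kap ^+ 2 / (2 ^+ 28 * nu ^+ 6).
Let h t omega := expR (- (th * (y t omega * attack_sign t omega)) + gam).

Let nu4 : 4^-1 <= nu.
Proof. exact: (nu_ge_quarter tau0 tauT mu Uu U0 Lphi0 phiL lambda0 excite phi0 su0 sgu r0 M0). Qed.

Let nu0 : 0 < nu. Proof. apply: lt_le_trans nu4; by rewrite invr_gt0. Qed.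

Let K0 : 0 < K. Proof. by apply: mulr_gt0 => //; apply: mulr_gt0. Qed.

(** All inputs and attack indicators that the term at [t] depends on. Blocks of two times at
    distance at least [tau.+1] are disjoint. *)
Let B t : set ('I_T + nat) := [set k : 'I_T + nat | match k with
  | inl s => (t - tau <= s <= t)%N | inr s => (t - tau <= s < t)%N end].

Let y_measurable t (H : set (set Omega)) : (tau <= t < T)%N ->
  gen_vec [set s | (t - tau <= s <= t)%N] u `<=` <<s H >> ->
  measurable_fun setT (y t : g_sigma_algebraType H -> R).
Proof.
move=> tt sub.
apply: (@measurable_funM _ (g_sigma_algebraType H) _ setT _ (cst K^-1)) => //.
apply: sub_g_sigma_measurable_fun sub _.
exact: (l2norm_mul_feature_measurable Uu Lphi0 phiL).
Qed.

Let subB t : (tau <= t < T)%N ->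
  gen_vec [set s | (t - tau <= s <= t)%N] u `<=`
  <<s \bigcup_(k in B t) <<s G k >> >>.
Proof.
move=> /andP[_ tT] E [[s i] [/= st _] BE].
apply: sub_sigma_algebra.
have sT : (s < T)%N by apply: leq_ltn_trans tT; case/andP: st.
exists (inl (Ordinal sT)) => //=; apply: sub_sigma_algebra.
by exists (s, i).
Qed.

Let sgn_measurable t (H : set (set Omega)) : <<s H >> (clean t) ->
  measurable_fun setT (attack_sign t : g_sigma_algebraType H -> R).
Proof.
move=> Hc; apply: measurable_funB => //.
exact: (@measurable_funM _ (g_sigma_algebraType H) _ setT (cst 2)).
Qed.

Let cleanB t : (tau <= t < T)%N -> <<s \bigcup_(k in B t) <<s G k >> >> (clean t).
Proof.
move=> /andP[tt _].
apply: (@fin_bigcap_measurable _ (g_sigma_algebraType (\bigcup_(k in B t) <<s G k >>))) => //.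
move=> s /=; rewrite !inE mem_iota subnK// => st.
apply: sub_sigma_algebra; exists (inr s) => //=; apply: sub_sigma_algebra.
by exists s => //; exists [set false].
Qed.

Let h_measurable t : (tau <= t < T)%N -> measurable_fun setT
  (h t : g_sigma_algebraType (\bigcup_(k in B t) <<s G k >>) -> R).
Proof.
move=> tt; set H := \bigcup_(k in _) _.
apply: (@measurableT_comp _ _ _ _ _ _ (@expR R)) => //.
apply: (@measurable_funD _ (g_sigma_algebraType H) _ setT _ (cst gam)) => //.
apply: measurable_funN.
apply: (@measurable_funM _ (g_sigma_algebraType H) _ setT (cst th)) => //.
apply: measurable_funM; first exact: y_measurable (subB tt).
exact: sgn_measurable (cleanB tt).
Qed.

Let h_moment t : (tau <= t < T)%N -> (\int[P]_omega (h t omega)%:E <= 1%:E)%E.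
Proof.
move=> tt; have /andP[t1 t2] := tt.
have q1 : 0 <= 2 * (1 - p) ^+ tau - 1 by exact: ltW.
have ug : gen_vec [set t | (t < T)%N] u `<=` measurable.
  by apply: gen_vec_measurable.
have my : measurable_fun setT
    (y t : g_sigma_algebraType (gen_vec [set t | (t < T)%N] u) -> R).
  apply: y_measurable => // E [[s i] [/= st _] BE]; apply: sub_sigma_algebra.
  exists (s, i) => //=; split => //=.
  by apply: leq_ltn_trans t2; case/andP: st.
have y0 omega : 0 <= y t omega.
  by rewrite divr_ge0 ?l2norm_ge0// ltW.
have cl : <<s gen_xi setT >> (clean t) by exact: clean_measurable.
have th0 : 0 <= th.
  by rewrite divr_ge0 ?(ltW kap0)// mulr_ge0 ?exprn_ge0// ltW.
have n3 : 0 < nu ^+ 3 by rewrite exprn_gt0.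
have th1 : th <= 1.
  rewrite ler_pdivrMr ?mul1r; last by rewrite mulr_gt0// exprn_gt0.
  apply: (le_trans attack_gap_le1).
  have n64 : 64^-1 <= nu ^+ 3.
    have -> : 64^-1 = (4^-1) ^+ 3 :> R by field.
    by rewrite lerXn2r// nnegrE// ltW.
  lra.
have al0 : 0 < 32 * nu by rewrite mulr_gt0.
have yE := normalized_exp_moment tau0 mu Uu U0 Lphi0 phiL lambda0 phi0 su0 sgu tt M0 D1.
have yb := excitation tau0 mu Uu U0 Lphi0 phiL lambda0 excite phi0 su0 sgu D tt M0.
have I1 := signed_exp_moment (@gen_xi_measurable setT) ug indxiu cl (prob_clean t1) q1 my y0
  yE yb th0 th1 al0.
have hb : (64 * nu ^+ 2)^-1 <= l2norm D ^+ 2 / (16 * nu ^+ 2).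
  have -> : (64 * nu ^+ 2)^-1 = (2^-1) ^+ 2 / (16 * nu ^+ 2).
    by field; rewrite gt_eqF.
  have c0 : 0 <= (16 * nu ^+ 2)^-1.
    by rewrite invr_ge0; apply: mulr_ge0 => //; exact: sqr_ge0.
  apply: ler_wpM2r => //.
  by rewrite ler_sqr ?nnegrE ?l2norm_ge0 ?invr_ge0.
have I2 : (\int[P]_omega (expR (- (th * (y t omega * attack_sign t omega))))%:E <=
    (expR (- gam))%:E)%E.
  apply: le_trans I1 _; rewrite lee_fin.
  exact: (block_constants_le nu0 hb (ltW kap0)).
have my1 : measurable_fun setT (y t) by exact: g_sigma_measurable_fun ug my.
have ms : measurable_fun setT (attack_sign t).
  apply: (g_sigma_measurable_fun (@gen_xi_measurable setT)).
  exact: sgn_measurable.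
have mS : measurable_fun setT (fun omega => - (th * (y t omega * attack_sign t omega))).
  apply: measurable_funN; apply: (@measurable_funM _ _ _ setT (cst th)) => //.
  exact: measurable_funM.
have mE : measurable_fun setT (fun omega => expR (- (th * (y t omega * attack_sign t omega)))).
  exact: (@measurable_comp _ _ _ _ _ _ setT (@expR R)).
have mh : measurable_fun setT (h t).
  apply: (@measurableT_comp _ _ _ _ _ _ (@expR R)) => //.
  exact: measurable_funD.
have hle omega : h t omega <= expR gam * expR (- (th * (y t omega * attack_sign t omega))).
  by rewrite /h addrC expRD.
apply: le_trans (le_integral_scale P mh mE (fun=> expR_ge0 _) (fun=> expR_ge0 _)
  (expR_ge0 gam) hle) _.
have e0 : (0 <= (expR gam)%:E)%E by rewrite lee_fin expR_ge0.
apply: le_trans (lee_wpmul2l e0 I2) _.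
by rewrite -EFinM -expRD subrr expR0.
Qed.

(* Jensen over the residue classes modulo [tau.+1] replaces a union bound, and
   adding [gam] to each term makes the size of the classes irrelevant. *)
Let Psi omega := \sum_(t < T | (tau <= t)%N) (- (th * (y t omega * attack_sign t omega)) + gam).

Let q (j : 'I_tau.+1) (t : nat) := (tau <= t)%N && ((t %% tau.+1)%N == j).

Let class_moment (j : 'I_tau.+1) :
  (\int[P]_omega (\prod_(t < T | q j t) h t omega)%:E <= 1%:E)%E.
Proof.
have := @integral_prod_blocks _ _ _ P _ G B (q j) h (fun=> 1) T G_measurable G_independent.
rewrite big1//; apply => //.
- move=> k l /andP[lk kT] /andP[tk /eqP kj] /andP[tl /eqP lj].
  have lk' : (l + tau.+1 <= k)%N by apply: mod_class_gap; rewrite ?lk// kj lj.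
  clear -lk'.
  apply/seteqP; split => // -[s|s] [/=]; lia.
- by move=> k kT /andP[tk _]; apply: h_measurable; rewrite tk.
- by move=> k omega; exact: expR_ge0.
- by move=> k kT /andP[tk _]; apply: h_moment; rewrite tk.
Qed.

(** The threshold is tuned so that [th / K] times it equals [gam / 2 * (T - tau)]. On the bad event
    [Psi] then keeps half of its offset [gam * (T - tau)], and Markov's inequality applies to
    [expR (Psi / tau.+1)], whose mean is at most 1. *)
Lemma signed_sum_tail :
  measurable [set omega | \sum_(t < T | (tau <= t)%N)
        l2norm (D *m feature phi u t omega) * attack_sign t omega
      <= lambda * kap / (2 ^+ 11 * nu ^+ 2) * (T - tau)%:R] /\
  (P [set omega | (\sum_(t < T | (tau <= t)%N)
        l2norm (D *m feature phi u t omega) * attack_sign t omega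
      <= lambda * kap / (2 ^+ 11 * nu ^+ 2) * (T - tau)%:R)%R]
   <= (expR (- (kap ^+ 2 / (2 ^+ 29 * nu ^+ 6) * (T - tau)%:R / tau.+1%:R)))%:E)%E.
Proof.
have tt (t : 'I_T) : (tau <= t)%N -> (tau <= t < T)%N by rewrite ltn_ord andbT.
have PsiE omega : Psi omega =
    \sum_(j < tau.+1) \sum_(t < T | q j t) (- (th * (y t omega * attack_sign t omega)) + gam).
  rewrite /Psi (partition_big (fun t : 'I_T => (inord (t %% tau.+1)%N : 'I_tau.+1)) xpredT)//=.
  apply: eq_bigr => j _; apply: eq_bigl => t; rewrite /q -val_eqE/= inordK//.
  exact: ltn_pmod.
have hge0 t omega : 0 <= h t omega by exact: expR_ge0.
have mh t : (tau <= t < T)%N -> measurable_fun setT (h t).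
  move=> tT; apply: (g_sigma_measurable_fun _ (h_measurable tT)).
  by move=> E [k _]; exact: (g_sigma_algebra_sub (@G_measurable k)).
pose H j omega := \prod_(t < T | q j t) h t omega.
have mH j : measurable_fun setT (H j).
  rewrite (_ : H j = fun omega => \prod_(t < T) (if q j t then h t omega else 1)).
    apply: measurable_prod => t _; case qt : (q j t) => //.
    by apply: mh; apply: tt; case/andP: qt.
  by apply/funext => omega; rewrite /H big_mkcond.
have H0 j omega : 0 <= H j omega by exact: prodr_ge0.
have mHs : measurable_fun setT (fun omega => \sum_(j < tau.+1) H j omega).
  exact: measurable_sum.
have Hs0 omega : 0 <= \sum_(j < tau.+1) H j omega by exact: sumr_ge0.
have mPsi : measurable_fun setT (fun omega => expR (tau.+1%:R^-1 * Psi omega)).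
  (* Each class sum is the [ln] of the product [H j], so measurability is inherited from [H j]. *)
  rewrite (_ : (fun omega => _) = fun omega =>
      expR (tau.+1%:R^-1 * \sum_(j < tau.+1) ln (H j omega))).
    apply: (@measurableT_comp _ _ _ _ _ _ (@expR R)) => //.
    apply: (@measurable_funM _ _ _ setT (cst _)) => //.
    apply: measurable_sum => j.
    by apply: (@measurableT_comp _ _ _ _ _ _ (@ln R)) => //; exact: measurable_ln.
  apply/funext => omega; rewrite PsiE; congr (expR (_ * _)); apply: eq_bigr => j _.
  by rewrite /H -expR_sum expRK.
have k0 : 0 <= tau.+1%:R^-1 :> R by rewrite invr_ge0.
have jen omega : expR (tau.+1%:R^-1 * Psi omega) <=
    tau.+1%:R^-1 * \sum_(j < tau.+1) H j omega.
  rewrite PsiE; apply: le_trans (jensen_expR _) _; rewrite ler_wpM2l//.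
  by apply: ler_sum => j _; rewrite expR_sum.
have I1 := le_integral_scale P mPsi mHs (fun=> expR_ge0 _) Hs0 k0 jen.
have I2 : (\int[P]_omega (\sum_(j < tau.+1) H j omega)%:E <= (\sum_(j < tau.+1) 1)%:E)%E.
  under eq_integral do rewrite -sumEFin.
  rewrite ge0_integral_sum//.
  - by rewrite -sumEFin; apply: lee_sum => j _; exact: class_moment.
  - by move=> j; exact/measurable_EFinP.
  - by move=> j omega _; rewrite lee_fin.
have I3 : (\int[P]_omega (expR (tau.+1%:R^-1 * Psi omega))%:E <= 1%:E)%E.
  apply: le_trans I1 _; apply: le_trans (lee_wpmul2l _ I2) _; first by rewrite lee_fin.
  by rewrite -EFinM sumr_const card_ord mulVf.
pose thr := - (lambda * kap / (2 ^+ 11 * nu ^+ 2) * (T - tau)%:R).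
have mbad : measurable [set omega | \sum_(t < T | (tau <= t)%N)
        l2norm (D *m feature phi u t omega) * attack_sign t omega
      <= lambda * kap / (2 ^+ 11 * nu ^+ 2) * (T - tau)%:R].
  rewrite (_ : [set omega | _] = [set omega | thr <=
      \sum_(t < T | (tau <= t)%N)
        - (l2norm (D *m feature phi u t omega) * attack_sign t omega)]); last first.
    by apply/seteqP; split => omega /=; rewrite sumrN lerNr opprK.
  apply: measurable_set_ge.
  rewrite (_ : (fun omega => _) = fun omega => \sum_(t < T) (if (tau <= t)%N then
      - (l2norm (D *m feature phi u t omega) * attack_sign t omega) else 0)); last first.
    by apply/funext => omega; rewrite big_mkcond.
  apply: measurable_sum => t; case: (boolP (tau <= t)%N) => // tt'.
  have ug : gen_vec [set s | (t - tau <= s <= t)%N] u `<=` measurable.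
    apply: gen_vec_measurable => s /= /andP[_ st]; apply: mu.
    exact: leq_ltn_trans st (ltn_ord t).
  apply: measurable_funN; apply: measurable_funM.
    apply: (g_sigma_measurable_fun ug).
    exact: (l2norm_mul_feature_measurable Uu Lphi0 phiL D (tt t tt')).
  apply: (g_sigma_measurable_fun (@gen_xi_measurable setT)).
  by apply: sgn_measurable; exact: clean_measurable.
split => //.
have := prob_ge_le_integral mPsi (fun=> expR_ge0 _) (expR_gt0 (gam / 2 * (T - tau)%:R / tau.+1%:R)) I3.
move=> h0; apply: le_trans (le_trans h0 _); last first.
  rewrite mul1r -expRN lee_fin ler_expR lerN2 le_eqVlt; apply/orP; left.
  by apply/eqP; congr (_ * _ / _); rewrite /gam; field; rewrite gt_eqF.
apply: le_measure; rewrite ?inE.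
- exact: mbad.
- exact: measurable_set_ge.
move=> omega /= hS; rewrite ler_expR.
have -> : Psi omega = gam * (T - tau)%:R -
    th / K * \sum_(t < T | (tau <= t)%N) l2norm (D *m feature phi u t omega) * attack_sign t omega.
  rewrite /Psi big_split/= addrC -[in X in X + _ = _](big_geq_mkord _ _ xpredT (fun=> gam)).
  rewrite sumr_const_nat; congr (_ + _); first by rewrite mulr_natr.
  rewrite mulr_sumr -sumrN; apply: eq_bigr => t _.
  by rewrite /y; ring.
rewrite [leRHS]mulrC ler_wpM2r//.
have tk0 : 0 <= th / K.
  rewrite divr_ge0 ?(ltW K0)//; rewrite divr_ge0 ?(ltW kap0)//.
  by rewrite mulr_ge0 ?exprn_ge0// ltW.
have := ler_wpM2l tk0 hS.
have -> : th / K * (lambda * kap / (2 ^+ 11 * nu ^+ 2) * (T - tau)%:R) =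
    gam / 2 * (T - tau)%:R.
  by rewrite /th /K /gam; field; rewrite !gt_eqF.
lra.
Qed.

End SignedSum.
End AttackBlocks.

(** * A net of the unit sphere *)

(** The ratio [expR (- e)] is at most [1 - e / 2], by the quadratic bound and [e <= 1/2]. *)
Lemma geometric_expRN_le (R : realType) (e : R) (n : nat) : 0 < e -> e <= 2^-1 ->
  \sum_(k < n) expR (- (e * k%:R)) <= 2 / e.
Proof.
move=> e0 e2; pose x := expR (- e).
have hx : x <= 1 - e / 2.
  have := expRN_le_quad (ltW e0); rewrite -/x.
  have : e ^+ 2 <= e * 2^-1 by rewrite expr2 ler_pM2l.
  lra.
have -> : \sum_(k < n) expR (- (e * k%:R)) = \sum_(k < n) x ^+ k.
  by apply: eq_bigr => k _; rewrite /x -expRM_natl mulrN mulrC.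
have x0 : 0 <= x by exact: expR_ge0.
have h : (1 - x) * \sum_(k < n) x ^+ k <= 1.
  rewrite -opprB mulNr -subrX1 opprB gerBl; exact: exprn_ge0.
rewrite ler_pdivlMr//.
have S0 : 0 <= \sum_(k < n) x ^+ k by apply: sumr_ge0 => k _; exact: exprn_ge0.
have : (e / 2) * \sum_(k < n) x ^+ k <= (1 - x) * \sum_(k < n) x ^+ k.
  by rewrite ler_wpM2r//; lra.
lra.
Qed.

Section SphereNet.
Context (R : realType) (r M : nat) (eps : R).
Hypotheses (r0 : (0 < r)%N) (M0 : (0 < M)%N) (eps0 : 0 < eps) (eps2 : eps <= 2^-1).

Let d : R := (r * M)%:R.
Let d0 : 0 < d. Proof. by rewrite ltr0n muln_gt0 r0. Qed.
(** Mesh for which [d] coordinate errors of size [h] give a total l2 error of [eps]. *)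
Let h := eps / Num.sqrt d.
Let h0 : 0 < h. Proof. by rewrite divr_gt0// sqrtr_gt0. Qed.
Let n := Num.truncn (h^-1).

Let Z := {ffun 'I_r * 'I_M -> bool * 'I_n.+1}.
Let pt (z : Z) : 'M[R]_(r, M) :=
  \matrix_(i, j) ((-1) ^+ (z (i, j)).1 * ((z (i, j)).2%:R * h)).
(** The norm conditions lose no needed point: rounding a unit matrix towards zero does not increase
    its norm, and an error of at most [eps <= 1/2] leaves norm at least 1/2. *)
Let good (z : Z) := [&& eps * (\sum_ij (z ij).2%:R) <= d,
  l2norm (pt z) <= 1 & 2^-1 <= l2norm (pt z)].

(* Lattice points are counted through the weight [expR (d - eps * l1)], which is
   at least 1 on the points kept and factorizes over coordinates; restricting
   the l1 norm loses nothing since it is at most [sqrt d] times the l2 norm. *)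
Lemma sphere_net : exists s : seq 'M[R]_(r, M),
  [/\ (size s)%:R <= (4 * expR 1 / eps) ^+ (r * M),
      forall D, D \in s -> 2^-1 <= l2norm D <= 1 &
      forall D, l2norm D = 1 -> exists2 E, E \in s & l2norm (D - E) <= eps].
Proof.
exists [seq pt z | z <- enum good]; split.
- rewrite size_map -cardE -sum1_card natr_sum.
  apply: (@le_trans _ _ (\sum_(z : Z) expR d * \prod_ij expR (- (eps * (z ij).2%:R)))).
    rewrite big_mkcond; apply: ler_sum => z _.
    have e0 : 0 <= expR d * \prod_ij expR (- (eps * (z ij).2%:R)).
      by rewrite mulr_ge0 ?expR_ge0//; apply: prodr_ge0 => ij _; exact: expR_ge0.
    case: ifP => // /and3P[zd _ _].
    by rewrite -expR_sum -expRD -[leLHS]expR0 ler_expR sumrN -mulr_sumr subr_ge0.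
  (* Each coordinate contributes 2 for the sign, [2 / eps] for the geometric series and [expR 1]
     from [expR d], which together give the base [4 * expR 1 / eps]. *)
  rewrite -mulr_sumr -(bigA_distr_bigA (fun (_ : 'I_r * 'I_M) (bk : bool * 'I_n.+1) =>
    expR (- (eps * bk.2%:R)))).
  have -> : expR d = \prod_(ij : 'I_r * 'I_M) expR 1.
    by rewrite prodr_const card_prod !card_ord /d -expRM_natl mulr1.
  rewrite -big_split/=.
  have -> : (4 * expR 1 / eps) ^+ (r * M) =
      \prod_(ij : 'I_r * 'I_M) (4 * expR 1 / eps).
    by rewrite prodr_const card_prod !card_ord.
  apply: ler_prod => ij _; apply/andP; split.
    by rewrite mulr_ge0 ?expR_ge0//; apply: sumr_ge0 => bk _; exact: expR_ge0.
  rewrite (_ : \sum_(j : bool * 'I_n.+1) expR (- (eps * j.2%:R)) =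
    2 * \sum_(k < n.+1) expR (- (eps * k%:R))).
    have := ler_wpM2l (expR_ge0 1) (geometric_expRN_le n.+1 eps0 eps2).
    lra.
  rewrite -(pair_big xpredT xpredT (fun (b : bool) (k : 'I_n.+1) => expR (- (eps * k%:R))))/=.
  by rewrite sumr_const card_bool mulr_natl.
- by move=> _ /mapP[z + ->]; rewrite mem_enum => /and3P[_ -> ->].
move=> D D1.
have Dij i j : `|D i j| <= 1.
  rewrite -D1 -ler_sqr ?nnegrE ?l2norm_ge0// real_normK ?num_real//.
  rewrite l2norm_sqr (bigD1 i)//= (bigD1 j)//= -addrA lerDl addr_ge0//.
    by apply: sumr_ge0 => k _; exact: sqr_ge0.
  by apply: sumr_ge0 => k _; apply: sumr_ge0 => l _; exact: sqr_ge0.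
pose k (ij : 'I_r * 'I_M) := Num.truncn (`|D ij.1 ij.2| / h).
have q0 ij : 0 <= `|D ij.1 ij.2| / h by rewrite divr_ge0// ltW.
have kn ij : (k ij < n.+1)%N.
  rewrite ltnS /k /n; apply: le_truncn.
  by rewrite ler_pdivrMr// mulVf ?gt_eqF.
pose z : Z := [ffun ij => (D ij.1 ij.2 < 0, inord (k ij))].
have ptE i j : pt z i j = (-1) ^+ (D i j < 0)%R * ((k (i, j))%:R * h).
  by rewrite mxE ffunE/= inordK.
have kle ij : (k ij)%:R * h <= `|D ij.1 ij.2|.
  by rewrite -ler_pdivlMr// /k truncn_le.
have kgt ij : `|D ij.1 ij.2| <= (k ij)%:R * h + h.
  have := truncnS_gt (`|D ij.1 ij.2| / h); rewrite ltr_pdivrMr// -natr1.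
  rewrite -/(k ij) mulrDl mul1r; exact: ltW.
have dist i j : `|(D - pt z) i j| <= h.
  have := kle (i, j); have := kgt (i, j); rewrite /= !mxE ffunE/= inordK//.
  case: (ltrP (D i j) 0) => Ds; rewrite /= ?expr1 ?expr0.
    by rewrite ltr0_norm// ler_norml => h1 h2; lra.
  by rewrite ger0_norm// ler_norml => h1 h2; lra.
have ptle i j : `|pt z i j| <= `|D i j|.
  rewrite ptE normrM normr_sign mul1r ger0_norm; first exact: (kle (i, j)).
  by rewrite mulr_ge0// ltW.
have dz : l2norm (D - pt z) <= eps.
  rewrite -ler_sqr ?nnegrE ?l2norm_ge0 ?(ltW eps0)// l2norm_sqr_pair.
  apply: (@le_trans _ _ (\sum_(ij : 'I_r * 'I_M) h ^+ 2)).
    apply: ler_sum => ij _; rewrite -[leLHS]real_normK ?num_real//.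
    by rewrite ler_sqr ?nnegrE ?(ltW h0).
  rewrite sumr_const card_prod !card_ord -mulr_natl -/d /h expr_div_n sqr_sqrtr ?(ltW d0)//.
  by rewrite mulrC divfK ?gt_eqF.
exists (pt z) => //; apply/mapP; exists z => //; rewrite mem_enum.
apply/and3P; split.
- have : \sum_ij (z ij).2%:R * h <= Num.sqrt d * 1 :> R.
    rewrite -{2}D1; apply: le_trans (l2norm_entry_sum_le D).
    rewrite pair_big/=; apply: ler_sum => ij _.
    by rewrite ffunE/= inordK.
  rewrite -mulr_suml mulr1 -ler_pdivlMr//.
  rewrite /h invf_div mulrA -expr2 sqr_sqrtr ?(ltW d0)//.
  by rewrite ler_pdivlMr// mulrC.
- rewrite -D1 -ler_sqr ?nnegrE ?l2norm_ge0// !l2norm_sqr_pair.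
  apply: ler_sum => ij _; rewrite -[leLHS]real_normK ?num_real//.
  by rewrite -[leRHS]real_normK ?num_real// ler_sqr ?nnegrE.
- have := l2normB_ge D (pt z); rewrite D1.
  have := eps2; lra.
Qed.
End SphereNet.

(** * Estimation error *)

(** Bernoulli's inequality: [(1 - p) ^+ tau >= 1 - tau * p > 1/2]. *)
Lemma attack_gap_gt0 (R : realType) (p : R) (tau : nat) : (0 < tau)%N ->
  0 <= p -> p < 1 / (2 * tau%:R) -> p <= 1 /\ 0 < attack_gap p tau.
Proof.
move=> t0 p0; have tR : 0 < tau%:R :> R by rewrite ltr0n.
rewrite ltr_pdivlMr ?mulr_gt0// => hp.
have t1 : 1 <= tau%:R :> R by rewrite ler1n.
have p1 : p <= 1.
  have := ler_wpM2l p0 t1; lra.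
split => //; have bern (k : nat) : 1 - k%:R * p <= (1 - p) ^+ k.
  elim: k => [|k IH]; first by rewrite mul0r subr0 expr0.
  rewrite exprS; apply: le_trans (ler_wpM2l _ IH); last by rewrite subr_ge0.
  rewrite -natr1; have : 0 <= k%:R * (p * p) :> R by rewrite !mulr_ge0.
  lra.
rewrite /attack_gap; have := bern tau; lra.
Qed.

(** * Failure probabilities at the given horizon *)

Section FailureBudget.
Variables (R : realType) (nu kap delta : R) (r M tau T : nat).
Hypotheses (nu4 : 4^-1 <= nu) (kap0 : 0 < kap) (kap1 : kap <= 1)
  (tau0 : (0 < tau)%N) (r0 : (0 < r)%N) (M0 : (0 < M)%N)
  (delta0 : 0 < delta) (delta1 : delta <= 1)
  (hT : 2 ^+ 40 * horizon r M tau nu kap delta <= T%:R).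

Let nu0 : 0 < nu. Proof. by apply: lt_le_trans nu4; rewrite invr_gt0. Qed.
Let tR : 1 <= tau%:R :> R. Proof. by rewrite ler1n. Qed.
Let tR0 : 0 < tau%:R :> R. Proof. by rewrite ltr0n. Qed.
Let Lg : R := Num.max 1 (ln (tau%:R * nu / kap)).
Let Lg1 : 1 <= Lg. Proof. by rewrite /Lg le_max lexx. Qed.
Let d : R := r%:R * M%:R.
Let d1 : 1 <= d.
Proof. by rewrite /d -natrM ler1n muln_gt0 r0. Qed.
Let l0 : 0 <= ln (1 / delta).
Proof. by apply: ln_ge0; rewrite ler_pdivlMr// mul1r. Qed.
Let H := d * Lg + ln (1 / delta).
Let dL : 1 <= d * Lg.
Proof. by rewrite -[leLHS]mulr1 ler_pM. Qed.
Let H1 : 1 <= H.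
Proof. by have := dL; have := l0; rewrite /H; lra. Qed.

(** Three exceptional events share the budget [delta]. The logarithmic part of [H] pays for [delta],
    and the rest, being at least 1, pays for the factor 3 through [expR (- 3) <= 1/3]. *)
Let delta_le (c : R) : 3 * H <= c -> expR (- c) <= delta / 3.
Proof.
move=> hc.
have -> : delta = expR (- ln (1 / delta)).
  by rewrite expRN lnK ?posrE ?divr_gt0// div1r invrK.
have e3 : expR (- 3) <= 3^-1 :> R.
  by rewrite expRN lef_pV2 ?posrE ?expR_gt0//; have := expR_ge1Dx (3 : R); lra.
apply: (@le_trans _ _ (expR (- ln (1 / delta)) * expR (- 3))).
  rewrite -expRD ler_expR; have := dL; have := l0; move: hc; rewrite /H; lra.
by rewrite ler_wpM2l ?expR_ge0.
Qed.

Let nu8 : 1 <= 2 ^+ 16 * (nu ^+ 8 / kap ^+ 2).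
Proof.
have n8 : (4^-1) ^+ 8 <= nu ^+ 8 by rewrite lerXn2r// nnegrE ?invr_ge0// ltW.
have k2 : kap ^+ 2 <= 1 by rewrite exprn_ile1// ltW.
have k20 : 0 < kap ^+ 2 by rewrite exprn_gt0.
rewrite mulrA ler_pdivlMr// mul1r; apply: le_trans k2 _.
have e : 2 ^+ 16 * (4^-1) ^+ 8 = 1 :> R by field.
apply: (@le_trans _ _ (2 ^+ 16 * (4^-1) ^+ 8)); first by rewrite e.
by rewrite ler_pM2l.
Qed.

Let T_ge : 2 ^+ 40 * (tau%:R * (nu ^+ 8 / kap ^+ 2)) * H <= T%:R.
Proof. by move: hT; rewrite /horizon -/Lg -/d -/H !mulrA. Qed.

Let T_ge_H : 2 ^+ 24 * (tau%:R * H) <= T%:R.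
Proof.
apply: le_trans T_ge.
have -> : 2 ^+ 40 * (tau%:R * (nu ^+ 8 / kap ^+ 2)) * H =
  (2 ^+ 24 * (tau%:R * H)) * (2 ^+ 16 * (nu ^+ 8 / kap ^+ 2)) by ring.
apply: ler_peMr nu8; rewrite mulr_ge0 ?exprn_ge0// mulr_ge0//.
exact: le_trans H1.
Qed.

Lemma horizon_ge_2tau : 2 * tau%:R <= T%:R :> R.
Proof.
apply: le_trans T_ge_H; have := ler_wpM2l (ltW tR0) H1; have := tR; lra.
Qed.

Lemma exp_horizon_le : expR (- T%:R) <= delta / 3.
Proof.
apply: delta_le; apply: le_trans T_ge_H.
have H0 : 0 <= H by exact: le_trans H1.
have := ler_wpM2r H0 tR; have := H1; lra.
Qed.

(** The logarithm of the net size is at most [21 * d * Lg]: 18 for the factor [2 ^+ 17 * expR 1],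
    and 3 because [nu ^+ 3 / kap <= (tau * nu / kap) ^+ 3]. The tail exponent is at least [24 * H]:
    the factor [2 ^+ 40] leaves [2 ^+ 9 * nu ^+ 2 * H], and [nu ^+ 2 >= 1/16]. The difference is at
    least [3 * H]. *)
Lemma net_failure_le :
  (4 * expR 1 / (kap / (2 ^+ 15 * nu ^+ 3))) ^+ (r * M) *
    expR (- (kap ^+ 2 / (2 ^+ 29 * nu ^+ 6) * (T - tau)%:R / tau.+1%:R)) <= delta / 3.
Proof.
have n3 : 0 < nu ^+ 3 by rewrite exprn_gt0.
have n6 : 0 < nu ^+ 6 by rewrite exprn_gt0.
have k3 : 0 < kap ^+ 3 by rewrite exprn_gt0.
have e2 : 2 <= expR 1 :> R by have := expR_ge1Dx (1 : R); lra.
have base : 4 * expR 1 / (kap / (2 ^+ 15 * nu ^+ 3)) <= expR (21 * Lg).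
  have -> : 4 * expR 1 / (kap / (2 ^+ 15 * nu ^+ 3)) =
      2 ^+ 17 * expR 1 * (nu ^+ 3 / kap).
    by field; rewrite !gt_eqF.
  have h1 : nu ^+ 3 / kap <= expR (3 * Lg).
    apply: (@le_trans _ _ ((tau%:R * nu / kap) ^+ 3)).
      rewrite expr_div_n exprMn ler_pM ?invr_ge0 ?(ltW kap0) ?(ltW n3)//.
        by apply: ler_peMl; [exact: ltW|exact: exprn_ege1].
      rewrite lef_pV2 ?posrE// exprS; apply: ler_piMr; first exact: ltW.
      by rewrite exprn_ile1// ltW.
    rewrite expRM_natl lerXn2r ?nnegrE ?expR_ge0//.
      by rewrite !mulr_ge0 ?invr_ge0// ltW.
    rewrite -[leLHS]lnK; last by rewrite posrE divr_gt0// mulr_gt0.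
    by rewrite ler_expR /Lg le_max lexx orbT.
  have h2 : 2 ^+ 17 * expR 1 <= expR (18 * Lg).
    apply: (@le_trans _ _ (expR 18)); last by rewrite ler_expR; have := Lg1; lra.
    have -> : expR 18 = expR 1 ^+ 17 * expR 1 :> R.
      by rewrite -expRM_natl -expRD; congr expR; lra.
    by rewrite ler_wpM2r ?expR_ge0// lerXn2r// nnegrE// expR_ge0.
  have -> : 21 * Lg = 18 * Lg + 3 * Lg by lra.
  rewrite expRD; apply: ler_pM h2 h1; first by rewrite mulr_ge0 ?expR_ge0 ?exprn_ge0.
  by apply: divr_ge0; exact: ltW.
have base0 : 0 <= 4 * expR 1 / (kap / (2 ^+ 15 * nu ^+ 3)).
  by rewrite !mulr_ge0 ?expR_ge0// invr_ge0 divr_ge0 ?(ltW kap0)// mulr_ge0// ltW.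
have hA : (4 * expR 1 / (kap / (2 ^+ 15 * nu ^+ 3))) ^+ (r * M) <= expR (21 * (d * Lg)).
  apply: (@le_trans _ _ (expR (21 * Lg) ^+ (r * M))).
    by rewrite lerXn2r// nnegrE expR_ge0.
  by rewrite -expRM_natl ler_expR natrM -/d; lra.
have hB : 24 * H <= kap ^+ 2 / (2 ^+ 29 * nu ^+ 6) * (T - tau)%:R / tau.+1%:R.
  have tauT : (tau <= T)%N.
    by rewrite -(ler_nat R); have := horizon_ge_2tau; have := tR; lra.
  have hTt : T%:R / (4 * tau%:R) <= (T - tau)%:R / tau.+1%:R :> R.
    rewrite natrB// -natr1 ler_pdivlMr ?ltr_wpDl// mulrAC ler_pdivrMr ?mulr_gt0//.
    have h1 := horizon_ge_2tau.
    have a1 : T%:R * (tau%:R + 1) <= T%:R * (2 * tau%:R) :> R.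
      by rewrite ler_wpM2l//; have := tR; lra.
    have a2 : T%:R / 2 * (4 * tau%:R) <= (T%:R - tau%:R) * (4 * tau%:R) :> R.
      by rewrite ler_wpM2r ?mulr_ge0//; lra.
    lra.
  have kn0 : 0 <= kap ^+ 2 / (2 ^+ 29 * nu ^+ 6).
    by rewrite divr_ge0 ?sqr_ge0// mulr_ge0 ?exprn_ge0// ltW.
  rewrite -mulrA; apply: le_trans (ler_wpM2l kn0 hTt).
  have c0 : 0 <= kap ^+ 2 / (2 ^+ 29 * nu ^+ 6) / (4 * tau%:R).
    by rewrite divr_ge0// mulr_ge0.
  have := ler_wpM2l c0 T_ge.
  have -> : kap ^+ 2 / (2 ^+ 29 * nu ^+ 6) / (4 * tau%:R) *
     (2 ^+ 40 * (tau%:R * (nu ^+ 8 / kap ^+ 2)) * H) = 2 ^+ 9 * nu ^+ 2 * H.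
    by field; rewrite !gt_eqF.
  have -> : kap ^+ 2 / (2 ^+ 29 * nu ^+ 6) * (T%:R / (4 * tau%:R)) =
     kap ^+ 2 / (2 ^+ 29 * nu ^+ 6) / (4 * tau%:R) * T%:R.
    by field; rewrite !gt_eqF.
  apply: le_trans; rewrite ler_wpM2r//; first exact: le_trans H1.
  have : (4^-1) ^+ 2 <= nu ^+ 2 by rewrite lerXn2r// nnegrE ?invr_ge0// ltW.
  lra.
apply: (@le_trans _ _ (expR (21 * (d * Lg)) * expR (- (24 * H)))).
  by rewrite ler_pM ?exprn_ge0 ?expR_ge0// ler_expR lerN2.
rewrite -expRD -[X in expR X]opprK; apply: delta_le.
have := l0; rewrite /H; lra.
Qed.

End FailureBudget.

(** * Deterministic inequalities and the final assembly *)

Lemma flow_trajectory (R : realType) (n m d T : nat)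
    (f : 'cV[R]_n -> 'cV[R]_m -> 'cV[R]_d -> 'cV[R]_n)
    (x : nat -> 'cV[R]_n) (u : nat -> 'cV[R]_m) (w : nat -> 'cV[R]_d) (a k : nat) :
  (forall t, (t < T)%N -> x t.+1 = f (x t) (u t) (w t)) -> (a + k <= T)%N ->
  x (a + k)%N = flow f k (x a) (fun j => u (a + j)%N) (fun j => w (a + j)%N).
Proof.
move=> dyn; elim: k => [|k IH] akT; first by rewrite addn0.
by rewrite addnS in akT *; rewrite dyn// IH// ltnW.
Qed.

(** Each signed term is at most the loss difference between [G'] and [G], plus twice the residual
    bound when the sign is 1. When it is -1 the reverse triangle inequality suffices and the
    residual of [G] is never estimated. Optimality discards the summed differences. *)
Lemma minimizer_signed_le (R : realType) (r M : nat) (I : finType) (q : pred I)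
    (ys : I -> 'cV[R]_r) (Z : I -> 'cV[R]_M) (G G' : 'M[R]_(r, M)) (s a : I -> R) :
  \sum_(t | q t) l2norm (ys t - G' *m Z t) <= \sum_(t | q t) l2norm (ys t - G *m Z t) ->
  (forall t, q t -> s t = 1 /\ l2norm (ys t - G *m Z t) <= a t \/ s t = - 1) ->
  (forall t, q t -> 0 <= a t) ->
  \sum_(t | q t) l2norm ((G - G') *m Z t) * s t <= 2 * \sum_(t | q t) a t.
Proof.
move=> opt sgn a0.
have step t : q t -> l2norm ((G - G') *m Z t) * s t <=
    l2norm (ys t - G' *m Z t) - l2norm (ys t - G *m Z t) + 2 * a t.
  move=> qt; have at0 := a0 t qt.
  have e : (G - G') *m Z t = (ys t - G' *m Z t) - (ys t - G *m Z t).
    by rewrite mulmxBl opprB [RHS]addrC addrA subrK.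
  case: (sgn t qt) => [[-> h]|->].
    have := l2normD (ys t - G' *m Z t) (- (ys t - G *m Z t)).
    rewrite -e l2normN; lra.
  have := l2normD ((G - G') *m Z t) (ys t - G' *m Z t).
  have := l2normB_ge (ys t - G *m Z t) (ys t - G' *m Z t).
  rewrite l2norm_dist -e; lra.
apply: le_trans (ler_sum _ step) _.
rewrite big_split/= sumrB -mulr_sumr; lra.
Qed.

Lemma window_sum_le (R : realType) (T tau : nat) (v : nat -> R) :
  (forall s, 0 <= v s) ->
  \sum_(t < T | (tau <= t)%N) \sum_(j < tau.+1) v (t - j)%N <=
  tau.+1%:R * \sum_(s < T) v s.
Proof.
move=> v0; rewrite exchange_big/= mulr_natl -[X in _ *+ X]card_ord -sumr_const.
apply: ler_sum => j _.
have jt : (j <= tau)%N by rewrite -ltnS.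
rewrite -(big_geq_mkord tau T xpredT (fun t => v (t - j)%N)).
rewrite -(big_mkord xpredT v).
have [tauT|Ttau] := leqP T tau.
  by rewrite big_geq//; apply: sumr_ge0.
have -> : \sum_(tau <= t < T) v (t - j)%N = \sum_(tau - j <= t < T - j) v t.
  have -> : \sum_(tau <= t < T) v (t - j)%N =
      \sum_(tau - j + j <= t < T - j + j) v (t - j)%N.
    by rewrite !subnK// (leq_trans jt)// ltnW.
  rewrite big_addn addnK; apply: eq_bigr => t _; by rewrite addnK.
rewrite [leRHS](@big_cat_nat _ _ _ (tau - j))//=; last first.
  by rewrite (leq_trans (leq_subr _ _))// ltnW.
rewrite [X in _ <= _ + X](@big_cat_nat _ _ _ (T - j))//=; last 2 first.
- by rewrite leq_sub2r// ltnW.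
- exact: leq_subr.
by rewrite addrCA lerDl addr_ge0//; apply: sumr_ge0.
Qed.

Section UnionBound.
Context d (Omega : measurableType d) (R : realType) (P : probability Omega R).
Local Open Scope ereal_scope.

Lemma union_bound (I : eqType) (s : seq I) (B : I -> set Omega) (c : R) :
  (forall i, i \in s -> measurable (B i) /\ P (B i) <= c%:E) ->
  measurable (\big[setU/set0]_(i <- s) B i) /\
  P (\big[setU/set0]_(i <- s) B i) <= ((size s)%:R * c)%:E.
Proof.
elim: s => [|i s IH] h.
  by rewrite big_nil mul0r measure0.
have [mi Pi] := h i (mem_head _ _).
have [ms Ps] : measurable (\big[setU/set0]_(i <- s) B i) /\
    P (\big[setU/set0]_(i <- s) B i) <= ((size s)%:R * c)%:E.
  by apply: IH => j js; apply: h; rewrite inE js orbT.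
rewrite big_cons; split; first exact: measurableU.
apply: le_trans (measureU2 _ mi ms) _.
rewrite /= -natr1 mulrDl mul1r addrC EFinD; exact: leeD.
Qed.

End UnionBound.

Lemma attack_signP d (Omega : measurableType d) (R : realType)
    (P : probability Omega R) tau (xi : nat -> {RV P >-> bool}) t omega :
  (attack_sign tau xi t omega = 1 /\ clean tau xi t omega) \/
  attack_sign tau xi t omega = -1.
Proof.
rewrite /attack_sign indicE; case: (boolP (omega \in clean tau xi t)) => [/set_mem h|_].
  by left; split => //=; lra.
by right => /=; lra.
Qed.

(** As [tau] is positive, the largest index reached is at most [T - 2], so the sum may stop before
    [T.-1]. *)
Lemma shifted_sum_le (R : realType) (T tau : nat) (v : nat -> R) :
  (0 < tau)%N -> (forall s, 0 <= v s) ->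
  \sum_(t < T | (tau <= t)%N) v (t - tau)%N <= \sum_(s < T.-1) v s.
Proof.
move=> tau0 v0.
rewrite -(big_geq_mkord tau T xpredT (fun t => v (t - tau)%N)).
rewrite -{1}[tau]add0n big_addn.
under eq_bigr do rewrite addnK.
rewrite -(big_mkord xpredT v) [leRHS](@big_cat_nat _ _ _ (T - tau))//=; last by lia.
by rewrite lerDl; apply: sumr_ge0.
Qed.

(** Every input lies in at most [tau.+1] windows, so the energy bound gives [K ^+ 2 * T] for the
    squared feature norms. The inequality [z <= z ^+ 2 / (2 * K) + K / 2] then yields [K * T] for
    their sum. *)
Lemma feature_sum_le disp (Omega : measurableType disp) (R : realType)
    (m M tau T : nat) (U : set 'cV[R]_m) (phi : 'I_M -> 'M[R]_(m, tau.+1) -> R)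
    (u : nat -> Omega -> 'cV[R]_m) (Lphi lambda su : R) (omega : Omega) :
  (0 < tau)%N -> (0 < M)%N ->
  (forall t omega, (t < T)%N -> U (u t omega)) -> U 0 -> 0 < Lphi ->
  (forall i W W', in_windows U W -> in_windows U W' ->
    `|phi i W - phi i W'| <= Lphi * l2norm (W - W')) ->
  0 < lambda -> Phi phi 0 = 0 -> 0 < su ->
  \sum_(s < T) l2norm (u s omega) ^+ 2 / (2 * su) ^+ 2 <= 2 * T%:R ->
  \sum_(t < T | (tau <= t)%N) l2norm (feature phi u t omega) <=
    4 * (lambda * nu_ratio M tau Lphi su lambda) * T%:R.
Proof.
move=> tau0 M0 Uu U0 Lphi0 phiL lambda0 phi0 su0 hS.
set K := 4 * (lambda * nu_ratio M tau Lphi su lambda).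
have MR : 0 < M%:R :> R by rewrite ltr0n.
have tR : 1 <= tau%:R :> R by rewrite ler1n.
have K2 : K ^+ 2 = 16 * (M%:R * tau%:R * Lphi ^+ 2 * su ^+ 2).
  by rewrite -(nu_sq _ _ _ _ lambda0) /K; ring.
have K20 : 0 < K ^+ 2 by rewrite K2 !mulr_gt0 ?exprn_gt0// ltr0n.
have K0 : 0 < K.
  rewrite lt_neqAle eq_sym -sqrf_eq0 gt_eqF//=.
  apply: mulr_ge0 => //; apply: mulr_ge0; first exact: ltW.
  exact: nu_ge0.
have ML0 : 0 <= M%:R * Lphi ^+ 2 by rewrite mulr_ge0// sqr_ge0.
have E : \sum_(t < T | (tau <= t)%N) l2norm (feature phi u t omega) ^+ 2 <=
    K ^+ 2 * T%:R.
  apply: (@le_trans _ _ (M%:R * Lphi ^+ 2 * (tau.+1%:R *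
      \sum_(s < T) l2norm (u s omega) ^+ 2))).
    apply: (@le_trans _ _ (M%:R * Lphi ^+ 2 * \sum_(t < T | (tau <= t)%N)
        \sum_(j < tau.+1) l2norm (u (t - j)%N omega) ^+ 2)).
      rewrite mulr_sumr; apply: ler_sum => t tt.
      by apply: (feature_energy Uu U0 Lphi0 phiL phi0); rewrite tt ltn_ord.
    rewrite ler_wpM2l//.
    by apply: (@window_sum_le _ T tau (fun s => l2norm (u s omega) ^+ 2)) => s;
      exact: sqr_ge0.
  move: hS; rewrite -mulr_suml ler_pdivrMr ?exprn_gt0 ?mulr_gt0// => hS.
  have t1 : tau.+1%:R <= 2 * tau%:R :> R by rewrite -natr1; lra.
  apply: (@le_trans _ _ (M%:R * Lphi ^+ 2 * (2 * tau%:R * (2 * T%:R * (2 * su) ^+ 2)))).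
    rewrite ler_wpM2l// ler_pM//.
    by apply: sumr_ge0 => s _; exact: sqr_ge0.
  by rewrite K2 le_eqVlt; apply/orP; left; apply/eqP; ring.
have term (t : 'I_T) : l2norm (feature phi u t omega) <=
    (2 * K)^-1 * l2norm (feature phi u t omega) ^+ 2 + K / 2.
  set z := l2norm _.
  have -> : (2 * K)^-1 * z ^+ 2 + K / 2 = z + (z - K) ^+ 2 / (2 * K).
    by field; rewrite gt_eqF.
  by rewrite lerDl divr_ge0 ?sqr_ge0// mulr_ge0// ltW.
apply: le_trans (ler_sum _ (fun t _ => term t)) _.
rewrite big_split/= -mulr_sumr.
have h1 : \sum_(t < T | (tau <= t)%N) K / 2 <= K / 2 * T%:R.
  rewrite big_mkcond/= mulr_natr -[X in _ <= _ *+ X](card_ord T) -sumr_const.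
  by apply: ler_sum => t _; case: ifP => // _; rewrite divr_ge0// ltW.
have k20 : 0 <= (2 * K)^-1 by rewrite invr_ge0 mulr_ge0// ltW.
have h2 := ler_wpM2l k20 E.
have e : (2 * K)^-1 * (K ^+ 2 * T%:R) = K / 2 * T%:R by field; rewrite gt_eqF.
lra.
Qed.

(** Division gives a bound with [nu ^+ 2 / kap] and constant [2 ^+ 14]; multiplying by [4 * nu >= 1]
    brings it to the stated rate and accounts for the factor [2 ^+ 16]. *)
Lemma error_rate_of_signed_bound (R : realType) (C C1 L lambda nu kap rt S epsbar T D : R) :
  0 < C -> C <= C1 -> 1 <= C1 -> 0 < L -> 0 < lambda -> 4^-1 <= nu -> 0 < kap ->
  0 <= rt -> 0 <= S -> 0 <= epsbar -> 0 < T ->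
  D * (lambda * kap / (2 ^+ 13 * nu ^+ 2) * T) <=
    2 * (L * C * rt * (6 * C1 * S * T) + epsbar * T) ->
  D <= 2 ^+ 16 * 6 * C1 ^+ 2 * ((rt * L / lambda * S + epsbar / lambda) * (nu ^+ 3 / kap)).
Proof.
move=> C0 CC1 C11 L0 l0 nu4 k0 rt0 S0 e0 T0 h.
have nu0 : 0 < nu by apply: lt_le_trans nu4; rewrite invr_gt0.
have n2 : 0 < nu ^+ 2 by rewrite exprn_gt0.
have C10 : 0 < C1 by apply: lt_le_trans C11.
pose Y := L * rt * S + epsbar.
have Y0 : 0 <= Y by rewrite /Y addr_ge0// !mulr_ge0// ltW.
have Lr0 : 0 <= L * rt * S by rewrite !mulr_ge0// ltW.
have hY : L * C * rt * (6 * C1 * S) + epsbar <= 6 * C1 ^+ 2 * Y.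
  have a1 : L * C * rt * (6 * C1 * S) <= 6 * C1 ^+ 2 * (L * rt * S).
    have -> : L * C * rt * (6 * C1 * S) = 6 * C1 * (L * rt * S) * C by ring.
    have -> : 6 * C1 ^+ 2 * (L * rt * S) = 6 * C1 * (L * rt * S) * C1 by ring.
    by rewrite ler_wpM2l// mulr_ge0// mulr_ge0// ltW.
  have a2 : epsbar <= 6 * C1 ^+ 2 * epsbar.
    rewrite ler_peMl//; have := exprn_ege1 2 C11; lra.
  rewrite /Y mulrDr; lra.
have h2 : D * (lambda * kap / (2 ^+ 13 * nu ^+ 2)) <= 2 * (6 * C1 ^+ 2 * Y).
  rewrite -(ler_pM2r T0).
  have := ler_wpM2r (ltW T0) hY; move: h; lra.
have c0 : 0 < lambda * kap / (2 ^+ 13 * nu ^+ 2).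
  by rewrite divr_gt0 ?mulr_gt0// exprn_gt0.
have h3 : D <= 2 * (6 * C1 ^+ 2 * Y) / (lambda * kap / (2 ^+ 13 * nu ^+ 2)).
  by rewrite ler_pdivlMr.
apply: le_trans h3 _.
have -> : 2 * (6 * C1 ^+ 2 * Y) / (lambda * kap / (2 ^+ 13 * nu ^+ 2)) =
    2 ^+ 14 * 6 * C1 ^+ 2 * Y / (lambda * kap) * nu ^+ 2.
  by field; rewrite !gt_eqF.
have -> : 2 ^+ 16 * 6 * C1 ^+ 2 *
    ((rt * L / lambda * S + epsbar / lambda) * (nu ^+ 3 / kap)) =
    2 ^+ 14 * 6 * C1 ^+ 2 * Y / (lambda * kap) * (4 * nu ^+ 3).
  by rewrite /Y; field; rewrite !gt_eqF.
apply: ler_wpM2l.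
  apply: divr_ge0; last by rewrite mulr_ge0// ltW.
  by rewrite !mulr_ge0// ?exprn_ge0// ltW.
have := ler_wpM2l (ltW n2) nu4; rewrite -exprSr; lra.
Qed.

Theorem theorem3p1 (R : realType) (C : R) (hC : 0 < C) :
  exists c1 c2 : R, 0 < c1 /\ 0 < c2 /\
  forall (disp : measure_display) (Omega : measurableType disp)
    (P : probability Omega R)
    (n m d r M tau T : nat)
    (f : 'cV[R]_n -> 'cV[R]_m -> 'cV[R]_d -> 'cV[R]_n)
    (g : 'cV[R]_n -> 'cV[R]_m -> 'cV[R]_r)
    (U : set 'cV[R]_m)
    (phi : 'I_M -> 'M[R]_(m, tau.+1) -> R)
    (x : nat -> Omega -> 'cV[R]_n) (u : nat -> Omega -> 'cV[R]_m)
    (w : nat -> Omega -> 'cV[R]_d) (y : nat -> Omega -> 'cV[R]_r)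
    (L rho Lphi lambda su sw p epsbar delta : R)
    (Gstar : 'M[R]_(r, M)) (eps : nat -> 'M[R]_(m, tau.+1) -> 'cV[R]_r)
    (Ghat : Omega -> 'M[R]_(r, M)),
  (0 < tau)%N -> (tau < T)%N ->
  (* the system *)
  (forall t, (t < T)%N -> random_vector (x t)) ->
  (forall t, (t < T)%N -> random_vector (u t)) ->
  (forall t, (t < T)%N -> random_vector (w t)) ->
  (forall t omega, (t < T)%N -> U (u t omega)) ->
  (forall t omega, (t < T)%N ->
    x t.+1 omega = f (x t omega) (u t omega) (w t omega)) ->
  (forall t omega, (t < T)%N -> y t omega = g (x t omega) (u t omega)) ->
  (* Lipschitz continuity *)
  0 < L -> lipschitz_observation g U L ->
  0 < rho -> rho < 1 -> contracting_dynamics f U C rho ->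
  U 0 -> f 0 0 0 = 0 ->
  (* basis functions *)
  0 < Lphi ->
  (forall i W W', in_windows U W -> in_windows U W' ->
    `|phi i W - phi i W'| <= Lphi * l2norm (W - W')) ->
  0 < lambda ->
  (forall t, (tau <= t < T)%N ->
    psd (second_moment P
           (fun omega => Phi phi (window tau (fun s => u s omega) t))
         - (lambda ^+ 2)%:M)) ->
  Phi phi 0 = 0 ->
  (* sub-Gaussian control inputs *)
  mutual_independence P (fun t : 'I_T => sigma_vec [set t : nat] u) ->
  (forall t, (t < T)%N ->
    independent2 P (sigma_vec [set t] u) (filtration x t)) ->
  0 < su ->
  (forall t, (t < T)%N -> subgaussian_le P (u t) su) ->
  (* sub-Gaussian disturbances *)
  0 < sw ->
  subgaussian_le P (x 0%N) sw ->
  (forall t, (t < T)%N ->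
    cond_subgaussian_le P (filtration x t) (w t) sw) ->
  (* probabilistic adversarial attack *)
  0 <= p -> p < 1 / (2 * tau%:R) ->
  probabilistic_attack P T x u w p ->
  (* approximation by the basis functions, and the estimator *)
  0 <= epsbar ->
  (forall t omega, (tau <= t < T)%N ->
    g (flow f tau 0 (fun j => u (t - tau + j)%N omega) (fun=> 0)) (u t omega)
      = Gstar *m Phi phi (window tau (fun s => u s omega) t)
        + eps t (window tau (fun s => u s omega) t)) ->
  (forall t omega, (tau <= t < T)%N ->
    l2norm (eps t (window tau (fun s => u s omega) t)) <= epsbar) ->
  (forall omega, l2_minimizer T phi (fun t => y t omega) (fun t => u t omega)
                   (Ghat omega)) ->
  0 < delta -> delta <= 1 ->
  c1 * horizon r M tau (nu_ratio M tau Lphi su lambda) (attack_gap p tau) delta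
    <= T%:R ->
  with_probability_ge P (1 - delta)
    [set omega | l2norm (Gstar - Ghat omega) <=
      c2 * error_rate tau rho L lambda su sw epsbar
             (nu_ratio M tau Lphi su lambda) (attack_gap p tau)].
Proof.
(* Zero-step flows are only Lipschitz with constant 1. *)
set C1 := Num.max 1 C.
have C11 : 1 <= C1 by rewrite /C1 le_max lexx.
have CC1 : C <= C1 by rewrite /C1 le_max lexx orbT.
have C10 : 0 < C1 by apply: lt_le_trans C11.
exists (2 ^+ 40), (2 ^+ 16 * 6 * C1 ^+ 2); split; first by rewrite exprn_gt0.
split; first by rewrite !mulr_gt0 ?exprn_gt0.
move=> disp Omega P n m d r M tau T f g U phi x u w y L rho Lphi lambda su sw p epsbar delta
  Gstar eps Ghat tau0 tauT mx mu mw Uu dyn obs L0 gL rho0 rho1 contr U0 f0 Lphi0 phiL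
  lambda0 excite phi0 indu indux su0 sgu sw0 sgx sgw p0 phalf
  [xi [dxi indxi indxiu _ wxi]] eb0 approx approxle opt delta0 delta1 hT.
have [p1 kap0] := attack_gap_gt0 tau0 p0 phalf.
set nu := nu_ratio M tau Lphi su lambda in hT *.
set kap := attack_gap p tau in kap0 hT *.
have kap1 : kap <= 1 by exact: attack_gap_le1.
have nu_ge : 0 <= nu by exact: nu_ge0.
have err0 : 0 <= 2 ^+ 16 * 6 * C1 ^+ 2 *
    error_rate tau rho L lambda su sw epsbar nu kap.
  rewrite /error_rate mulr_ge0//.
    by rewrite !mulr_ge0// ?exprn_ge0// ltW.
  rewrite mulr_ge0//; last by rewrite divr_ge0 ?exprn_ge0// ltW.
  rewrite addr_ge0 ?divr_ge0// ?(ltW lambda0)//.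
  rewrite mulr_ge0// ?divr_ge0 ?mulr_ge0 ?exprn_ge0 ?(ltW rho0) ?(ltW L0) ?(ltW lambda0)//.
    by rewrite addr_ge0// ltW.
  by rewrite subr_ge0 ltW.
(* Without entries the error is zero; this case is split off because [nu >= 1/4] rests on a matrix
   of norm 1. *)
have [rM0|rM] := boolP ((r == 0%N) || (M == 0%N)).
  exists setT; split => //; last first.
    rewrite probability_setT lee_fin; lra.
  move=> omega _ /=.
  have -> : Gstar - Ghat omega = 0.
    apply/matrixP => i j; exfalso; case/orP: rM0 => /eqP e.
      by move: (ltn_ord i); rewrite {2}e.
    by move: (ltn_ord j); rewrite {2}e.
  by rewrite l2norm0.
move: rM; rewrite negb_or -!lt0n => /andP[r0 M0].
have nu4 : 4^-1 <= nu.
  exact: (nu_ge_quarter tau0 tauT mu Uu U0 Lphi0 phiL lambda0 excite phi0 su0 sgu r0 M0).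
have nu0 : 0 < nu by apply: lt_le_trans nu4; rewrite invr_gt0.
have n3 : 0 < nu ^+ 3 by rewrite exprn_gt0.
have T0 : (0 < T)%N by exact: leq_ltn_trans tauT.
have TN : T.-1.+1 = T by rewrite prednK.
(* With this mesh, moving to a net point changes the signed sum by at most
   [lambda * kap / (2 ^+ 13 * nu ^+ 2) * T], half of the lower bound for [thr]. *)
pose e := kap / (2 ^+ 15 * nu ^+ 3).
have e0 : 0 < e by rewrite divr_gt0// mulr_gt0.
have e2 : e <= 2^-1.
  rewrite ler_pdivrMr; last by rewrite mulr_gt0.
  have n64 : (4^-1) ^+ 3 <= nu ^+ 3 by rewrite lerXn2r// nnegrE ?invr_ge0// ltW.
  lra.
have [net [net_size net_norm net_near]] := sphere_net r0 M0 e0 e2.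
pose signed (E : 'M[R]_(r, M)) omega := \sum_(t < T | (tau <= t)%N)
  l2norm (E *m feature phi u t omega) * attack_sign tau xi t omega.
pose thr := lambda * kap / (2 ^+ 11 * nu ^+ 2) * (T - tau)%:R.
pose B1 := \big[setU/set0]_(E <- net) [set omega | signed E omega <= thr].
pose B2 := [set omega | 2 * T%:R <=
  \sum_(s < T) l2norm (u s omega) ^+ 2 / (2 * su) ^+ 2].
(* The growth bound for [N] steps involves [x N], and the states are random vectors only before time
   [T]; [N = T.-1] still covers every [x (t - tau)]. *)
pose B3 := [set omega | 6 * C1 * (su + sw) / (1 - rho) * T.-1.+1%:R <=
  \sum_(s < T.-1) l2norm (x s omega)].
have [mB1 PB1] : measurable B1 /\ (P B1 <= ((size net)%:R *
    expR (- (kap ^+ 2 / (2 ^+ 29 * nu ^+ 6) * (T - tau)%:R / tau.+1%:R)))%:E)%E.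
  apply: union_bound => E /net_norm/andP[E1 E2].
  exact: (signed_sum_tail tau0 tauT mu Uu U0 Lphi0 phiL lambda0 excite phi0 indu su0 sgu
    p0 p1 dxi indxi indxiu kap0 M0 r0 E2 E1).
have [mB2 PB2] : measurable B2 /\ (P B2 <= (expR (- T%:R))%:E)%E.
  exact: (input_energy_tail mu indu su0 sgu).
have ltT t : (t < T.-1)%N -> (t < T)%N by move=> h; rewrite -TN ltnW.
have [mB3 PB3] : measurable B3 /\ (P B3 <= (expR (- T.-1.+1%:R))%:E)%E.
  apply: (@state_sum_tail _ _ _ P n m d T.-1 f U C1 rho su sw x u w) => //.
  - move=> k z z' us us' ws ws' k0 hU hus.
    apply: le_trans (contr k z z' us us' ws ws' k0 hU hus) _.
    apply: ler_wpM2r; first by rewrite !addr_ge0 ?l2norm_ge0.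
    by apply: ler_wpM2r => //; rewrite exprn_ge0// ltW.
  - by move=> t tN; apply: mx; rewrite -TN ltnS.
  - by move=> t tN; apply: mu; exact: ltT.
  - by move=> t tN; apply: mw; exact: ltT.
  - by move=> t omega tN; apply: Uu; exact: ltT.
  - by move=> t omega tN; apply: dyn; exact: ltT.
  - by move=> t tN; apply: indux; exact: ltT.
  - by move=> t tN; apply: sgu; exact: ltT.
  - by move=> t tN; apply: sgw; exact: ltT.
rewrite TN in PB3.
pose B := B1 `|` B2 `|` B3.
have mB : measurable B by apply: measurableU => //; exact: measurableU.
have PB : (P B <= delta%:E)%E.
  have f1 : (P B1 <= (delta / 3)%:E)%E.
    apply: le_trans PB1 _; rewrite lee_fin.
    apply: le_trans (net_failure_le nu4 kap0 kap1 tau0 r0 M0 delta0 delta1 hT).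
    by rewrite ler_wpM2r ?expR_ge0.
  have fT : ((expR (- T%:R))%:E <= (delta / 3)%:E :> \bar R)%E.
    rewrite lee_fin.
    exact: (exp_horizon_le nu4 kap0 kap1 tau0 r0 M0 delta0 delta1 hT).
  have f2 := le_trans PB2 fT; have f3 := le_trans PB3 fT.
  apply: le_trans (measureU2 _ (measurableU _ _ mB1 mB2) mB3) _.
  apply: le_trans (leeD (le_trans (measureU2 _ mB1 mB2) (leeD f1 f2)) f3) _.
  by rewrite -!EFinD lee_fin; lra.
(* [Ghat] need not be measurable in [omega]; the complement of [B] is a measurable event contained
   in the error event. *)
exists (~` B); split; first exact: measurableC.
  2: by rewrite probability_setC// EFinB leeB.
move=> omega /=; rewrite /B -/(not _) => nB.
have nB1 E : E \in net -> thr < signed E omega.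
  move=> En; rewrite ltNge; apply/negP => h; apply: nB; left; left.
  by rewrite /B1 -bigcup_seq; exists E.
have nB2 : \sum_(s < T) l2norm (u s omega) ^+ 2 / (2 * su) ^+ 2 <= 2 * T%:R.
  by apply/ltW; rewrite ltNge; apply/negP => h; apply: nB; left; right.
have nB3 : \sum_(s < T.-1) l2norm (x s omega) <=
    6 * C1 * (su + sw) / (1 - rho) * T%:R.
  by apply/ltW; rewrite ltNge -[in T%:R]TN; apply/negP => h; apply: nB; right.
pose Z t := feature phi u t omega.
pose a t := L * C * rho ^+ tau * l2norm (x (t - tau)%N omega) + epsbar.
have LCr0 : 0 <= L * C * rho ^+ tau by rewrite !mulr_ge0 ?exprn_ge0// ltW.
have a0 t : 0 <= a t by rewrite addr_ge0// mulr_ge0// l2norm_ge0.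
have residual t : (tau <= t < T)%N -> clean tau xi t omega ->
    l2norm (y t omega - Gstar *m Z t) <= a t.
  move=> /andP[tt tT] cl.
  have w0 s : (t - tau <= s < t)%N -> w s omega = 0.
    move=> st; apply: wxi; first by apply: ltn_trans tT; case/andP: st.
    by apply: (cl s); rewrite /= !inE mem_iota subnK.
  have xt : x t omega = flow f tau (x (t - tau)%N omega)
      (fun j => u (t - tau + j)%N omega) (fun j => w (t - tau + j)%N omega).
    rewrite -[in LHS](subnK tt).
    apply: (@flow_trajectory _ _ _ _ T f (fun s => x s omega) (fun s => u s omega)
      (fun s => w s omega)); first by move=> s sT; exact: dyn.
    by rewrite subnK// ltnW.
  have tt' : (tau <= t < T)%N by rewrite tt.
  have UT s : (s < tau)%N -> U (u (t - tau + s)%N omega).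
    move=> st; apply: Uu; apply: ltn_trans tT.
    by rewrite -[X in (_ < X)%N](subnK tt) ltn_add2l.
  have w0' s : (s < tau)%N -> w (t - tau + s)%N omega = 0.
    by move=> st; apply: w0; rewrite leq_addr -[X in (_ < X)%N](subnK tt) ltn_add2l.
  set x0 := flow f tau 0 (fun j => u (t - tau + j)%N omega) (fun=> 0).
  (* On a clean window all disturbances vanish, so the true and the nominal flow differ only in
     their starting states [x (t - tau)] and 0. *)
  have dx : l2norm (x t omega - x0) <= C * rho ^+ tau * l2norm (x (t - tau)%N omega).
    have := @contr tau (x (t - tau)%N omega) 0 (fun j => u (t - tau + j)%N omega)
      (fun j => u (t - tau + j)%N omega) (fun j => w (t - tau + j)%N omega) (fun=> 0) tau0.
    rewrite /= -xt -/x0 w0'// !subrr !subr0 !l2norm0 !addr0; apply.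
      by move=> i it; split; exact: UT.
    by move=> i /andP[_ it]; rewrite w0'.
  have -> : y t omega - Gstar *m Z t =
      (g (x t omega) (u t omega) - g x0 (u t omega)) +
      eps t (window tau (fun s => u s omega) t).
    rewrite obs// /x0 approx// -/(feature phi u t omega) -/(Z t).
    by rewrite opprD addrA subrK.
  apply: le_trans (l2normD _ _) _; apply: lerD; last exact: approxle.
  apply: le_trans (gL _ _ _ _ (Uu t omega tT) (Uu t omega tT)) _.
  rewrite subrr l2norm0 addr0 -!mulrA ler_pM2l// mulrA.
  exact: dx.
pose D := Gstar - Ghat omega.
have signedD : signed D omega <= 2 * \sum_(t < T | (tau <= t)%N) a t.
  apply: (@minimizer_signed_le _ _ _ 'I_T (fun t : 'I_T => (tau <= t)%N)
    (fun t => y t omega) (fun t => Z t)).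
  - have := opt omega Gstar.
    by rewrite !(big_geq_mkord _ _ xpredT).
  - move=> t tt; case: (attack_signP tau xi t omega) => [[-> cl]|->]; last by right.
    by left; split => //; apply: residual => //; rewrite tt ltn_ord.
  - by move=> t _; exact: a0.
have suma : \sum_(t < T | (tau <= t)%N) a t <=
    L * C * rho ^+ tau * (6 * C1 * ((su + sw) / (1 - rho)) * T%:R) + epsbar * T%:R.
  rewrite big_split/= -mulr_sumr; apply: lerD.
    apply: ler_wpM2l => //.
    apply: le_trans (_ : \sum_(s < T.-1) l2norm (x s omega) <= _); last first.
      by apply: le_trans nB3 _; rewrite !mulrA.
    apply: (@shifted_sum_le _ T tau (fun s => l2norm (x s omega)) tau0).
    by move=> s; exact: l2norm_ge0.
  rewrite big_mkcond/= mulr_natr -[X in _ <= _ *+ X](card_ord T) -sumr_const.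
  by apply: ler_sum => t _; case: ifP.
apply: (@error_rate_of_signed_bound _ C C1 L lambda nu kap (rho ^+ tau) ((su + sw) / (1 - rho)) epsbar
  T%:R) => //.
- by rewrite exprn_ge0// ltW.
- apply: divr_ge0; first by apply: addr_ge0; exact: ltW.
  by rewrite subr_ge0 ltW.
- by rewrite ltr0n.
apply: le_trans (_ : signed D omega <= _); last first.
  by apply: le_trans signedD _; rewrite ler_wpM2l.
have [D0|Dn0] := eqVneq (l2norm D) 0.
  rewrite D0 mul0r; apply: sumr_ge0 => t _.
  by rewrite (l2norm_eq0 D0) mul0mx l2norm0 mul0r.
have Dpos : 0 < l2norm D by rewrite lt_neqAle eq_sym Dn0 l2norm_ge0.
(* The signed sum is homogeneous in the matrix, so the net is needed on the unit sphere only. *)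
pose D1 := (l2norm D)^-1 *: D.
have D1n : l2norm D1 = 1.
  by rewrite l2normZ ger0_norm ?invr_ge0 ?l2norm_ge0// mulVf.
have signedDE : signed D omega = l2norm D * signed D1 omega.
  rewrite /signed mulr_sumr; apply: eq_bigr => t _.
  rewrite -scalemxAl l2normZ ger0_norm ?invr_ge0 ?l2norm_ge0//.
  by rewrite !mulrA mulfV// mul1r.
rewrite signedDE ler_pM2l//.
have [E En DE] := net_near D1 D1n.
have close : signed E omega - e * (4 * (lambda * nu) * T%:R) <= signed D1 omega.
  have sZ := feature_sum_le tau0 M0 Uu U0 Lphi0 phiL lambda0 phi0 su0 nB2.
  apply: (@le_trans _ _ (signed E omega -
      e * \sum_(t < T | (tau <= t)%N) l2norm (feature phi u t omega))).
    by rewrite lerD2l lerN2 ler_wpM2l// ltW.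
  rewrite mulr_sumr /signed -sumrB; apply: ler_sum => t _.
  have h : l2norm ((D1 - E) *m feature phi u t omega) <=
      e * l2norm (feature phi u t omega).
    apply: le_trans (l2norm_mulmx _ _) _.
    by rewrite ler_wpM2r ?l2norm_ge0.
  have h1 := l2normB_ge (D1 *m feature phi u t omega) (E *m feature phi u t omega).
  have h2 := l2normB_ge (E *m feature phi u t omega) (D1 *m feature phi u t omega).
  rewrite (l2norm_dist (E *m _)) in h2; rewrite -mulmxBl in h1 h2.
  by case: (attack_signP tau xi t omega) => [[-> _]|->]; lra.
have T2 := horizon_ge_2tau nu4 kap0 kap1 tau0 r0 M0 delta0 delta1 hT.
have thrE := nB1 E En.
apply: le_trans close.
(* The horizon gives [T - tau >= T / 2], which turns [2 ^+ 11] into [2 ^+ 12]; subtracting the net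
   error turns it into [2 ^+ 13]. *)
have thr_ge : lambda * kap / (2 ^+ 12 * nu ^+ 2) * T%:R <= thr.
  rewrite /thr natrB; last exact: ltnW.
  have c0 : 0 <= lambda * kap / (2 ^+ 12 * nu ^+ 2).
    apply: divr_ge0; first by apply: mulr_ge0; exact: ltW.
    by apply: mulr_ge0; [exact: exprn_ge0|exact: sqr_ge0].
  have -> : lambda * kap / (2 ^+ 11 * nu ^+ 2) * (T%:R - tau%:R) =
      lambda * kap / (2 ^+ 12 * nu ^+ 2) * (2 * (T%:R - tau%:R)).
    by field; rewrite gt_eqF.
  by rewrite ler_wpM2l//; lra.
have eE : e * (4 * (lambda * nu) * T%:R) = lambda * kap / (2 ^+ 13 * nu ^+ 2) * T%:R.
  by rewrite /e; field; rewrite gt_eqF.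
have eT : lambda * kap / (2 ^+ 12 * nu ^+ 2) * T%:R =
    2 * (lambda * kap / (2 ^+ 13 * nu ^+ 2) * T%:R).
  by field; rewrite gt_eqF.
rewrite eE; rewrite eT in thr_ge; lra.
Qed.
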